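(* Let $n\ge1$, $m\ge0$, and let $\Omega\subseteq\mathbb C^{n+m}$ be a domain (not necessarily bounded) which is $n$-star-shaped Hartogs in the first $n$ variables $z=(z_1,\dots,z_n)$; write points as $(z,z')$ with $z'\in\mathbb C^m$. Let $\gamma=(\gamma_1,\dots,\gamma_n)$ with all $\gamma_j>0$ and put $$V^\gamma=\big\{(z,z',w)\in\mathbb C^{n+m}\times\mathbb C:\ (g_\gamma(z,w),z')\in\Omega\big\},\qquad g_\gamma(z,w)=\big(e^{\gamma_1|w|^2/2}z_1,\dots,e^{\gamma_n|w|^2/2}z_n\big).$$ For $\eta\in\mathbb C$ let $V^\gamma_\eta=\{(z,z')\in\mathbb C^{n+m}:(z,z',\eta)\in V^\gamma\}$ with Bergman kernel $K_{V^\gamma_\eta}$. Define $$l(z,w,\eta)=\big(z_1e^{\gamma_1(w\bar\eta-|\eta|^2)},\dots,z_ne^{\gamma_n(w\bar\eta-|\eta|^2)}\big),\qquad D_{V^\gamma}=\frac{e^{(\gamma\cdot\mathbf 1)(w\bar\eta-|\eta|^2)}}{\pi}\Big(\sum_{j=1}^n\gamma_j\Big(I+z_j\frac{\partial}{\partial z_j}\Big)\Big),$$ where $I$ is the identity and $\gamma\cdot\mathbf 1=\sum_j\gamma_j$. Then for all $(z,z',w;\zeta,\zeta',\eta)\in V^\gamma\times V^\gamma$, $$K_{V^\gamma}(z,z',w;\bar\zeta,\bar\zeta',\bar\eta)=D_{V^\gamma}\Big[K_{V^\gamma_\eta}\big(l(z,w,\eta),z';\bar\zeta,\bar\zeta'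\big)\Big].$$
   Context: A domain $\Omega\subseteq\mathbb C^{n+m}$ is called $n$-star-shaped Hartogs in $(z_1,\dots,z_n)$ if $(z_1,\dots,z_n,\zeta)\in\Omega$ implies $(\lambda_1z_1,\dots,\lambda_nz_n,\zeta)\in\Omega$ for all $\lambda_j\in\mathbb C$ with $|\lambda_j|\le1$. The Bergman kernel of a domain $D$ is the reproducing kernel of $A^2(D)$, the square-integrable holomorphic functions on $D$ (possibly the zero space). The differential operator acts on the function $(z,z',w)\mapsto K_{V^\gamma_\eta}(l(z,w,\eta),z';\bar\zeta,\bar\zeta')$, with $\partial/\partial z_j$ differentiating in $z_j$. *)

(* Defs.v *)
From HB Require Import structures.
From mathcomp Require Import all_boot all_order all_algebra.
From mathcomp Require Import all_classical all_reals all_analysis.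
From mathcomp Require Import complex.
Import Order.TTheory GRing.Theory Num.Theory.
Import numFieldTopology.Exports numFieldNormedType.Exports.

Set Implicit Arguments.
Unset Strict Implicit.
Unset Printing Implicit Defensive.

Local Open Scope ring_scope.
Local Open Scope complex_scope.
Local Open Scope classical_set_scope.

Definition cabs2 {R : realType} (z : R[i]) : R := complex.Re z ^+ 2 + complex.Im z ^+ 2.

Definition cexp {R : realType} (z : R[i]) : R[i] :=
  (expR (complex.Re z))%:C * (cos (complex.Im z) +i* sin (complex.Im z)).

Definition lebC (R : realType) : set (R * R)%type -> \bar R :=
  (lebesgue_measure \x lebesgue_measure)%E.

Definition of_pair {R : realType} (p : (R * R)%type) : R[i] := p.1 +i* p.2.

Definition ccons {R : realType} {N : nat} (a : R[i]) (v : 'rV[R[i]]_N)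
  : 'rV[R[i]]_N.+1 := row_mx (\row_(_ < 1) a) v.

(** Lebesgue integral over C^N of a nonnegative (extended-real) function,
    computed as an iterated integral over the coordinates (Tonelli). *)
Fixpoint int_nonneg (R : realType) (N : nat) : ('rV[R[i]]_N -> \bar R) -> \bar R :=
  match N with
  | 0 => fun F => F 0%R
  | N'.+1 => fun F : 'rV[R[i]]_N'.+1 -> \bar R =>
      (\int[@lebC R]_p @int_nonneg R N' (fun v => F (ccons (of_pair p) v)))%E
  end.

(** Lebesgue integral over C^N of a complex function, as an iterated
    integral (Fubini), real and imaginary parts integrated separately. *)
Fixpoint int_C (R : realType) (N : nat) : ('rV[R[i]]_N -> R[i]) -> R[i] :=
  match N with
  | 0 => fun F => F 0%R
  | N'.+1 => fun F : 'rV[R[i]]_N'.+1 -> R[i] =>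
      let G := fun p => @int_C R N' (fun v => F (ccons (of_pair p) v)) in
      fine (\int[@lebC R]_p (complex.Re (G p))%:E)%E +i* fine (\int[@lebC R]_p (complex.Im (G p))%:E)%E
  end.

(** holomorphic on an open set: complex (C-linear Frechet) differentiable at each point *)
Definition holomorphic_on {R : realType} {N : nat} (D : set 'rV[R[i]]_N)
  (f : ('rV[R[i]]_N : normedModType R[i]) -> R[i]^o) : Prop :=
  open (D : set ('rV[R[i]]_N : normedModType R[i])) /\ forall p : ('rV[R[i]]_N : normedModType R[i]), D p -> differentiable f p.

Definition L2norm2 {R : realType} {N : nat} (D : set 'rV[R[i]]_N)
  (f : 'rV[R[i]]_N -> R[i]) : \bar R :=
  int_nonneg (fun v => (if `[< D v >] then cabs2 (f v) else 0)%:E).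

Definition A2 {R : realType} {N : nat} (D : set 'rV[R[i]]_N)
  (f : 'rV[R[i]]_N -> R[i]) : Prop :=
  holomorphic_on D f /\ (L2norm2 D f < +oo)%E.

Definition inner {R : realType} {N : nat} (D : set 'rV[R[i]]_N)
  (f g : 'rV[R[i]]_N -> R[i]) : R[i] :=
  int_C (fun v => if `[< D v >] then f v * (g v)^* else 0).

(** K is the Bergman kernel of the open set D: K z w = K_D(z; conj w),
    i.e. K(., w) lies in A^2(D) and reproduces every f in A^2(D) at w. *)
Definition bergman_kernel {R : realType} {N : nat} (D : set 'rV[R[i]]_N)
  (K : 'rV[R[i]]_N -> 'rV[R[i]]_N -> R[i]) : Prop :=
  forall w, D w ->
    A2 D (fun z => K z w) /\
    forall f, A2 D f -> f w = inner D f (fun z => K z w).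

Definition domain {R : realType} {N : nat} (D : set 'rV[R[i]]_N) : Prop :=
  open (D : set ('rV[R[i]]_N : normedModType R[i])) /\
  connected (D : set ('rV[R[i]]_N : normedModType R[i])) /\ D !=set0.

Definition star_hartogs {R : realType} {n m : nat} (Om : set 'rV[R[i]]_(n + m)) : Prop :=
  forall (z lam : 'rV[R[i]]_n) (z' : 'rV[R[i]]_m),
    Om (row_mx z z') -> (forall j, `|lam 0 j| <= 1) ->
    Om (row_mx (\row_j (lam 0 j * z 0 j)) z').

Definition pt {R : realType} {n m : nat} (z : 'rV[R[i]]_n) (z' : 'rV[R[i]]_m) (w : R[i])
  : 'rV[R[i]]_(n + m + 1) := row_mx (row_mx z z') (\row_(_ < 1) w).

Definition g_gamma {R : realType} {n : nat} (gamma : 'rV[R]_n) (z : 'rV[R[i]]_n) (w : R[i])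
  : 'rV[R[i]]_n := \row_j ((expR (gamma 0 j * cabs2 w / 2))%:C * z 0 j).

Definition Vg {R : realType} {n m : nat} (gamma : 'rV[R]_n) (Om : set 'rV[R[i]]_(n + m))
  : set 'rV[R[i]]_(n + m + 1) :=
  fun p => Om (row_mx (g_gamma gamma (lsubmx (lsubmx p)) (rsubmx p 0 0)) (rsubmx (lsubmx p))).

Definition Vg_eta {R : realType} {n m : nat} (gamma : 'rV[R]_n) (Om : set 'rV[R[i]]_(n + m))
  (eta : R[i]) : set 'rV[R[i]]_(n + m) :=
  fun q => Vg gamma Om (row_mx q (\row_(_ < 1) eta)).

Definition lmap {R : realType} {n : nat} (gamma : 'rV[R]_n) (z : 'rV[R[i]]_n) (w eta : R[i])
  : 'rV[R[i]]_n :=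
  \row_j (z 0 j * cexp ((gamma 0 j)%:C * (w * eta^* - (cabs2 eta)%:C))).

Definition DV {R : realType} {n : nat} (gamma : 'rV[R]_n) (w eta : R[i])
  (F : 'rV[R[i]]_n -> R[i]^o) (z : 'rV[R[i]]_n) : R[i] :=
  cexp ((\sum_(j < n) gamma 0 j)%:C * (w * eta^* - (cabs2 eta)%:C)) / (pi%:C) *
  \sum_(j < n) (gamma 0 j)%:C * (F z + z 0 j * ('D_(delta_mx 0 j) F z : R[i]^o)).

(* Main.v *)
(** For a complex number [c] let [delta_c] multiply each [z_j] by
    [exp (gamma_j c)] and fix [z'].  Put [kap = gamma_1 + ... + gamma_n],
    [q0 = (zeta, zeta')], [a(w) = w conj(eta) - |eta|^2], and let [K] be the
    Bergman kernel of the slice [V_eta] at [q0].  For real [s >= 0] consider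
      [G_s (v, w) = exp (kap (a(w) - s)) K (delta_(a(w) - s) v)].
    A real dilation carries the slice [V_w] onto [V_eta] and turns
    [G_s (., w)] into a multiple of [K o l], where [l] multiplies the [z_j] by
    numbers of modulus at most [1].  By the mean value property [f (l v)] is an
    average of values [f (t v)] with [t] in the torus; as the torus preserves
    Lebesgue measure, [f |-> f o l] is a contraction of [A^2(V_eta)] whose
    adjoint is [f |-> f o conj(l)].  Hence [G_s] is in [A^2(V)], and the
    reproducing property of [K] on slices gives, for [f] in [A^2(V)],
      [<f, G_s> = int_C exp (kap b) f (delta_b q0, w) dw]
    with [b = conj(w) eta - |w|^2 - s].  Put [w = eta + sigma]: averaging over
    the rotations of [sigma] leaves a radial integrand, and
      [<f, G_s> = pi int_s^oo k],  [k(x) = exp (- kap x) f (delta_(-x) q0, eta)].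
    For [f = K_V (.; p)] the left-hand side is the conjugate of [G_s (p)], so
    that [- d/ds G_s (p)] at [s = 0] is [pi K_V (p; q0, eta)]; computing this
    derivative by the chain rule produces the operator [D_V]. *)

Require Import Defs.
From HB Require Import structures.
From mathcomp Require Import all_boot all_order all_algebra.
From mathcomp Require Import all_classical all_reals all_analysis.
From mathcomp Require Import measurable_realfun complex ring lra.
Import Order.TTheory GRing.Theory Num.Theory.
Import numFieldTopology.Exports numFieldNormedType.Exports.
Local Open Scope ring_scope.
Local Open Scope complex_scope.
Set Implicit Arguments.
Unset Strict Implicit.
Unset Printing Implicit Defensive.
Local Open Scope classical_set_scope.

(** * Complex derivatives in epsilon-delta form *)

(** The kernels are known only through their reproducing property, so [K_V] at a point is reached
    only through scalar products. Pairing with [G_s] gives the tail of an integral instead of a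
    point value; the parameter [s] is there to recover the value at [(q0, eta)] by differentiation
    at [s = 0]. All convergence comes from a completed square, [Re a(w) = (|w|^2 - |eta|^2 - |w -
    eta|^2) / 2]. The dilation from [V_eta] to [V_w] absorbs [(|w|^2 - |eta|^2) / 2]; the rest,
    [- |w - eta|^2 / 2], puts [l] into the closed polydisc and leaves the weight
    [exp (- kap |w - eta|^2)], integrable since [kap > 0]. The exponent [b] contains [conj(w)], so
    the integrand is not holomorphic in [w]. With [w = eta + sigma] it reads
    [b = - |sigma|^2 - conj(eta) sigma - s]: on each circle around [eta] the term [|sigma|^2] is
    constant, what remains is holomorphic in [sigma], and the mean value property applies. The
    averages over the torus reduce to the same one-variable property. *)

Notation nC := (@Normc.normc _).

Lemma normC_normc (R : realType) (z : R[i]) : `|z| = (nC z)%:C. Proof. by []. Qed.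

(** Clearing the denominator of the difference quotient gives an estimate that also covers [h = 0]
    and splits into real and imaginary parts. The Cauchy-Riemann equations and the final comparison
    of derivatives use this form. *)
Lemma derive_eps (R : realType) (q : R[i]^o -> R[i]^o) (z : R[i]^o) : derivable q z 1 ->
  forall e : R, 0 < e -> exists2 d : R, 0 < d &
    forall h : R[i]^o, nC h < d ->
      nC (q (z + h) - q z - 'D_1 q z * h) <= e * nC h.
Proof.
move=> dq e e0.
have : (fun h : R[i]^o => h^-1 *: ((q \o shift z) (h *: (1 : R[i]^o)) - q z)) @ 0^' --> ('D_1 q z : R[i]^o).
  exact: dq.
move=> /cvgrPdist_le /(_ e%:C); rewrite ltcR => /(_ e0) [d /= d0 dP].
(* In the order of [R[i]], positivity forces the imaginary part to vanish. *)
have dE : d = (complex.Re d)%:C.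
  by move: d0; rewrite /= ltcE /= => /andP[/eqP]; case: (d) => a b /= ->.
exists (complex.Re d); first by rewrite -ltcR -dE.
move=> h hd; have [->|h0] := eqVneq h 0.
  by rewrite addr0 mulr0 subr0 subrr Normc.normc0 mulr0.
have := dP h; rewrite /ball /= sub0r normrN normC_normc dE ltcR => /(_ hd h0).
rewrite [h *: _]mulr1 [h + z]addrC normC_normc lecR => H.
have -> : q (z + h) - q z - 'D_1 q z * h = - (h * ('D_1 q z - h^-1 *: (q (z + h) - q z))).
  by rewrite mulrBr /GRing.scale /= mulVKf // mulrC opprB.
by rewrite normcN Normc.normcM mulrC ler_wpM2r // -lecR -normC_normc normr_ge0.
Qed.

Lemma derivable_eps (R : realType) (q : R[i]^o -> R[i]^o) (z : R[i]^o) : differentiable q z ->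
  exists l : R[i], forall e : R, 0 < e -> exists2 d : R, 0 < d &
    forall h : R[i]^o, nC h < d ->
      nC (q (z + h) - q z - l * h) <= e * nC h.
Proof. by move=> /derivable1_diffP dq; exists ('D_1 q z : R[i]^o); exact: derive_eps. Qed.

Lemma eps_is_derive (R : realType) (q : R[i]^o -> R[i]^o) (z : R[i]^o) (l : R[i]^o) :
  (forall e : R, 0 < e -> exists2 d : R, 0 < d &
    forall h : R[i]^o, nC h < d ->
      nC (q (z + h) - q z - l * h) <= e * nC h) -> is_derive z (1 : R[i]^o) q l.
Proof.
move=> H.
suff L : (fun h : R[i]^o => h^-1 *: ((q \o shift z) (h *: (1 : R[i]^o)) - q z)) @ 0^' --> l.
  by apply: DeriveDef; [apply/cvg_ex; exists l|exact: cvg_lim L].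
apply/cvgrPdist_le => e e0.
have eE : e = (complex.Re e)%:C.
  by move: e0; rewrite /= ltcE /= => /andP[/eqP]; case: (e) => a b /= ->.
have [|d d0 dP] := H (complex.Re e); first by rewrite -ltcR -eE.
exists d%:C; first by rewrite /= ltcR.
move=> h; rewrite /ball /= sub0r normrN normC_normc ltcR => hd h0.
rewrite [h *: _]mulr1 [h + z]addrC eE normC_normc lecR.
have := dP h hd.
have -> : q (z + h) - q z - l * h = - (h * (l - h^-1 *: (q (z + h) - q z))).
  by rewrite mulrBr /GRing.scale /= mulVKf // mulrC opprB.
rewrite normcN Normc.normcM mulrC ler_pM2r //.
by rewrite -ltcR -normC_normc normr_gt0.
Qed.

Lemma normc_split (R : realType) (a b : R) : nC (a +i* b) <= `|a| + `|b|.
Proof.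
have -> : a +i* b = a%:C + (0 +i* b) by simpc.
apply: (le_trans (le_normcD _ _)); rewrite /= expr0n /= add0r addr0.
by rewrite !sqrtr_sqr.
Qed.

Lemma normc_Re (R : realType) (z : R[i]) : `|complex.Re z| <= nC z.
Proof. by case: z => a b; rewrite /= -sqrtr_sqr ler_wsqrtr // lerDl sqr_ge0. Qed.

Lemma normc_Im (R : realType) (z : R[i]) : `|complex.Im z| <= nC z.
Proof. by case: z => a b; rewrite /= -sqrtr_sqr ler_wsqrtr // lerDr sqr_ge0. Qed.

Lemma normc_ge0 (R : realType) (z : R[i]) : 0 <= nC z.
Proof. exact: le_trans (normr_ge0 _) (normc_Re z). Qed.

Lemma is_derive_eps (R : realType) (f : R -> R) (x l : R) : is_derive x 1 f l ->
  forall e : R, 0 < e -> exists2 d : R, 0 < d &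
    forall h : R, `|h| < d -> `|f (x + h) - f x - l * h| <= e * `|h|.
Proof.
move=> [dq dl] e e0.
have : (fun h : R => h^-1 *: ((f \o shift x) (h *: (1 : R^o)) - f x)) @ 0^' --> l.
  by rewrite -dl; exact: dq.
move=> /cvgrPdist_le /(_ e e0) [d /= d0 dP].
exists d => // h hd; have [->|h0] := eqVneq h 0.
  by rewrite addr0 mulr0 subr0 subrr normr0 mulr0.
have := dP h; rewrite /ball /= sub0r normrN => /(_ hd h0).
rewrite [h *: _]mulr1 [h + x]addrC => H.
have -> : f (x + h) - f x - l * h = - (h * (l - h^-1 *: (f (x + h) - f x))).
  by rewrite mulrBr /GRing.scale /= mulVKf // mulrC opprB.
by rewrite normrN normrM mulrC ler_wpM2r.
Qed.

Lemma cexpD (R : realType) (x y : R[i]) : cexp (x + y) = cexp x * cexp y.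
Proof.
case: x y => [a b] [c d]; rewrite /cexp /= expRD cosD sinD; simpc.
apply/eqP; rewrite eq_complex /=; apply/andP; split; apply/eqP; ring.
Qed.

Lemma cexp0 (R : realType) : cexp 0 = 1 :> R[i].
Proof. by rewrite /cexp /= expR0 cos0 sin0 mul1r. Qed.

(** As [cexp] is built from real functions, its complex derivative at 0 is assembled from the real
    expansions of [expR], [cos] and [sin] at 0. *)
Lemma cexp_eps (R : realType) (e : R) : 0 < e -> exists2 d : R, 0 < d &
    forall h : R[i]^o, nC h < d -> nC (cexp h - 1 - h) <= e * nC h.
Proof.
move=> e0.
(* With [m] for this minimum, the four error terms below are at most 3, 1, 3 and 2 times [m * N], in
   total [9 * (m * N)]. The bound by 1 gives the crude estimates of [expR a]. *)
have e40 : 0 < Num.min (e / 9) 1 by rewrite lt_min ltr01 divr_gt0.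
have [d1 d10 P1] := is_derive_eps (is_derive_expR 0) e40.
have [d2 d20 P2] := is_derive_eps (is_derive_cos 0) e40.
have [d3 d30 P3] := is_derive_eps (is_derive_sin 0) e40.
have e41 : Num.min (e / 9) 1 <= 1 by rewrite ge_min lexx orbT.
have e42 : Num.min (e / 9) 1 <= e / 9 by rewrite ge_min lexx.
move: e41 e42 e40 P1 P2 P3; move: (Num.min (e / 9) 1) => m e41 e42 e40 P1 P2 P3.
exists (Num.min (Num.min d1 d2) (Num.min d3 (Num.min 1 m))).
  by rewrite !lt_min d10 d20 d30 ltr01 e40.
move=> h; rewrite !lt_min => /andP[/andP[hd1 hd2] /andP[hd3 /andP[h1 hm]]].
have ha := normc_Re h; have hb := normc_Im h.
have := P1 (complex.Re h) (le_lt_trans ha hd1).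
have := P2 (complex.Im h) (le_lt_trans hb hd2).
have := P3 (complex.Im h) (le_lt_trans hb hd3).
move: ha hb; rewrite !add0r expR0 cos0 sin0 subr0 oppr0 mul0r !subr0 !mul1r.
set a := complex.Re h; set b := complex.Im h; set N := nC h in h1 hm *.
move=> ha hb Ps Pc Pe.
have -> : cexp h - 1 - h = (expR a * (cos b - 1) + (expR a - 1 - a)) +i*
   (expR a * (sin b - b) + (expR a - 1) * b).
  rewrite /cexp -/a -/b [X in _ - X]complexE -/a -/b; simpc.
  apply/eqP; rewrite eq_complex /=; apply/andP; split; apply/eqP; ring.
apply: (le_trans (normc_split _ _)).
have m0 := ltW e40.
have N0 : 0 <= N by exact: normc_ge0.
have Pe' : `|expR a - 1 - a| <= m * N by rewrite (le_trans Pe) // ler_wpM2l.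
have Pc' : `|cos b - 1| <= m * N by rewrite (le_trans Pc) // ler_wpM2l.
have Ps' : `|sin b - b| <= m * N by rewrite (le_trans Ps) // ler_wpM2l.
have mN : m * N <= N by rewrite ler_piMl.
have e1 : `|expR a - 1| <= 2 * N.
  have -> : expR a - 1 = (expR a - 1 - a) + a by ring.
  apply: (le_trans (ler_normD _ _)); lra.
have e3 : `|expR a| <= 3.
  have -> : expR a = (expR a - 1) + 1 by ring.
  apply: (le_trans (ler_normD _ _)); rewrite normr1; lra.
have A1 : `|expR a * (cos b - 1)| <= 3 * (m * N) by rewrite normrM ler_pM.
have A2 : `|expR a * (sin b - b)| <= 3 * (m * N) by rewrite normrM ler_pM.
have A3 : `|(expR a - 1) * b| <= 2 * (m * N).
  by rewrite normrM mulrA; apply: ler_pM => //; apply: (le_trans e1); rewrite ler_wpM2l // ltW.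
have B1 := ler_normD (expR a * (cos b - 1)) (expR a - 1 - a).
have B2 := ler_normD (expR a * (sin b - b)) ((expR a - 1) * b).
have : 9 * (m * N) <= e * N by rewrite mulrA ler_wpM2r // mulrC -ler_pdivlMr.
lra.
Qed.

(** By [cexpD] the increment is [cexp (a * z + b)] times the increment of [cexp] from 0 to [a * h],
    which leaves only [cexp_eps]. *)
Lemma is_derive_cexp_affine (R : realType) (a b : R[i]) (z : R[i]^o) :
  is_derive z (1 : R[i]^o) (fun t : R[i]^o => cexp (a * t + b) : R[i]^o) (a * cexp (a * z + b)).
Proof.
apply: eps_is_derive => e e0; set c := cexp (a * z + b).
have A0 : 0 < nC a + 1 by rewrite ltr_wpDl // normc_ge0.
have C0 : 0 < nC c + 1 by rewrite ltr_wpDl // normc_ge0.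
have ez0 : 0 < e / ((nC c + 1) * (nC a + 1)) by rewrite divr_gt0 // mulr_gt0.
have [d d0 dP] := cexp_eps ez0; exists (d / (nC a + 1)); first by rewrite divr_gt0.
move=> h; rewrite ltr_pdivlMr // mulrC => hd.
have hah : nC (a * h) <= (nC a + 1) * nC h.
  by rewrite Normc.normcM ler_wpM2r ?normc_ge0 // lerDl.
have -> : cexp (a * (z + h) + b) - c - a * c * h = c * (cexp (a * h) - 1 - a * h).
  have -> : a * (z + h) + b = (a * z + b) + a * h by ring.
  by rewrite cexpD -/c; ring.
rewrite Normc.normcM.
apply: (le_trans (ler_wpM2l (normc_ge0 _) (dP _ (le_lt_trans hah hd)))).
apply: (@le_trans _ _ ((nC c + 1) * (e / ((nC c + 1) * (nC a + 1)) * ((nC a + 1) * nC h)))).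
  apply: ler_pM; rewrite ?normc_ge0 ?lerDl //; first by rewrite mulr_ge0 ?normc_ge0 // ltW.
  by rewrite ler_wpM2l // ltW.
rewrite le_eqVlt; apply/orP; left; apply/eqP; field.
by rewrite !gt_eqF.
Qed.

Lemma differentiable_cexp (R : realType) (z : R[i]^o) :
  differentiable (@cexp R : R[i]^o -> R[i]^o) z.
Proof.
apply/derivable1_diffP; have [d _] := is_derive_cexp_affine 1 0 z.
by rewrite (_ : (@cexp R : R[i]^o -> R[i]^o) = (fun t : R[i]^o => cexp (1 * t + 0))) //; apply/funext => t; rewrite mul1r addr0.
Qed.

(** * Goursat's theorem on a rectangle and the mean value property *)

Lemma half_small (R : realType) (x d : R) : 0 < d -> exists k, x / 2 ^+ k < d.
Proof.
move=> d0; have [k hk] : exists k : nat, `|x| / d < k%:R.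
  by exists (Num.truncn (`|x| / d)).+1; rewrite truncnS_gt.
exists k; rewrite ltr_pdivrMr ?exprn_gt0 //.
apply: (le_lt_trans (ler_norm x)); move: hk; rewrite ltr_pdivrMr // mulrC => hk.
apply: (lt_le_trans hk); rewrite ler_pM2l //.
by rewrite -natrX ler_nat ltnW // ltn_expl.
Qed.

Lemma nested_point (R : realType) (A P : nat -> R) :
  (forall k, A k <= A k.+1 /\ A k.+1 + P k.+1 <= A k + P k /\ 0 <= P k) ->
  exists x0, forall k, A k <= x0 <= A k + P k.
Proof.
move=> H; have H1 j k : A j <= A (j + k)%N.
  elim: k => [|k IH]; first by rewrite addn0.
  by rewrite addnS; apply: (le_trans IH); have [] := H (j + k)%N.
have H2 j k : A (j + k)%N + P (j + k)%N <= A j + P j.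
  elim: k => [|k IH]; first by rewrite addn0.
  by rewrite addnS; apply: le_trans IH; have [_ []] := H (j + k)%N.
have H3 j k : A j <= A k + P k.
  have [jk|kj] := leqP j k.
    rewrite -(subnKC jk); apply: (le_trans (H1 _ (k - j)%N)); rewrite lerDl.
    by have [_ []] := H (j + (k - j))%N.
  apply: le_trans (H2 k (j - k)%N); rewrite subnKC 1?ltnW // lerDl.
  by have [_ []] := H j.
exists (sup (range A)) => k.
have hs : has_sup (range A).
  split; first by exists (A 0%N), 0%N.
  by exists (A 0%N + P 0%N) => _ [j _ <-].
apply/andP; split; first by apply: ub_le_sup; [case: hs|exists k].
by apply: ge_sup; [case: hs|move=> _ [j _ <-]].
Qed.

Section Goursat.
Variables (R : realType).
Notation mu := (@lebesgue_measure R).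
Implicit Types (u v : R -> R -> R) (x y a b c p q e d K M : R).

(** Real differentiability of [(u, v)] together with the Cauchy-Riemann equations: [al + i be] is
    the complex derivative of [u + i v]. Keeping two real functions lets Goursat's theorem be proved
    with real integrals over segments. *)
Definition CRpt u v x0 y0 := exists al be, forall e, 0 < e ->
  exists2 d : R, 0 < d & forall x y, `|x - x0| < d -> `|y - y0| < d ->
   `|u x y - (u x0 y0 + al * (x - x0) - be * (y - y0))| <= e * (`|x - x0| + `|y - y0|) /\
   `|v x y - (v x0 y0 + be * (x - x0) + al * (y - y0))| <= e * (`|x - x0| + `|y - y0|).

(** This is multiplication of [u + i v] by [- i]; it carries statements on the first component over
    to the second. *)
Lemma CR_sym u v x y : CRpt u v x y -> CRpt v (fun x y => - u x y) x y.
Proof.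
move=> [al [be H]]; exists be, (- al) => e e0; have [d d0 P] := H e e0.
exists d => // x' y' hx hy; have [P1 P2] := P x' y' hx hy; split.
  by rewrite mulNr opprK.
rewrite -normrN; apply: le_trans P1; rewrite le_eqVlt; apply/orP; left; apply/eqP.
congr (`|_|); ring.
Qed.

Lemma lin_continuous (f : R -> R) x l : 
  (forall e, 0 < e -> exists2 d : R, 0 < d & forall h, `|h - x| < d -> `|f h - (f x + l * (h - x))| <= e * `|h - x|) ->
  {for x, continuous f}.
Proof.
move=> H; apply/cvgrPdist_le => e e0; have [d d0 P] := H 1 ltr01.
have L0 : 0 < `|l| + 1 by rewrite ltr_wpDl.
exists (Num.min d (e / (`|l| + 1))); first by rewrite /= lt_min d0 divr_gt0.
move=> h; rewrite /ball /= lt_min distrC ltr_pdivlMr // => /andP[hd he].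
have := P h hd; rewrite mul1r => P'; rewrite distrC.
have -> : f h - f x = (f h - (f x + l * (h - x))) + l * (h - x) by ring.
apply: (le_trans (ler_normD _ _)); rewrite normrM; apply: le_trans (ltW he).
by rewrite [X in _ <= X]mulrDr mulr1 addrC [_ * `|l|]mulrC lerD2l.
Qed.

Lemma CR_continuous u v x y : CRpt u v x y ->
  {for y, continuous (u x)} /\ {for x, continuous (u^~ y)}.
Proof.
move=> [al [be H]]; split.
  apply: (@lin_continuous _ _ (- be)) => e e0; have [d d0 P] := H e e0.
  exists d => // h hd; have := (P x h _ hd).1; rewrite subrr normr0 mulr0 addr0 add0r mulNr.
  by apply.
apply: (@lin_continuous _ _ al) => e e0; have [d d0 P] := H e e0.
exists d => // h hd; have := (P h y hd _).1; rewrite subrr normr0 mulr0 addr0 subr0.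
by apply.
Qed.

Definition iseg (f : R -> R) a b := (\int[mu]_(x in `[a, b]) f x)%R.

(** Continuity in full neighbourhoods of the points of the segment, ends included, and not relative
    to the segment. *)
Definition cseg (f : R -> R) a b := forall x, a <= x <= b -> {for x, continuous f}.

Lemma cseg_int f a b : cseg f a b -> mu.-integrable `[a, b] (EFin \o f).
Proof.
move=> cf; apply: continuous_compact_integrable; first exact: segment_compact.
by apply: continuous_in_subspaceT => x; rewrite inE /= in_itv /=; exact: cf.
Qed.

Lemma csegB f g a b : cseg f a b -> cseg g a b -> cseg (fun x => f x - g x) a b.
Proof. by move=> cf cg x xab; apply: cvgB; [exact: cf|exact: cg]. Qed.

Lemma csegS f a b c d : a <= c -> d <= b -> cseg f a b -> cseg f c d.
Proof. move=> ac db cf x /andP[cx xd]; apply: cf; apply/andP; split; lra. Qed.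

Lemma isegD f a b c : a <= b <= c -> cseg f a c -> iseg f a c = iseg f a b + iseg f b c.
Proof.
move=> /andP[ab bc] cf; rewrite /iseg.
have E : (\int[mu]_(t in `[a, c]) f t - \int[mu]_(t in `[a, b]) f t =
    \int[mu]_(x in `]b, c]) f x)%R.
  by rewrite Rintegral_itvB //; exact: cseg_int.
have E2 : (\int[mu]_(x in `]b, c]) f x = \int[mu]_(x in `[b, c]) f x)%R.
  rewrite Rintegral_itv_obnd_cbnd //.
  apply: (integrableS _ _ _ (cseg_int (csegS ab (lexx c) cf))) => //.
  by apply: subset_itvr; rewrite bnd_simp.
by rewrite -E2 -E addrC subrK.
Qed.

Lemma csegC a b k : cseg (fun=> k) a b.
Proof. by move=> x _; exact: cst_continuous. Qed.

Lemma isegB f g a b : cseg f a b -> cseg g a b ->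
  iseg (fun x => f x - g x) a b = iseg f a b - iseg g a b.
Proof. by move=> cf cg; rewrite /iseg RintegralB //; exact: cseg_int. Qed.

Lemma iseg_cst a p k : 0 <= p -> iseg (fun=> k) a (a + p) = k * p.
Proof.
move=> p0; rewrite /iseg Rintegral_cst //= lebesgue_measure_itv /= lte_fin.
case: ltP => h /=; first by congr (_ * _); ring.
by have -> : p = 0 by lra.
Qed.

Lemma iseg_near f a p K M : 0 <= p -> cseg f a (a + p) ->
  (forall x, a <= x <= a + p -> `|f x - K| <= M) -> `|iseg f a (a + p) - K * p| <= M * p.
Proof.
move=> p0 cf H; rewrite -(iseg_cst a K p0) -isegB //; last exact: csegC.
have cg := csegB cf (@csegC a (a + p) K).
apply: (le_trans (le_normr_Rintegral _ (cseg_int cg))) => //.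
rewrite -(iseg_cst a M p0) /iseg; apply: le_Rintegral => //.
- exact: (integrable_norm (cseg_int cg)).
- exact: cseg_int (@csegC a (a + p) M).
Qed.

Variables (u v : R -> R -> R) (a0 c0 p0 q0 : R).
Hypothesis (p00 : 0 < p0) (q00 : 0 < q0).
Hypothesis CR : forall x y, a0 <= x <= a0 + p0 -> c0 <= y <= c0 + q0 -> CRpt u v x y.

(* The imaginary part of the integral of [(u + i v) (dx + i dy)] over the
   boundary of the rectangle of sides [p], [q] with lower left corner [(a, c)]. *)
Definition boundary_int a c p q := iseg (fun x => v x c - v x (c + q)) a (a + p) +
  iseg (fun y => u (a + p) y - u a y) c (c + q).

Definition subrect a c p q := [/\ 0 <= p, 0 <= q, a0 <= a, a + p <= a0 + p0 & (c0 <= c /\ c + q <= c0 + q0)].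

Lemma csegv a c p q y : subrect a c p q -> c <= y <= c + q -> cseg (v^~ y) a (a + p).
Proof.
move=> [p1 q1 a1 a2 [c1 c2]] /andP[y1 y2] x /andP[x1 x2].
by apply: (CR_continuous (CR_sym (CR _ _))).2; lra.
Qed.

Lemma csegu a c p q x : subrect a c p q -> a <= x <= a + p -> cseg (u x) c (c + q).
Proof.
move=> [p1 q1 a1 a2 [c1 c2]] /andP[x1 x2] y /andP[y1 y2].
by apply: (CR_continuous (CR _ _)).1; lra.
Qed.

(** The two integrals over the common vertical side cancel. *)
Lemma boundary_int_splitx a c p1 p2 q : 0 <= p1 -> 0 <= p2 -> subrect a c (p1 + p2) q ->
  boundary_int a c (p1 + p2) q = boundary_int a c p1 q + boundary_int (a + p1) c p2 q.
Proof.
move=> p10 p20 I; have [_ q1 a1 a2 [c1 c2]] := I.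
rewrite /boundary_int -[in RHS]addrA (isegD (b := a + p1)); last 2 first.
- by lra.
- by apply: csegB; apply: (csegv I); lra.
rewrite [a + (p1 + p2)]addrA.
rewrite (isegB (f := u (a + p1 + p2)) (g := u a)); last 2 first.
- by apply: (csegu I); lra.
- by apply: (csegu I); lra.
rewrite (isegB (f := u (a + p1 + p2))); last 2 first.
- by apply: (csegu I); lra.
- by apply: (csegu I); lra.
rewrite (isegB (f := u (a + p1))); last 2 first.
- by apply: (csegu I); lra.
- by apply: (csegu I); lra.
ring.
Qed.

Lemma boundary_int_splity a c p q1 q2 : 0 <= q1 -> 0 <= q2 -> subrect a c p (q1 + q2) ->
  boundary_int a c p (q1 + q2) = boundary_int a c p q1 + boundary_int a (c + q1) p q2.
Proof.
move=> q10 q20 I; have [p1 _ a1 a2 [c1 c2]] := I.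
rewrite /boundary_int (isegD (b := c + q1) (c := c + (q1 + q2))); last 2 first.
- by lra.
- by apply: csegB; apply: (csegu I); lra.
rewrite [c + (q1 + q2)]addrA.
rewrite (isegB (f := v^~ c) (g := v^~ (c + q1 + q2))); last 2 first.
- by apply: (csegv I); lra.
- by apply: (csegv I); lra.
rewrite (isegB (f := v^~ c)); last 2 first.
- by apply: (csegv I); lra.
- by apply: (csegv I); lra.
rewrite (isegB (f := v^~ (c + q1))); last 2 first.
- by apply: (csegv I); lra.
- by apply: (csegv I); lra.
ring.
Qed.

(** The linear parts of [u] and [v] contribute [- al * q * p] and [al * p * q], with the same [al]
    by Cauchy-Riemann, and cancel. Only the error of first order remains, integrated over the
    sides. *)
Lemma boundary_int_local x0 y0 e : a0 <= x0 <= a0 + p0 -> c0 <= y0 <= c0 + q0 -> 0 < e ->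
  exists2 d : R, 0 < d & forall a c p q, subrect a c p q ->
   a <= x0 <= a + p -> c <= y0 <= c + q -> p < d -> q < d ->
   `|boundary_int a c p q| <= e * (p + q) ^+ 2.
Proof.
move=> hx0 hy0 e0; have [al [be H]] := CR hx0 hy0.
(* Each integrand of [boundary_int] is a difference of two values, hence the half. *)
have [d d0 P] := H (e / 2) (divr_gt0 e0 (ltr0n _ 2)); exists d => // a c p q I hx hy pd qd.
have [p1 q1 a1 a2 [c1 c2]] := I.
have B : forall x y, a <= x <= a + p -> c <= y <= c + q ->
   `|u x y - (u x0 y0 + al * (x - x0) - be * (y - y0))| <= (e / 2) * (p + q) /\
   `|v x y - (v x0 y0 + be * (x - x0) + al * (y - y0))| <= (e / 2) * (p + q).
  move=> x y xx yy.
  have X1 : `|x - x0| <= p by rewrite ler_norml; lra.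
  have Y1 : `|y - y0| <= q by rewrite ler_norml; lra.
  have [U V] := P x y (le_lt_trans X1 pd) (le_lt_trans Y1 qd).
  have E : (e / 2) * (`|x - x0| + `|y - y0|) <= (e / 2) * (p + q).
    by rewrite ler_wpM2l ?lerD // divr_ge0 // ltW.
  by split; [apply: le_trans U E | apply: le_trans V E].
have I1 : `|iseg (fun x => v x c - v x (c + q)) a (a + p) - (- al * q) * p| <= (e * (p + q)) * p.
  apply: iseg_near => //; first by apply: csegB; apply: (csegv I); lra.
  move=> x xx; have := (B x c xx _).2; have := (B x (c + q) xx _).2.
  rewrite !ler_norml => V1 V2.
  have /andP[V3 V4] := V1 ltac:(lra); have /andP[V5 V6] := V2 ltac:(lra).
  nra.
have I2 : `|iseg (fun y => u (a + p) y - u a y) c (c + q) - (al * p) * q| <= (e * (p + q)) * q.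
  apply: iseg_near => //; first by apply: csegB; apply: (csegu I); lra.
  move=> y yy; have := (B a y _ yy).1; have := (B (a + p) y _ yy).1.
  rewrite !ler_norml => V1 V2.
  have /andP[V3 V4] := V1 ltac:(lra); have /andP[V5 V6] := V2 ltac:(lra).
  nra.
rewrite /boundary_int; move: I1 I2; set A := iseg _ _ _; set B' := iseg _ _ _ => I1 I2.
have -> : A + B' = (A - (- al * q) * p) + (B' - (al * p) * q) by ring.
apply: (le_trans (ler_normD _ _)).
have -> : e * (p + q) ^+ 2 = e * (p + q) * p + e * (p + q) * q by ring.
exact: lerD.
Qed.

(** By bisection: some quarter carries at least a quarter of the modulus. The chosen quarters shrink
    to a point, where the local estimate decays faster than the lower bound [eta / 4 ^+ k]
    allows. *)
Lemma Goursat : boundary_int a0 c0 p0 q0 = 0.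
Proof.
apply/eqP; apply: contrapT => /negP Jn0.
set eta := `|boundary_int a0 c0 p0 q0|; have eta0 : 0 < eta by rewrite normr_gt0.
pose P k := p0 / 2 ^+ k; pose Q k := q0 / 2 ^+ k.
have P0 k : 0 < P k by rewrite divr_gt0 ?exprn_gt0.
have Q0 k : 0 < Q k by rewrite divr_gt0 ?exprn_gt0.
have PS k : P k = P k.+1 + P k.+1 by rewrite /P exprS invfM; field; rewrite expf_neq0.
have QS k : Q k = Q k.+1 + Q k.+1 by rewrite /Q exprS invfM; field; rewrite expf_neq0.
pose Inv k (s : R * R) := subrect s.1 s.2 (P k) (Q k) /\ eta / 4 ^+ k <= `|boundary_int s.1 s.2 (P k) (Q k)|.
pose Near k (s s' : R * R) := (s.1 <= s'.1 <= s.1 + P k.+1) /\ (s.2 <= s'.2 <= s.2 + Q k.+1).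
(* If all four quarters stayed below [eta / 4 ^+ k.+1], their sum would stay below [eta / 4 ^+ k].
   The choice is returned in a sigma type so that [fix] can iterate it. *)
have step k (s : {s | Inv k s}) : {s' : {s' | Inv k.+1 s'} | Near k (sval s) (sval s')}.
  suff H : exists s', Inv k.+1 s' /\ Near k (sval s) s'.
    by have [s' [I' N']] := cid H; exists (exist _ s' I').
  case: s => -[a c] /= [I J].
  apply: contrapT => H.
  have p1 := ltW (P0 k.+1); have q1 := ltW (Q0 k.+1).
  move: I J; rewrite PS QS => I J; have [_ _ /= a1 a2 [c1 c2]] := I.
  have S : forall a' c', a <= a' <= a + P k.+1 -> c <= c' <= c + Q k.+1 ->
     `|boundary_int a' c' (P k.+1) (Q k.+1)| < eta / 4 ^+ k.+1.
    move=> a' c' ha hc; rewrite ltNge; apply/negP => h; apply: H.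
    exists (a', c'); split; last by split.
    by split => //; split => //=; lra.
  have X0 := boundary_int_splitx p1 p1 I.
  have I1 : subrect a c (P k.+1) (Q k.+1 + Q k.+1) by split; lra.
  have I2 : subrect (a + P k.+1) c (P k.+1) (Q k.+1 + Q k.+1) by split; lra.
  move: J; rewrite X0 (boundary_int_splity q1 q1 I1) (boundary_int_splity q1 q1 I2) /=.
  have S1 := S a c ltac:(lra) ltac:(lra).
  have S2 := S a (c + Q k.+1) ltac:(lra) ltac:(lra).
  have S3 := S (a + P k.+1) c ltac:(lra) ltac:(lra).
  have S4 := S (a + P k.+1) (c + Q k.+1) ltac:(lra) ltac:(lra).
  have -> : eta / 4 ^+ k = 4 * (eta / 4 ^+ k.+1) by rewrite exprS invfM; field; rewrite expf_neq0.
  move: S1 S2 S3 S4; set w1 := boundary_int a c _ _; set w2 := boundary_int a _ _ _; set w3 := boundary_int _ c _ _; set w4 := boundary_int _ _ _ _; set z := eta / _.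
  clear; move=> S1 S2 S3 S4 h.
  have := le_trans h (ler_normD _ _); have := ler_normD w1 w2; have := ler_normD w3 w4; lra.
have I0 : Inv 0 (a0, c0).
  rewrite /Inv /P /Q /= !expr0 !divr1; split => //.
  by split => //; exact: ltW.
pose f := fix f k : {s | Inv k s} := if k is k'.+1 then sval (step k' (f k')) else exist _ (a0, c0) I0.
pose A k := (sval (f k)).1; pose C k := (sval (f k)).2.
have fS k : Near k (sval (f k)) (sval (f k.+1)) by rewrite /= /Near; case: (step k (f k)).
have fI k : Inv k (A k, C k) by rewrite /A /C -surjective_pairing; case: (f k).
have [x0 hx] : exists x0, forall k, A k <= x0 <= A k + P k.
  apply: (@nested_point _ A P) => k; have h : A k <= A k.+1 <= A k + P k.+1 := (fS k).1.
  rewrite (PS k); have := P0 k.+1; move: h; clear; move=> h hP; split; lra.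
have [y0 hy] : exists y0, forall k, C k <= y0 <= C k + Q k.
  apply: (@nested_point _ C Q) => k; have h : C k <= C k.+1 <= C k + Q k.+1 := (fS k).2.
  rewrite (QS k); have := Q0 k.+1; move: h; clear; move=> h hQ; split; lra.
have hx0 : a0 <= x0 <= a0 + p0 by have := hx 0%N; rewrite /A /P /= expr0 divr1.
have hy0 : c0 <= y0 <= c0 + q0 by have := hy 0%N; rewrite /C /Q /= expr0 divr1.
have pq : 0 < p0 + q0 by rewrite addr_gt0.
(* As [P k + Q k = (p0 + q0) / 2 ^+ k], this [e] makes the local bound equal to half of
   [eta / 4 ^+ k]. *)
pose e := eta / (2 * (p0 + q0) ^+ 2).
have e0 : 0 < e by rewrite divr_gt0 ?mulr_gt0 ?exprn_gt0.
have [d d0 L] := boundary_int_local hx0 hy0 e0.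
have [k hk] := half_small (p0 + q0) d0.
have [Ik Jk] := fI k.
have hPQ : (p0 + q0) / 2 ^+ k = P k + Q k by rewrite mulrDl.
have [hPd hQd] : P k < d /\ Q k < d.
  by move: (P0 k) (Q0 k) hk; rewrite hPQ; clear; move=> ? ? ?; split; lra.
have := L _ _ _ _ Ik (hx k) (hy k) hPd hQd.
move=> /(le_trans Jk); rewrite -hPQ /e => h.
have : eta / 4 ^+ k <= eta / 4 ^+ k / 2.
  apply: (le_trans h); rewrite le_eqVlt; apply/orP; left; apply/eqP.
  have -> : 4 ^+ k = 2 ^+ k ^+ 2 :> R by rewrite -exprM mulnC exprM; congr (_ ^+ _); ring.
  by field; rewrite expf_neq0 //= lt0r_neq0.
have : 0 < eta / 4 ^+ k by rewrite divr_gt0 ?exprn_gt0.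
move: (eta / 4 ^+ k) => z; lra.
Qed.

End Goursat.

Lemma normc_cexp (R : realType) (z : R[i]) : nC (cexp z) = expR (complex.Re z).
Proof.
rewrite /cexp Normc.normcM /= expr0n /= addr0 cos2Dsin2 sqrtr1 mulr1 sqrtr_sqr.
by rewrite ger0_norm // expR_ge0.
Qed.

Lemma CR_of_differentiable (R : realType) (Q : R[i]^o -> R[i]^o) (x0 y0 : R) :
  differentiable Q (x0 +i* y0 : R[i]^o) ->
  CRpt (fun x y => complex.Re (Q (x +i* y))) (fun x y => complex.Im (Q (x +i* y))) x0 y0.
Proof.
move=> /derivable_eps[l H]; exists (complex.Re l), (complex.Im l) => e e0.
have [d d0 P] := H e e0; exists (d / 2); first by rewrite divr_gt0.
move=> x y hx hy.
have hd : nC ((x - x0) +i* (y - y0)) < d.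
  apply: (le_lt_trans (normc_split _ _)); move: hx hy; move: `|_| `|_|; clear; move=> a b; lra.
have := P _ hd.
have -> : (x0 +i* y0 + ((x - x0) +i* (y - y0)) : R[i]) = x +i* y.
  by apply/eqP; rewrite eq_complex /=; apply/andP; split; apply/eqP; ring.
have E := ler_wpM2l (ltW e0) (normc_split (x - x0) (y - y0)).
move=> /le_trans /(_ E).
move: (Q (x +i* y)) (Q (x0 +i* y0)) {H P} => [a b] [a' b']; move: l => [al be] B.
split; apply: (le_trans _ B).
  apply: le_trans (normc_Re _); rewrite le_eqVlt; apply/orP; left; apply/eqP.
  by congr (`|_|); rewrite /=; ring.
apply: le_trans (normc_Im _); rewrite le_eqVlt; apply/orP; left; apply/eqP.
by congr (`|_|); rewrite /=; ring.
Qed.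

(** The pair of [z |-> conj (Q (conj z))]; it allows a circle to be run through in the opposite
    direction. *)
Lemma CR_flip (R : realType) (u v : R -> R -> R) (x0 y0 : R) :
  CRpt u v x0 (- y0) -> CRpt (fun x y => u x (- y)) (fun x y => - v x (- y)) x0 y0.
Proof.
move=> [al [be H]]; exists al, (- be) => e e0; have [d d0 P] := H e e0.
exists d => // x y hx hy; have hy' : `|- y - - y0| < d by rewrite -opprD normrN.
have [P1 P2] := P x (- y) hx hy'; move: P1 P2; rewrite -opprD normrN => P1 P2.
split.
  apply: le_trans P1; rewrite le_eqVlt; apply/orP; left; apply/eqP.
  by congr (`|_|); ring.
apply: le_trans P2; rewrite le_eqVlt; apply/orP; left; apply/eqP.
by rewrite -normrN; congr (`|_|); ring.
Qed.

(** * The mean value property on the unit circle *)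

Section MVP.
Variables (R : realType) (q : R[i]^o -> R[i]^o).
Hypothesis dq : forall z : R[i]^o, nC z <= 1 -> differentiable q z.

(** The exponential unrolls the punctured closed disc onto the half plane of nonpositive real part:
    the angle becomes a variable of period 1, and the centre of the disc lies at real part
    [- oo]. *)
Let Q (z : R[i]^o) : R[i]^o := q (cexp ((2 * pi)%:C * z)).

Lemma differentiable_MVP_Q x y : x <= 0 -> differentiable Q (x +i* y : R[i]^o).
Proof.
move=> x0; apply: (@differentiable_comp _ _ _ _ (fun z : R[i]^o => cexp ((2 * pi)%:C * z) : R[i]^o) q).
  apply: (@differentiable_comp _ _ _ _ (fun z : R[i]^o => ((2 * pi)%:C * z) : R[i]^o)); last exact: differentiable_cexp.
  exact: (@differentiableZ _ _ _ id).
apply: dq; rewrite normc_cexp; simpc; rewrite expR_le1.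
by rewrite mulr_ge0_le0 // mulr_ge0 // pi_ge0.
Qed.

Lemma cexp_period x y : cexp ((2 * pi)%:C * (x +i* (y + 1))) = cexp ((2 * pi)%:C * (x +i* y)) :> R[i].
Proof.
have -> : (2 * pi)%:C * (x +i* (y + 1)) = (2 * pi * x) +i* (2 * pi * y + pi *+ 2) :> R[i].
  by apply/eqP; rewrite eq_complex /=; apply/andP; split; apply/eqP; ring.
have -> : (2 * pi)%:C * (x +i* y) = (2 * pi * x) +i* (2 * pi * y) :> R[i].
  by apply/eqP; rewrite eq_complex /=; apply/andP; split; apply/eqP; ring.
by rewrite /cexp /= cosD2pi sinD2pi.
Qed.

(* Goursat's theorem on [- L, 0] x [0, 1]: the horizontal sides cancel by
   periodicity, so the integral over a vertical side does not depend on its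
   abscissa, and it tends to [K] at [- oo]. *)
Lemma MVP_gen (u v : R -> R -> R) (K : R) :
  (forall x y, x <= 0 -> CRpt u v x y) ->
  (forall x, v x 0 = v x 1) ->
  (forall e, 0 < e -> exists x0, forall x y, x <= x0 -> `|u x y - K| <= e) ->
  iseg (u 0) 0 1 = K.
Proof.
move=> CR pv lu; apply/eqP; rewrite -subr_eq0 -normr_le0; apply/ler_addgt0Pr => e e0.
rewrite add0r; have [x0 hx] := lu e e0.
pose L := `|x0| + 1.
have L0 : 0 < L by rewrite ltr_wpDl.
have J0 := @Goursat R u v (- L) 0 L 1 L0 ltr01 _.
have {J0} : boundary_int u v (- L) 0 L 1 = 0.
  by apply: J0 => x y hx' _; apply: CR; move: hx'; rewrite addNr => /andP[].
rewrite /boundary_int !add0r addNr.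
have cu x : x <= 0 -> cseg (u x) 0 1.
  by move=> hx' y _; apply: (CR_continuous (CR _ _ hx')).1.
have -> : (fun x : R => v x 0 - v x 1) = (fun=> 0) by apply/funext => x; rewrite pv subrr.
have := @iseg_cst R (- L) L 0 (ltW L0); rewrite addNr mul0r => ->.
have L00 : - L <= 0 by rewrite oppr_le0 ltW.
rewrite add0r (isegB (cu _ (lexx 0)) (cu _ L00)) => /eqP; rewrite subr_eq0 => /eqP ->.
have := @iseg_near R (u (- L)) 0 1 K e ler01; rewrite add0r !mulr1; apply; first exact: cu.
move=> y _; apply: hx; rewrite /L; have := ler_norm (- x0); rewrite normrN; move: `|x0| => a; lra.
Qed.

Lemma MVP_lim (e : R) : 0 < e -> exists x0, forall x y, x <= x0 -> nC (Q (x +i* y) - q 0) <= e.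
Proof.
move=> e0; have [|l H] := @derivable_eps R q 0 _.
  by apply: dq; rewrite Normc.normc0.
have [d d0 P] := H 1 ltr01.
have N1 : 0 < nC l + 1 by rewrite ltr_wpDl // normc_ge0.
pose d' := Num.min (d / 2) (e / (nC l + 1)).
have d'0 : 0 < d' by rewrite lt_min !divr_gt0.
have d'd : d' < d by rewrite gt_min ltr_pdivrMr // ltr_pMr // ltr1n.
have d'e : d' <= e / (nC l + 1) by rewrite ge_min lexx orbT.
(* For such [x <= 0] one has [2 * pi * x <= x <= ln d'], so the exponential has modulus at most
   [d']. *)
exists (- `|ln d'|) => x y hx.
have hz : nC (cexp ((2 * pi)%:C * (x +i* y))) <= d'.
  rewrite normc_cexp; simpc; rewrite -[X in _ <= X]lnK ?posrE // ler_expR.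
  have x0 : x <= 0 by apply: (le_trans hx); rewrite oppr_le0.
  apply: (@le_trans _ _ x); last by apply: (le_trans hx); rewrite lerNl -normrN ler_norm.
  rewrite -[X in _ <= X]mul1r ler_wnM2r //.
  by have := @pi_ge2 R; move: pi => p; lra.
rewrite /Q; move: hz; move: (cexp _) => h hz.
have := P h (le_lt_trans hz d'd); rewrite add0r mul1r => H1.
have -> : q h - q 0 = (q h - q 0 - l * h) + l * h by rewrite subrK.
apply: (le_trans (le_normcD _ _)).
apply: (le_trans (lerD H1 (lexx _))); rewrite Normc.normcM.
have -> : nC h + nC l * nC h = (1 + nC l) * nC h by rewrite mulrDl mul1r.
apply: (@le_trans _ _ ((1 + nC l) * d')); first by rewrite ler_wpM2l // addr_ge0 ?normc_ge0.
by rewrite addrC mulrC -ler_pdivlMr.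
Qed.

Lemma MVP_pos : iseg (fun y => complex.Re (q (cexp ((2 * pi)%:C * (0 +i* y))))) 0 1 = complex.Re (q 0).
Proof.
apply: (@MVP_gen (fun x y => complex.Re (Q (x +i* y))) (fun x y => complex.Im (Q (x +i* y)))).
- by move=> x y x0; apply: CR_of_differentiable; exact: differentiable_MVP_Q.
- by move=> x; rewrite /Q -(cexp_period x 0) add0r.
- move=> e e0; have [x0 H] := MVP_lim e0; exists x0 => x y hx.
  by apply: le_trans (H x y hx); rewrite -[X in `|X|](raddfB (@complex.Re R : Rcomplex R -> R)) normc_Re.
Qed.

(** The circle run through clockwise. Passing to adjoints conjugates the points of the circle, so
    both orientations are needed. *)
Lemma MVP_neg : iseg (fun y => complex.Re (q (cexp ((2 * pi)%:C * (0 +i* (- y)))))) 0 1 = complex.Re (q 0).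
Proof.
apply: (@MVP_gen (fun x y => complex.Re (Q (x +i* (- y)))) (fun x y => - complex.Im (Q (x +i* (- y))))).
- by move=> x y x0; apply: (@CR_flip R (fun x y => complex.Re (Q (x +i* y))) (fun x y => complex.Im (Q (x +i* y)))); apply: CR_of_differentiable; exact: differentiable_MVP_Q.
- by move=> x; rewrite oppr0 /Q -(cexp_period x (- 1)) addNr.
- move=> e e0; have [x0 H] := MVP_lim e0; exists x0 => x y hx.
  by apply: le_trans (H x (- y) hx); rewrite -[X in `|X|](raddfB (@complex.Re R : Rcomplex R -> R)) normc_Re.
Qed.

End MVP.

(** * Lebesgue measure on [C^N] *)

(* An alias of ['rV[R[i]]_N], to carry the sigma-algebra generated by the real
   and imaginary parts of the coordinates. *)
Definition CN (R : realType) N : Type := 'rV[R[i]]_N.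
HB.instance Definition _ (R : realType) N := Choice.copy (CN R N) 'rV[R[i]]_N.
HB.instance Definition _ (R : realType) N := isPointed.Build (CN R N) (0 : 'rV[R[i]]_N).
Definition cyl (R : realType) N : set (set (CN R N)) := [set A | exists j (B : set (measurableTypeR R)), measurable B /\
  (A = (fun v : 'rV[R[i]]_N => complex.Re (v 0 j)) @^-1` B \/ A = (fun v : 'rV[R[i]]_N => complex.Im (v 0 j)) @^-1` B)].
Notation XRN R N := (g_sigma_algebraType (@cyl R N)).

Section meas.
Variable R : realType.
Notation XN N := (g_sigma_algebraType (@cyl R N)).

Lemma measurable_Rec N j : measurable_fun setT (fun v : XN N => complex.Re (v 0 j)).
Proof.
move=> _ B mB; rewrite setTI; apply: sub_sigma_algebra.
by exists j, B; split => //; left.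
Qed.

Lemma measurable_Imc N j : measurable_fun setT (fun v : XN N => complex.Im (v 0 j)).
Proof.
move=> _ B mB; rewrite setTI; apply: sub_sigma_algebra.
by exists j, B; split => //; right.
Qed.

Definition cmeas d (T : measurableType d) (F : T -> R[i]) :=
  measurable_fun setT (fun t => complex.Re (F t)) /\ measurable_fun setT (fun t => complex.Im (F t)).

Lemma measurable_toX d (T : measurableType d) N (h : T -> XN N) :
  (forall j, cmeas (fun t => h t 0 j)) -> measurable_fun setT h.
Proof.
move=> H; apply: (@measurability _ _ T (XN N) setT h (@cyl R N)) => //.
move=> _ [_ [j [B [mB [->|->]]]] <-].
  exact: (H j).1.
exact: (H j).2.
Qed.

Definition cconsp N (z : (measurableTypeR R * measurableTypeR R) * XN N) : XN N.+1 := ccons (of_pair z.1) z.2.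
Definition chead N (v : XN N.+1) : measurableTypeR R * measurableTypeR R := (complex.Re (v 0 ord0), complex.Im (v 0 ord0)).
Definition ctail N (v : XN N.+1) : XN N := \row_j v 0 (lift ord0 j).

Lemma ccons0 N a (v : 'rV[R[i]]_N) : ccons a v 0 ord0 = a.
Proof.
rewrite /ccons mxE; case: splitP => [k _|k]; first by rewrite mxE.
by move=> /eqP.
Qed.

Lemma cconsS N a (v : 'rV[R[i]]_N) j : ccons a v 0 (lift ord0 j) = v 0 j.
Proof.
rewrite /ccons mxE; case: splitP => [k /eqP|k]; first by rewrite ord1.
by move=> /eqP; rewrite lift0 eqSS => /eqP h; congr (v _ _); apply/val_inj.
Qed.

Lemma cconsp_chead N z : chead (@cconsp N z) = z.1.
Proof. by rewrite /chead /cconsp ccons0; case: z => -[a b]. Qed.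

Lemma cconsp_ctail N z : ctail (@cconsp N z) = z.2.
Proof. by apply/rowP => j; rewrite mxE cconsS. Qed.

Lemma cmeas_comp d d' (T : measurableType d) (T' : measurableType d') (F : T' -> R[i]) (g : T -> T') :
  measurable_fun setT g -> cmeas F -> cmeas (F \o g).
Proof. by move=> mg [m1 m2]; split; [exact: (measurableT_comp m1 mg)|exact: (measurableT_comp m2 mg)]. Qed.

Lemma measurable_cconsp N : measurable_fun setT (@cconsp N).
Proof.
apply: measurable_toX => j; case: (unliftP ord0 j) => [k ->|->].
  rewrite (_ : (fun _ => _) = (fun v : XN N => v 0 k) \o snd).
    apply: cmeas_comp; first exact: measurable_snd.
    by split; [exact: measurable_Rec|exact: measurable_Imc].
  by apply/funext => z; rewrite /cconsp cconsS.
rewrite (_ : (fun _ => _) = (fun z => of_pair z.1)); last first.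
  by apply/funext => z; rewrite /cconsp ccons0.
split => /=.
  exact: (measurableT_comp measurable_fst measurable_fst).
exact: (measurableT_comp measurable_snd measurable_fst).
Qed.

Lemma measurable_chead N : measurable_fun setT (@chead N).
Proof. by apply: measurable_fun_pair; [exact: measurable_Rec|exact: measurable_Imc]. Qed.

Lemma measurable_ctail N : measurable_fun setT (@ctail N).
Proof.
apply: measurable_toX => j; rewrite (_ : (fun _ => _) = (fun v : XN N.+1 => v 0 (lift ord0 j))).
  by split; [exact: measurable_Rec|exact: measurable_Imc].
by apply/funext => v; rewrite mxE.
Qed.

End meas.

Section prodM.
Context d1 d2 (T1 : measurableType d1) (T2 : measurableType d2) (R : realType).
Variables (m1 : {sigma_finite_measure set T1 -> \bar R}) (m2 : {sigma_finite_measure set T2 -> \bar R}).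
(** A name for the product measure on which sigma-finiteness is declared, so that it can itself be a
    factor of a product. *)
Definition prodm : set (T1 * T2)%type -> \bar R := (m1 \x m2)%E.
HB.instance Definition _ := Measure.on prodm.

Lemma prodm_sigma_finite : sigma_finite setT prodm.
Proof.
have /sigma_finiteP[F [TF ndF Ff]] := sigma_finiteT m1.
have /sigma_finiteP[G [TG ndG Gf]] := sigma_finiteT m2.
exists (fun k => F k `*` G k); last first.
  move=> k; have [mF lF] := Ff k; have [mG lG] := Gf k; split; first exact: measurableX.
  by rewrite /prodm product_measure1E // lte_mul_pinfty // ge0_fin_numE.
apply/esym/seteqP; split => // -[x y] _.
have [i _ Fx] : (\bigcup_k F k) x by rewrite -TF.
have [j _ Gy] : (\bigcup_k G k) y by rewrite -TG.
exists (maxn i j) => //; split.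
  by apply: (subsetPset _ _ (ndF _ _ (leq_maxl i j))).
by apply: (subsetPset _ _ (ndG _ _ (leq_maxr i j))).
Qed.

HB.instance Definition _ := Measure_isSigmaFinite.Build _ _ _ prodm prodm_sigma_finite.
End prodM.

Section mu.
Variable R : realType.
Notation XN N := (g_sigma_algebraType (@cyl R N)).
Definition lebCm : {sigma_finite_measure set (measurableTypeR R * measurableTypeR R)%type -> \bar R} :=
  prodm (@lebesgue_measure R) (@lebesgue_measure R).

Section cmu.
Variables (N : nat) (m : {sigma_finite_measure set (XN N) -> \bar R}).
Definition cmu : set (XN N.+1) -> \bar R := pushforward (prodm lebCm m) (@cconsp R N).
Definition cmuM : {measure set (XN N.+1) -> \bar R} :=
 measure_function_pushforward__canonical__measure_function_Measure (prodm lebCm m) (@measurable_cconsp R N).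
HB.instance Definition _ := Measure.copy cmu cmuM.

Lemma cmu_sigma_finite : sigma_finite setT cmu.
Proof.
have [A AT Afin] := sigma_finiteT (prodm lebCm m).
have mh : measurable_fun setT (fun v : XN N.+1 => (chead v, ctail v)).
  by apply: measurable_fun_pair; [exact: measurable_chead|exact: measurable_ctail].
exists (fun k => (fun v : XN N.+1 => (chead v, ctail v)) @^-1` A k).
  rewrite -preimage_bigcup -AT; exact/esym/preimage_setT.
move=> k; have [mA lA] := Afin k; split.
  by rewrite -[X in measurable X]setTI; exact: mh.
rewrite /cmu /pushforward /=.
rewrite (_ : _ @^-1` _ = A k) //.
by apply/seteqP; split => z /=; rewrite cconsp_chead cconsp_ctail -surjective_pairing.
Qed.

HB.instance Definition _ := Measure_isSigmaFinite.Build _ _ _ cmu cmu_sigma_finite.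
End cmu.

(** Lebesgue measure on [C^N], with the unit mass on [C^0]. The recursion runs parallel to those of
    [int_nonneg] and [int_C], which makes the comparison with them an induction. *)
Fixpoint mu N : {sigma_finite_measure set (XN N) -> \bar R} :=
  match N with 0 => dirac (0 : XN 0) | N'.+1 => cmu (mu N') end.
End mu.

(** The l1 norm of the plane: its integral is finite exactly when real and imaginary part are both
    integrable, for measurable functions. *)
Definition cnorm1 (R : realType) (z : R[i]) : R := `|complex.Re z| + `|complex.Im z|.

Lemma cnorm1_ge0 (R : realType) (z : R[i]) : 0 <= cnorm1 z.
Proof. by rewrite addr_ge0. Qed.

Lemma cnorm1M (R : realType) (z w : R[i]) : cnorm1 (z * w) <= cnorm1 z * cnorm1 w.
Proof.
case: z w => [a b] [c d]; rewrite /cnorm1 /= mulrDl !mulrDr -!normrM.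
have := ler_normB (a * c) (b * d); have := ler_normD (a * d) (b * c); lra.
Qed.

(** Real and imaginary part are each at most half of the right-hand side. This makes products of
    square integrable functions integrable. *)
Lemma cnorm1_mulJ (R : realType) (z w : R[i]) : cnorm1 (z * w^*) <= cabs2 z + cabs2 w.
Proof.
case: z w => [a b] [c d]; rewrite /cnorm1 /cabs2 /=.
rewrite -[X in _ <= X]addr0; apply: (@le_trans _ _ ((a ^+ 2 + b ^+ 2 + (c ^+ 2 + d ^+ 2)) / 2 + (a ^+ 2 + b ^+ 2 + (c ^+ 2 + d ^+ 2)) / 2)); last lra.
apply: lerD; rewrite ler_norml; apply/andP; split; have := sqr_ge0 (a + c); have := sqr_ge0 (a - c); have := sqr_ge0 (b + d); have := sqr_ge0 (b - d); have := sqr_ge0 (a + d); have := sqr_ge0 (a - d); have := sqr_ge0 (b + c); have := sqr_ge0 (b - c); clear; rewrite !expr2; lra.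
Qed.

(** * Integrals of complex-valued functions *)

Section cint.
Context d (T : measurableType d) (R : realType).
Variable m : {measure set T -> \bar R}.
Implicit Types F G : T -> R[i].

Lemma eq_integrableT (f g : T -> \bar R) : f =1 g -> m.-integrable setT f -> m.-integrable setT g.
Proof. by move=> /funext ->. Qed.

Definition cint F : R[i] := (\int[m]_x complex.Re (F x))%R +i* (\int[m]_x complex.Im (F x))%R.
Definition cintegrable F := m.-integrable setT (fun x => (complex.Re (F x))%:E) /\
  m.-integrable setT (fun x => (complex.Im (F x))%:E).

Lemma cintegrable_meas F : cintegrable F -> cmeas F.
Proof. by move=> [/measurable_int/measurable_EFinP mf /measurable_int/measurable_EFinP mg]. Qed.

Lemma eq_cint F G : F =1 G -> cint F = cint G.
Proof. by move=> FG; congr cint; apply/funext. Qed.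

Lemma cmeas_cnorm1 F : cmeas F -> measurable_fun setT (fun x => cnorm1 (F x)).
Proof. by move=> [m1 m2]; apply: measurable_funD; apply: measurableT_comp. Qed.

Lemma cmeas_cabs2 F : cmeas F -> measurable_fun setT (fun x => cabs2 (F x)).
Proof. by move=> [m1 m2]; apply: measurable_funD; apply: measurable_funX. Qed.

Lemma cintegrable_dom F (g : T -> R) : cmeas F -> measurable_fun setT g -> (forall x, cnorm1 (F x) <= g x) ->
  (\int[m]_x (g x)%:E < +oo)%E -> cintegrable F.
Proof.
move=> mF mg Fg Ig; have g0 x : 0 <= g x by apply: le_trans (Fg x); exact: cnorm1_ge0.
have H (f : T -> R) : measurable_fun setT f -> (forall x, `|f x| <= g x) -> m.-integrable setT (fun x => (f x)%:E).
  move=> mf fg; apply/integrableP; split; first exact/measurable_EFinP.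
  apply: le_lt_trans Ig; apply: ge0_le_integral => //.
  - by apply/measurableT_comp => //; exact/measurable_EFinP.
  - exact/measurable_EFinP.
  - by move=> x _; rewrite /= lee_fin.
split; apply: H; first exact: mF.1.
- by move=> x; apply: le_trans (Fg x); rewrite lerDl.
- exact: mF.2.
- by move=> x; apply: le_trans (Fg x); rewrite lerDr.
Qed.

Lemma cintegrable_cnorm1 F : cintegrable F -> (\int[m]_x (cnorm1 (F x))%:E < +oo)%E.
Proof.
move=> [i1 i2].
have i4 := integrableD measurableT (integrable_abse i1) (integrable_abse i2).
have /integrableP[mi i3] := i4.
apply: le_lt_trans i3; apply: ge0_le_integral => //.
- by move=> x _; rewrite lee_fin cnorm1_ge0.
- by apply/measurableT_comp.
- by move=> x _ /=; rewrite lee_fin ger0_norm ?cnorm1_ge0.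
Qed.

Lemma cint_conj F : cintegrable F -> cint (fun x => (F x)^*) = (cint F)^*.
Proof.
move=> [i1 i2]; rewrite /cint /=; congr (_ +i* _).
  by apply: eq_Rintegral => x _; case: (F x).
rewrite -[RHS]mulN1r -RintegralZl //; apply: eq_Rintegral => x _.
by rewrite mulN1r; case: (F x).
Qed.

Lemma cintegrable_conj F : cintegrable F -> cintegrable (fun x => (F x)^*).
Proof.
move=> [i1 i2]; split.
  by apply: (eq_integrableT _ i1) => x; case: (F x).
by apply: (eq_integrableT _ (integrableN i2)) => x /=; case: (F x).
Qed.

Lemma cmeasM F G : cmeas F -> cmeas G -> cmeas (fun x => F x * G x).
Proof.
move=> [a b] [a' b']; split.
  rewrite (_ : (fun _ => _) = (fun x => complex.Re (F x) * complex.Re (G x) - complex.Im (F x) * complex.Im (G x))).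
    by apply: measurable_funB; apply: measurable_funM.
  by apply/funext => x; case: (F x) (G x) => [? ?] [? ?].
rewrite (_ : (fun _ => _) = (fun x => complex.Re (F x) * complex.Im (G x) + complex.Im (F x) * complex.Re (G x))).
  by apply: measurable_funD; apply: measurable_funM.
by apply/funext => x; case: (F x) (G x) => [? ?] [? ?].
Qed.

Lemma cmeasD F G : cmeas F -> cmeas G -> cmeas (fun x => F x + G x).
Proof.
move=> [a b] [a' b']; split.
  rewrite (_ : (fun _ => _) = (fun x => complex.Re (F x) + complex.Re (G x))).
    by apply: measurable_funD.
  by apply/funext => x; case: (F x) (G x) => [? ?] [? ?].
rewrite (_ : (fun _ => _) = (fun x => complex.Im (F x) + complex.Im (G x))).
  by apply: measurable_funD.
by apply/funext => x; case: (F x) (G x) => [? ?] [? ?].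
Qed.

Lemma cmeas_conj F : cmeas F -> cmeas (fun x => (F x)^*).
Proof.
move=> [a b]; split.
  by apply: eq_measurable_fun a => x _; case: (F x).
by apply: eq_measurable_fun (measurable_funN b) => x _ /=; case: (F x).
Qed.

Lemma cmeas_cst (c : R[i]) : cmeas (fun _ : T => c).
Proof. by split; exact: measurable_cst. Qed.

Lemma cintegrableZ (c : R[i]) F : cintegrable F -> cintegrable (fun x => c * F x).
Proof.
move=> iF; apply: (@cintegrable_dom _ (fun x => cnorm1 c * cnorm1 (F x))).
- by apply: cmeasM (cintegrable_meas iF); exact: cmeas_cst.
- apply: measurable_funM; first exact: measurable_cst.
  exact/cmeas_cnorm1/cintegrable_meas.
- by move=> x; exact: cnorm1M.
- have := cintegrable_cnorm1 iF; under [in X in _ -> X]eq_integral do rewrite EFinM.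
  move=> h; rewrite ge0_integralZl_EFin //; first last.
  + exact: cnorm1_ge0.
  + by apply/measurable_EFinP; exact/cmeas_cnorm1/cintegrable_meas.
  + by move=> x _; rewrite lee_fin cnorm1_ge0.
  by rewrite lte_mul_pinfty // lee_fin cnorm1_ge0.
Qed.

Lemma cintZ (c : R[i]) F : cintegrable F -> cint (fun x => c * F x) = c * cint F.
Proof.
move=> [i1 i2]; case: c => a b; rewrite /cint; simpc; congr (_ +i* _).
  rewrite -!RintegralZl // -RintegralB //; first last.
  - by apply: (eq_integrableT _ (integrableZl measurableT b i2)) => x /=; rewrite EFinM.
  - by apply: (eq_integrableT _ (integrableZl measurableT a i1)) => x /=; rewrite EFinM.
  by apply: eq_Rintegral => x _; case: (F x).
rewrite -!RintegralZl // -RintegralD //; first last.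
- by apply: (eq_integrableT _ (integrableZl measurableT b i1)) => x /=; rewrite EFinM.
- by apply: (eq_integrableT _ (integrableZl measurableT a i2)) => x /=; rewrite EFinM.
by apply: eq_Rintegral => x _; case: (F x).
Qed.

Lemma cint_ae F G : cmeas F -> cmeas G -> {ae m, forall x, F x = G x} -> cint F = cint G.
Proof.
move=> mF mG FG; rewrite /cint /Rintegral; congr (fine _ +i* fine _); apply: ae_eq_integral => //.
- exact/measurable_EFinP/mF.1.
- exact/measurable_EFinP/mG.1.
- by apply: filterS FG => x /= -> _.
- exact/measurable_EFinP/mF.2.
- exact/measurable_EFinP/mG.2.
- by apply: filterS FG => x /= -> _.
Qed.

Lemma cintegrable_ae F G : cintegrable F -> cmeas G -> {ae m, forall x, F x = G x} -> cintegrable G.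
Proof.
move=> iF mG FG; apply: (@cintegrable_dom _ (fun x => cnorm1 (G x))) => //; first exact: cmeas_cnorm1.
have := cintegrable_cnorm1 iF; rewrite (ae_eq_integral (fun x => (cnorm1 (G x))%:E)) //.
- exact/measurable_EFinP/cmeas_cnorm1/cintegrable_meas.
- exact/measurable_EFinP/cmeas_cnorm1.
- by apply: filterS FG => x /= -> _.
Qed.

End cint.

(** * Fubini's theorem for complex-valued functions *)

Section cfubini.
Context d1 d2 (T1 : measurableType d1) (T2 : measurableType d2) (R : realType).
Variables (m1 : {sigma_finite_measure set T1 -> \bar R}) (m2 : {sigma_finite_measure set T2 -> \bar R}).
Implicit Types F : T1 * T2 -> R[i].

Lemma tonelli1 (f : T1 * T2 -> \bar R) : measurable_fun setT f -> (forall z, 0 <= f z)%E ->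
  (\int[prodm m1 m2]_z f z = \int[m1]_x \int[m2]_y f (x, y))%E.
Proof. by move=> mf f0; exact: (@fubini_tonelli1 _ _ _ _ _ m1 m2 f mf f0). Qed.

Lemma tonelli2 (f : T1 * T2 -> \bar R) : measurable_fun setT f -> (forall z, 0 <= f z)%E ->
  (\int[prodm m1 m2]_z f z = \int[m2]_y \int[m1]_x f (x, y))%E.
Proof. by move=> mf f0; exact: (@fubini_tonelli2 _ _ _ _ _ m1 m2 f mf f0). Qed.

Lemma cmeas_pair1 F x : cmeas F -> cmeas (fun y => F (x, y)).
Proof. by move=> [a b]; split; [exact: (measurableT_comp a (pair1_measurable x))|exact: (measurableT_comp b (pair1_measurable x))]. Qed.

(** Integrability plays no part: the integrals of the positive and of the negative part are
    measurable by Tonelli, and so is [fine] of their difference. *)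
Lemma measurable_Rintegral2 (f : T1 * T2 -> R) : measurable_fun setT f ->
  measurable_fun setT (fun x => \int[m2]_y f (x, y))%R.
Proof.
move=> mf; apply: (measurableT_comp (f := fine)) => //.
have mf' : measurable_fun setT (EFin \o f) by exact/measurable_EFinP.
rewrite (_ : (fun _ => _) = ((fun x => \int[m2]_y (EFin \o f)^\+ (x, y)) \- (fun x => \int[m2]_y (EFin \o f)^\- (x, y)))%E).
  apply: emeasurable_funB.
    by apply: (@measurable_fun_fubini_tonelli_F _ _ _ _ _ m2) => //; exact: measurable_funepos.
  by apply: (@measurable_fun_fubini_tonelli_F _ _ _ _ _ m2) => //; exact: measurable_funeneg.
by apply/funext => x; rewrite [LHS]integralE; congr (_ - _)%E; apply: eq_integral => y _; rewrite ?funeposE ?funenegE.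
Qed.

Lemma measurable_Rintegral1 (f : T1 * T2 -> R) : measurable_fun setT f ->
  measurable_fun setT (fun y => \int[m1]_x f (x, y))%R.
Proof.
move=> mf; apply: (measurableT_comp (f := fine)) => //.
have mf' : measurable_fun setT (EFin \o f) by exact/measurable_EFinP.
rewrite (_ : (fun _ => _) = ((fun y => \int[m1]_x (EFin \o f)^\+ (x, y)) \- (fun y => \int[m1]_x (EFin \o f)^\- (x, y)))%E).
  apply: emeasurable_funB.
    by apply: (@measurable_fun_fubini_tonelli_G _ _ _ _ _ m1) => //; exact: measurable_funepos.
  by apply: (@measurable_fun_fubini_tonelli_G _ _ _ _ _ m1) => //; exact: measurable_funeneg.
by apply/funext => x; rewrite [LHS]integralE; congr (_ - _)%E; apply: eq_integral => y _; rewrite ?funeposE ?funenegE.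
Qed.

Lemma cmeas_cint2 F : cmeas F -> cmeas (fun x => cint m2 (fun y => F (x, y))).
Proof. by move=> [a b]; split; [exact: (measurable_Rintegral2 a)|exact: (measurable_Rintegral2 b)]. Qed.

Lemma ae_cintegrable1 F : cintegrable (prodm m1 m2) F ->
  {ae m1, forall x, cintegrable m2 (fun y => F (x, y))}.
Proof. by move=> [a b]; have h1 := ae_integrable1 a; have h2 := ae_integrable1 b; apply: filterS2 h1 h2 => x ? ?; split. Qed.

(** Almost every section is integrable, so [fine] alters the extended-real section integral only on
    a null set. *)
Let R12 (f : T1 * T2 -> R) : (prodm m1 m2).-integrable setT (fun z => (f z)%:E) ->
  (\int[m1]_x \int[m2]_y f (x, y) = \int[prodm m1 m2]_z f z)%R /\ m1.-integrable setT (fun x => (\int[m2]_y f (x, y))%R%:E).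
Proof.
move=> If; have If' : (m1 \x m2)%E.-integrable setT (fun z => (f z)%:E) := If.
have mf := (measurable_EFinP _ _).1 (measurable_int _ If).
have E : {ae m1, forall x, setT x -> ((\int[m2]_y f (x, y))%R%:E = fubini_F m2 (fun z => (f z)%:E) x)}.
  apply: filterS (ae_integrable1 If') => x Ix _.
  by rewrite /Rintegral fineK //; exact: integrable_fin_num.
have mF := measurable_fubini_F If'.
have mG : measurable_fun setT (fun x => (\int[m2]_y f (x, y))%R%:E).
  by apply/measurable_EFinP; exact: measurable_Rintegral2.
split.
  rewrite {1}/Rintegral (ae_eq_integral (fubini_F m2 (fun z => (f z)%:E))) //.
  by rewrite integral12_prod_meas1.
have IF := integrable_fubini_F If'.
apply/integrableP; split => //; have /integrableP[_] := IF.
rewrite (ae_eq_integral (fun x => `|(\int[m2]_y f (x, y))%R%:E|%E)) //.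
- exact: measurableT_comp.
- exact: measurableT_comp.
- by apply: filterS E => x E sx; congr (`|_|%E); exact/esym/E.
Qed.

Let R21 (f : T1 * T2 -> R) : (prodm m1 m2).-integrable setT (fun z => (f z)%:E) ->
  (\int[m2]_y \int[m1]_x f (x, y) = \int[prodm m1 m2]_z f z)%R.
Proof.
move=> If; have If' : (m1 \x m2)%E.-integrable setT (fun z => (f z)%:E) := If.
have mf := (measurable_EFinP _ _).1 (measurable_int _ If).
have E : {ae m2, forall y, setT y -> ((\int[m1]_x f (x, y))%R%:E = fubini_G m1 (fun z => (f z)%:E) y)}.
  apply: filterS (ae_integrable2 If') => x Ix _.
  by rewrite /Rintegral fineK //; exact: integrable_fin_num.
have mF := measurable_fubini_G If'.
have mG : measurable_fun setT (fun y => (\int[m1]_x f (x, y))%R%:E).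
  by apply/measurable_EFinP; exact: measurable_Rintegral1.
rewrite {1}/Rintegral (ae_eq_integral (fubini_G m1 (fun z => (f z)%:E))) //.
by rewrite integral21_prod_meas1.
Qed.

Lemma cfubini1 F : cintegrable (prodm m1 m2) F ->
  cint m1 (fun x => cint m2 (fun y => F (x, y))) = cint (prodm m1 m2) F.
Proof. by move=> [/R12[a _] /R12[b _]]; rewrite /cint /= a b. Qed.

Lemma cfubini2 F : cintegrable (prodm m1 m2) F ->
  cint m2 (fun y => cint m1 (fun x => F (x, y))) = cint (prodm m1 m2) F.
Proof. by move=> [/R21 a /R21 b]; rewrite /cint /= a b. Qed.

Lemma cintegrable_cint F : cintegrable (prodm m1 m2) F ->
  cintegrable m1 (fun x => cint m2 (fun y => F (x, y))).
Proof. by move=> [/R12[_ a] /R12[_ b]]; split. Qed.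

Let R21_integrable (f : T1 * T2 -> R) : (prodm m1 m2).-integrable setT (fun z => (f z)%:E) ->
  m2.-integrable setT (fun y => (\int[m1]_x f (x, y))%R%:E).
Proof.
move=> If; have /integrableP[/measurable_EFinP mf fin] := If.
have mG : measurable_fun setT (fun y => (\int[m1]_x f (x, y))%R%:E).
  by apply/measurable_EFinP; exact: measurable_Rintegral1.
have ma : measurable_fun setT (fun z => `|(f z)%:E|%E) by do 2 apply: measurableT_comp => //.
apply/integrableP; split => //; apply: le_lt_trans fin.
rewrite (tonelli2 ma) //; apply: ge0_le_integral => //.
- exact: measurableT_comp.
- by apply: (@measurable_fun_fubini_tonelli_G _ _ _ _ _ m1 (fun z => `|(f z)%:E|%E)).
move=> y _; have my : measurable_fun setT (fun x => (f (x, y))%:E).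
  by apply/measurable_EFinP; exact: (measurableT_comp mf (measurable_pair2 y)).
apply: le_trans (le_abse_integral m1 measurableT my).
(* An infinite section integral has [fine] equal to 0 and satisfies the bound. *)
by rewrite /Rintegral; case: (\int[m1]_x _)%E => [r| |]; rewrite /= ?normr0 ?leey.
Qed.

Lemma cintegrable_cint2 F : cintegrable (prodm m1 m2) F ->
  cintegrable m2 (fun y => cint m1 (fun x => F (x, y))).
Proof. by move=> [/R21_integrable a /R21_integrable b]; split. Qed.

Lemma cintegrable_prod F : cmeas F -> (\int[m1]_x \int[m2]_y (cnorm1 (F (x, y)))%:E < +oo)%E ->
  cintegrable (prodm m1 m2) F.
Proof.
move=> mF h; apply: (@cintegrable_dom _ _ _ _ _ (fun z => cnorm1 (F z))) => //; first exact: cmeas_cnorm1.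
rewrite tonelli1 //; first exact/measurable_EFinP/cmeas_cnorm1.
by move=> z; rewrite lee_fin cnorm1_ge0.
Qed.

End cfubini.

(** * Integrals against an image measure *)

Section push.
Context d1 d2 (T1 : measurableType d1) (T2 : measurableType d2) (R : realType).
Variables (m : {measure set T1 -> \bar R}) (phi : T1 -> T2) (mphi : measurable_fun setT phi) (m' : {measure set T2 -> \bar R}).
Hypothesis m'E : forall A, measurable A -> m' A = pushforward m phi A.

Lemma integral_push (f : T2 -> \bar R) : measurable_fun setT f -> (forall y, 0 <= f y)%E ->
  (\int[m']_y f y = \int[m]_x f (phi x))%E.
Proof.
move=> mf f0; have := @ge0_integral_pushforward _ _ _ _ _ phi mphi m setT f measurableT mf (fun y _ => f0 y).
rewrite preimage_setT => <-; apply: (@eq_measure_integral _ _ _ _ (measure_function_pushforward__canonical__measure_function_Measure m mphi)) => A mA _.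
exact: m'E.
Qed.

Lemma Rintegral_push (f : T2 -> R) : measurable_fun setT f ->
  (\int[m']_y f y = \int[m]_x f (phi x))%R.
Proof.
move=> mf; rewrite /Rintegral [in LHS]integralE [in RHS]integralE.
have mf' : measurable_fun setT (fun y => (f y)%:E) by exact/measurable_EFinP.
rewrite integral_push //; last exact: measurable_funepos.
rewrite (integral_push (f := (fun y => (f y)%:E)^\-%E)) //; last exact: measurable_funeneg.
by congr (fine (_ - _)); apply: eq_integral => x _; rewrite ?funeposE ?funenegE.
Qed.

Lemma cint_push (F : T2 -> R[i]) : cmeas F -> cint m' F = cint m (F \o phi).
Proof. by move=> [a b]; rewrite /cint /= !Rintegral_push. Qed.

Lemma cintegrable_push (F : T2 -> R[i]) : cmeas F -> cintegrable m' F <-> cintegrable m (F \o phi).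
Proof.
move=> mF; have mF' := cmeas_comp mphi mF; have mc := cmeas_cnorm1 mF.
have E : (\int[m']_y (cnorm1 (F y))%:E = \int[m]_x (cnorm1 ((F \o phi) x))%:E)%E.
  rewrite integral_push //; first exact/measurable_EFinP.
  by move=> y; rewrite lee_fin cnorm1_ge0.
split=> /cintegrable_cnorm1 h.
  by apply: (cintegrable_dom mF' (cmeas_cnorm1 mF')) => //; rewrite -E.
by apply: (cintegrable_dom mF mc) => //; rewrite E.
Qed.

End push.

(** * Iterated integrals as integrals against [mu] *)

Section intmu.
Variable R : realType.
Notation XN N := (g_sigma_algebraType (@cyl R N)).
(* [lebC] integrates over [R * R] with the canonical Borel structure of [R],
   not that of [measurableTypeR R]. *)
Definition idRR (p : (measurableTypeR R * measurableTypeR R)%type) : (R * R)%type := p.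

Lemma measurable_idRR : measurable_fun setT idRR.
Proof. by move=> _ A mA; rewrite setTI; exact: mA. Qed.

Lemma integral_lebC (f : (R * R)%type -> \bar R) :
  measurable_fun setT (f : (measurableTypeR R * measurableTypeR R)%type -> \bar R) -> (forall p, 0 <= f p)%E ->
  integral (@lebC R) setT f = (\int[lebCm R]_p f p)%E.
Proof.
move=> mf f0; have mf' : measurable_fun setT f by move=> mD A mA; have := mf mD A mA.
exact: (@integral_push _ _ _ _ R (lebCm R) idRR measurable_idRR (measure_function_pushforward__canonical__measure_function_Measure (lebCm R) measurable_idRR) (fun A mA => erefl) f mf' f0).
Qed.

Lemma Rintegral_lebC (f : (R * R)%type -> R) :
  measurable_fun setT (f : (measurableTypeR R * measurableTypeR R)%type -> R) ->
  fine (integral (@lebC R) setT (fun p => (f p)%:E)) = (\int[lebCm R]_p f p)%R.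
Proof.
move=> mf; have mf' : measurable_fun setT f by move=> mD A mA; have := mf mD A mA.
exact: (@Rintegral_push _ _ _ _ R (lebCm R) idRR measurable_idRR (measure_function_pushforward__canonical__measure_function_Measure (lebCm R) measurable_idRR) (fun A mA => erefl) f mf').
Qed.

Lemma int_muS N (F : XN N.+1 -> \bar R) : measurable_fun setT F -> (forall v, 0 <= F v)%E ->
  (\int[mu R N.+1]_v F v = \int[lebCm R]_p \int[mu R N]_v F (ccons (of_pair p) v))%E.
Proof.
move=> mF F0.
rewrite (@integral_push _ _ _ _ R (prodm (lebCm R) (mu R N)) (@cconsp R N) (@measurable_cconsp R N) (mu R N.+1) (fun A mA => erefl) F mF F0).
have mF' : measurable_fun setT (fun z => F (@cconsp R N z)) := measurableT_comp mF (@measurable_cconsp R N).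
by rewrite (tonelli1 _ _ mF').
Qed.

Lemma int_nonneg_mu N (F : 'rV[R[i]]_N -> \bar R) : measurable_fun setT (F : XN N -> \bar R) ->
  (forall v, 0 <= F v)%E -> int_nonneg F = (\int[mu R N]_v F v)%E.
Proof.
elim: N F => [|N IH] F mF F0.
  by rewrite /= integral_dirac // diracT mul1e.
rewrite (int_muS mF F0).
have -> : int_nonneg F = integral (@lebC R) setT (fun p => int_nonneg (fun v => F (ccons (of_pair p) v))) by [].
have mF' : measurable_fun setT (fun z => F (@cconsp R N z)) := measurableT_comp mF (@measurable_cconsp R N).
have E p : int_nonneg (fun v => F (ccons (of_pair p) v)) = (\int[mu R N]_v F (ccons (of_pair p) v))%E.
  by apply: IH => //; exact: (measurableT_comp mF' (pair1_measurable p)).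
rewrite (_ : (fun p => _) = (fun p => \int[mu R N]_v F (ccons (of_pair p) v))%E); last exact/funext.
rewrite integral_lebC //; last by move=> p; exact: integral_ge0.
exact: (@measurable_fun_fubini_tonelli_F _ _ _ _ _ (mu R N) _ mF').
Qed.

(** The parameter space is arbitrary so that the induction can absorb the first coordinate into
    it. *)
Lemma cmeas_int_C N d (T : measurableType d) (F : T -> 'rV[R[i]]_N -> R[i]) :
  cmeas (fun z : T * XN N => F z.1 z.2) -> cmeas (fun t => int_C (F t)).
Proof.
elim: N d T F => [|N IH] d T F mF /=.
  have h := cmeas_comp (pair2_measurable (0 : XN 0)) mF.
  exact: h.
have mG : cmeas (fun tp : T * (measurableTypeR R * measurableTypeR R) => int_C (fun v : 'rV_N => F tp.1 (ccons (of_pair tp.2) v))).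
  apply: IH => /=.
  have mh : measurable_fun setT (fun z : (T * (measurableTypeR R * measurableTypeR R)) * XN N => (z.1.1, cconsp (z.1.2, z.2))).
    apply: measurable_fun_pair; first exact: (measurableT_comp measurable_fst measurable_fst).
    apply: (measurableT_comp (@measurable_cconsp R N)).
    apply: measurable_fun_pair; last exact: measurable_snd.
    exact: (measurableT_comp measurable_snd measurable_fst).
  exact: (cmeas_comp mh mF).
have mG' t : cmeas (fun p : measurableTypeR R * measurableTypeR R => int_C (fun v : 'rV_N => F t (ccons (of_pair p) v))).
  exact: (cmeas_pair1 t mG).
rewrite (_ : (fun t => _) = (fun t => cint (lebCm R) (fun p => int_C (fun v : 'rV_N => F t (ccons (of_pair p) v))))).
  exact: (cmeas_cint2 (lebCm R) mG).
by apply/funext => t; have [a b] := mG' t; rewrite !Rintegral_lebC.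
Qed.

(** The induction hypothesis covers only those [p] whose section is integrable. These are almost
    all, so the outer integrals agree by [cint_ae], which needs the measurability given by
    [cmeas_int_C]. *)
Lemma int_C_mu N (F : 'rV[R[i]]_N -> R[i]) : cintegrable (mu R N) F -> int_C F = cint (mu R N) F.
Proof.
elim: N F => [|N IH] F IF.
  rewrite /= /cint /Rintegral.
  have [/measurable_int mf /measurable_int mg] := IF.
  by rewrite !integral_dirac // !diracT !mul1e /=; case: (F 0).
have mF := cintegrable_meas IF.
have IF' : cintegrable (prodm (lebCm R) (mu R N)) (F \o @cconsp R N).
  exact: (@cintegrable_push _ _ _ _ R (prodm (lebCm R) (mu R N)) (@cconsp R N) (@measurable_cconsp R N) (mu R N.+1) (fun A mA => erefl) F mF).1.
rewrite (@cint_push _ _ _ _ R (prodm (lebCm R) (mu R N)) (@cconsp R N) (@measurable_cconsp R N) (mu R N.+1) (fun A mA => erefl) F mF).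
rewrite -(cfubini1 IF').
have mI : cmeas (fun p : measurableTypeR R * measurableTypeR R => int_C (fun v : 'rV_N => F (ccons (of_pair p) v))).
  apply: (@cmeas_int_C N _ _ (fun p v => F (ccons (of_pair p) v))).
  exact: (cmeas_comp (@measurable_cconsp R N) mF).
have -> : int_C F = cint (lebCm R) (fun p => int_C (fun v : 'rV_N => F (ccons (of_pair p) v))).
  by have [a b] := mI; rewrite /= !Rintegral_lebC.
apply: cint_ae => //.
- by apply: cmeas_cint2; exact: (cmeas_comp (@measurable_cconsp R N) mF).
- by apply: filterS (ae_cintegrable1 IF') => p Ip; rewrite IH.
Qed.

End intmu.

(** * Changes of variables *)

(** Infinite values are included, since [fine] sends them to 0 on both sides; the change of
    variables below can thus do without integrability. *)
Lemma fine_scaleB (R : realType) (J : R) (a b : \bar R) : 0 < J ->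
  fine (J%:E * a - J%:E * b)%E = J * fine (a - b)%E.
Proof.
move=> J0; case: a b => [a||] [b||] //=; rewrite ?gt0_muley ?gt0_muleNy ?lte_fin //= ?mulr0 //.
by rewrite mulrBr.
Qed.

Section scaled_push.
Context d1 d2 (T1 : measurableType d1) (T2 : measurableType d2) (R : realType).
Variables (m : {measure set T1 -> \bar R}) (phi : T1 -> T2) (mphi : measurable_fun setT phi) (m' : {measure set T2 -> \bar R}) (J : R).
Hypothesis J0 : 0 < J.
(** Change of variables by [phi] with constant Jacobian [J], on nonnegative functions. Every
    substitution made below is of this kind. *)
Definition scaled_push_hyp := forall f : T2 -> \bar R, measurable_fun setT f -> (forall y, 0 <= f y)%E ->
  (\int[m']_y f y = J%:E * \int[m]_x f (phi x))%E.
Hypothesis H : scaled_push_hyp.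

Lemma Rintegral_spush (f : T2 -> R) : measurable_fun setT f ->
  (\int[m']_y f y = J * \int[m]_x f (phi x))%R.
Proof.
move=> mf; rewrite /Rintegral [in LHS]integralE [in RHS]integralE.
have mf' : measurable_fun setT (fun y => (f y)%:E) by exact/measurable_EFinP.
rewrite (H (measurable_funepos mf')) // (H (measurable_funeneg mf')) //.
rewrite fine_scaleB // -!(eq_integral _ _ (fun x _ => congr1 (fun g : T1 -> \bar R => g x) (funepos_comp _ phi))).
rewrite -!(eq_integral _ _ (fun x _ => congr1 (fun g : T1 -> \bar R => g x) (funeneg_comp _ phi))).
by [].
Qed.

Lemma cint_spush (F : T2 -> R[i]) : cmeas F -> cint m' F = J%:C * cint m (F \o phi).
Proof. by move=> [a b]; rewrite /cint /= !Rintegral_spush //; simpc. Qed.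

Lemma cintegrable_spush (F : T2 -> R[i]) : cmeas F -> cintegrable m' F <-> cintegrable m (F \o phi).
Proof.
move=> mF; have mF' := cmeas_comp mphi mF; have mc := cmeas_cnorm1 mF.
have E : (\int[m']_y (cnorm1 (F y))%:E = J%:E * \int[m]_x (cnorm1 ((F \o phi) x))%:E)%E.
  by apply: H; [exact/measurable_EFinP|move=> y; rewrite lee_fin cnorm1_ge0].
have I0 : (0 <= \int[m]_x (cnorm1 ((F \o phi) x))%:E)%E.
  by apply: integral_ge0 => x _; rewrite lee_fin cnorm1_ge0.
split=> /cintegrable_cnorm1 h.
  apply: (cintegrable_dom mF' (cmeas_cnorm1 mF')) => //; move: h; rewrite E; move: I0.
  by case: integral => [r||] // _; rewrite ?ltry ?gt0_muley ?lte_fin.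
by apply: (cintegrable_dom mF mc) => //; rewrite E lte_mul_pinfty // lee_fin ltW.
Qed.

End scaled_push.

Section affine.
Variable R : realType.
Notation leb := (@lebesgue_measure R).

Lemma measurable_affine (c a : R) : measurable_fun setT (fun t : measurableTypeR R => c * t + a : measurableTypeR R).
Proof. by apply: measurable_funD => //; apply: measurable_funM. Qed.

(** By uniqueness of Lebesgue measure only half-open intervals are compared; a negative [c]
    exchanges the open and the closed end, which does not affect the length. *)
Lemma lebesgue_affine (c a : R) : c != 0 -> @scaled_push_hyp _ _ (measurableTypeR R) (measurableTypeR R) R leb (fun t => c * t + a) leb `|c|.
Proof.
move=> c0 f mf f0.
pose m1 : {measure set (measurableTypeR R) -> \bar R} := measure_function_pushforward__canonical__measure_function_Measure leb (measurable_affine c a).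
pose m2 := mscale (NngNum (normr_ge0 c)) m1.
have E : forall A, measurable A -> leb A = m2 A.
  apply: lebesgue_measure_unique => X /ocitvP[->|[[x y] /= xy ->]].
    by rewrite !measure0.
  rewrite /m2 /mscale /= /pushforward lebesgue_measure_itv /= lte_fin xy.
  have [cp|cn] := ltP 0 c.
    have -> : (fun t : measurableTypeR R => c * t + a) @^-1` `]x, y] = `](x - a) / c, (y - a) / c]%classic.
      apply/seteqP; split => t /=; rewrite !in_itv /= ltr_pdivrMr // ler_pdivlMr // ltrBlDr lerBrDr mulrC //.
    rewrite lebesgue_measure_itv /= lte_fin ltr_pM2r ?invr_gt0 // ltrD2r xy.
    rewrite gtr0_norm // -EFinB -EFinB -EFinM; congr EFin; by field.
  have {}cn : c < 0 by rewrite lt_neqAle c0.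
  have -> : (fun t : measurableTypeR R => c * t + a) @^-1` `]x, y] = `[(y - a) / c, (x - a) / c[%classic.
    by apply/seteqP; split => t /=; rewrite !in_itv /= ler_ndivrMr // ltr_ndivlMr // lerBrDr ltrBlDr mulrC andbC.
  rewrite lebesgue_measure_itv /= lte_fin ltr_nM2r ?invr_lt0 // ltrD2r xy.
  rewrite ltr0_norm // -EFinB -EFinB -EFinM; congr EFin; by field.
rewrite (@eq_measure_integral _ _ _ _ m2 leb) => [|A mA _]; last exact: E.
rewrite ge0_integral_mscale //= ; congr (_ * _)%E.
exact: (@integral_push _ _ _ _ R leb _ (measurable_affine c a) m1 (fun A mA => erefl) f mf f0).
Qed.

End affine.

(** * Shears and complex multiplication in the plane *)

Section planar.
Variable R : realType.
Notation mR := (measurableTypeR R).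
Notation leb := (@lebesgue_measure R).
Definition planar (phi : mR * mR -> mR * mR) (J : R) :=
  measurable_fun setT phi /\ @scaled_push_hyp _ _ _ _ R (lebCm R) phi (lebCm R) J.

Lemma planar_comp phi psi J J' : planar phi J -> planar psi J' -> 0 <= J -> planar (phi \o psi) (J * J').
Proof.
move=> [mp hp] [mq hq] J0; split; first exact: measurableT_comp.
move=> f mf f0; rewrite hp // EFinM -muleA; congr (_ * _)%E.
exact: (hq (f \o phi) (measurableT_comp mf mp) (fun y => f0 _)).
Qed.

Lemma planar_shear1 (a : R) (g : mR -> mR) : a != 0 -> measurable_fun setT g ->
  planar (fun z => (a * z.1 + g z.2, z.2)) `|a|.
Proof.
move=> a0 mg.
have mphi : measurable_fun setT (fun z : mR * mR => (a * z.1 + g z.2 : mR, z.2 : mR)).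
  apply: measurable_fun_pair; last exact: measurable_snd.
  apply: measurable_funD; last exact: (measurableT_comp mg measurable_snd).
  by apply: measurable_funM => //; exact: measurable_fst.
split=> // f mf f0.
have mf' := measurableT_comp mf mphi.
have E : (\int[leb]_y (`|a|%:E * \int[leb]_x f (a * x + g y, y)%R) = `|a|%:E * \int[leb]_y \int[leb]_x f (a * x + g y, y)%R)%E.
  apply: ge0_integralZl_EFin => //; first by move=> y _; exact: integral_ge0.
  exact: (@measurable_fun_fubini_tonelli_G _ _ _ _ _ leb _ mf' (fun z => f0 _)).
have T2 := tonelli2 leb leb mf' (fun z => f0 _).
etransitivity; first exact: (tonelli2 leb leb mf f0).
transitivity (`|a|%:E * \int[leb]_y \int[leb]_x f (a * x + g y, y)%R)%E; last by congr (_ * _)%E; exact/esym/T2.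
rewrite -E; apply: eq_integral => y _.
exact: (lebesgue_affine (g y) a0 (measurableT_comp mf (pair2_measurable y)) (fun x => f0 (x, y))).
Qed.

Lemma planar_shear2 (a : R) (g : mR -> mR) : a != 0 -> measurable_fun setT g ->
  planar (fun z => (z.1, a * z.2 + g z.1)) `|a|.
Proof.
move=> a0 mg.
have mphi : measurable_fun setT (fun z : mR * mR => (z.1 : mR, a * z.2 + g z.1 : mR)).
  apply: measurable_fun_pair; first exact: measurable_fst.
  apply: measurable_funD; last exact: (measurableT_comp mg measurable_fst).
  by apply: measurable_funM => //; exact: measurable_snd.
split=> // f mf f0.
have mf' := measurableT_comp mf mphi.
have E : (\int[leb]_y (`|a|%:E * \int[leb]_x f (y, a * x + g y)%R) = `|a|%:E * \int[leb]_y \int[leb]_x f (y, a * x + g y)%R)%E.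
  apply: ge0_integralZl_EFin => //; first by move=> y _; exact: integral_ge0.
  exact: (@measurable_fun_fubini_tonelli_F _ _ _ _ _ leb _ mf' (fun z => f0 _)).
have T2 := tonelli1 leb leb mf' (fun z => f0 _).
etransitivity; first exact: (tonelli1 leb leb mf f0).
transitivity (`|a|%:E * \int[leb]_y \int[leb]_x f (y, a * x + g y)%R)%E; last by congr (_ * _)%E; exact/esym/T2.
rewrite -E; apply: eq_integral => y _.
exact: (lebesgue_affine (g y) a0 (measurableT_comp mf (pair1_measurable y)) (fun x => f0 (y, x))).
Qed.

Lemma planar_translation (z0 : mR * mR) : planar (fun z => (z.1 + z0.1, z.2 + z0.2)) 1.
Proof.
have h1 := @planar_shear1 1 (fun=> z0.1) (oner_neq0 _) (@measurable_cst _ _ _ _ _ _).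
have h2 := @planar_shear2 1 (fun=> z0.2) (oner_neq0 _) (@measurable_cst _ _ _ _ _ _).
have := planar_comp h1 h2; rewrite normr1 mulr1 => /(_ ler01).
by congr (planar _ _); apply/funext => z /=; rewrite !mul1r.
Qed.

Definition cmulp (l : R[i]) (z : mR * mR) : mR * mR :=
  (complex.Re l * z.1 - complex.Im l * z.2, complex.Im l * z.1 + complex.Re l * z.2).

Lemma of_pair_cmulp l z : of_pair (cmulp l z) = l * of_pair z.
Proof. by case: l z => [a b] [x y]; rewrite /of_pair /cmulp /=; simpc; rewrite addrC [X in _ +i* X]addrC. Qed.

Lemma cabs2M (z w : R[i]) : cabs2 (z * w) = cabs2 z * cabs2 w.
Proof. by case: z w => [a b] [c d]; rewrite /cabs2 /=; ring. Qed.

Lemma cabs2_ge0 (z : R[i]) : 0 <= cabs2 z.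
Proof. by rewrite addr_ge0 // sqr_ge0. Qed.

(** For [l = p + i q] with [p] nonzero, multiplication by [l] is the shear
    [(x, y) |-> (p x - q y, y)] followed by [(x, y) |-> (x, (p^2 + q^2) / p y + q / p x)]. *)
Lemma planar_cmulp_re (l : R[i]) : complex.Re l != 0 -> planar (cmulp l) (cabs2 l).
Proof.
case: l => p q /= p0.
have c0 : p != 0 -> (p ^+ 2 + q ^+ 2) / p != 0.
  move=> _; rewrite mulf_neq0 ?invr_eq0 // lt0r_neq0 //.
  by rewrite ltr_pwDl ?sqr_ge0 // exprn_even_gt0.
have m1 : measurable_fun setT (fun y : mR => - q * y : mR) by apply: measurable_funM.
have m2 : measurable_fun setT (fun y : mR => q / p * y : mR) by apply: measurable_funM.
have h1 := planar_shear1 p0 m1.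
have h2 := planar_shear2 (c0 p0) m2.
have := planar_comp h2 h1 (normr_ge0 _).
congr (planar _ _).
  by apply/funext => -[x y] /=; rewrite /cmulp /=; congr (_, _); field.
rewrite -normrM /cabs2 /= divfK // ger0_norm //.
by rewrite addr_ge0 // sqr_ge0.
Qed.

(** A purely imaginary [l = i q], for which the shears would divide by 0, is the product of [1 + i]
    and [q / 2 + i q / 2]. *)
Lemma planar_cmulp (l : R[i]) : l != 0 -> planar (cmulp l) (cabs2 l).
Proof.
have [|h l0] := eqVneq (complex.Re l) 0; last exact: planar_cmulp_re.
case: l => p q /= -> l0.
have q0 : q != 0 by apply: contraNneq l0 => ->.
have h1 := @planar_cmulp_re (1 +i* 1) (oner_neq0 _).
have q20 : q / 2 != 0 by rewrite mulf_neq0 // invr_eq0 pnatr_eq0.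
have h2 := @planar_cmulp_re (q / 2 +i* (q / 2)) q20.
have := planar_comp h1 h2 (cabs2_ge0 _).
congr (planar _ _).
  by apply/funext => -[x y] /=; rewrite /cmulp /=; congr (_, _); field.
by rewrite /cabs2 /=; field.
Qed.

End planar.

(** * Coordinatewise multiplication on [C^N] *)

Section dilation.
Variable R : realType.
Notation XN N := (g_sigma_algebraType (@cyl R N)).
Definition dmul N (l v : 'rV[R[i]]_N) : 'rV[R[i]]_N := \row_j (l 0 j * v 0 j).

Lemma cmeas_coord N (j : 'I_N) : cmeas (fun v : XN N => v 0 j).
Proof. by split; [exact: measurable_Rec|exact: measurable_Imc]. Qed.

Lemma measurable_dmul N (l : 'rV[R[i]]_N) : measurable_fun setT (dmul l : XN N -> XN N).
Proof.
apply: measurable_toX => j; rewrite (_ : (fun _ => _) = (fun v : XN N => l 0 j * v 0 j)).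
  by apply: cmeasM; [exact: cmeas_cst|exact: cmeas_coord].
by apply/funext => v; rewrite mxE.
Qed.

Lemma dmul_ccons N (l : 'rV[R[i]]_N.+1) (p : measurableTypeR R * measurableTypeR R) (v : 'rV[R[i]]_N) :
  dmul l (ccons (of_pair p) v) = ccons (of_pair (cmulp (l 0 ord0) p)) (dmul (\row_j l 0 (lift ord0 j)) v).
Proof.
apply/rowP => j; rewrite mxE; case: (unliftP ord0 j) => [k ->|->].
  by rewrite !cconsS !mxE.
by rewrite !ccons0 of_pair_cmulp.
Qed.

Lemma mu_dmul N (l : 'rV[R[i]]_N) : (forall j, l 0 j != 0) ->
  @scaled_push_hyp _ _ (XN N) (XN N) R (mu R N) (dmul l) (mu R N) (\prod_j cabs2 (l 0 j)).
Proof.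
elim: N l => [|N IH] l l0 f mf f0.
  rewrite big_ord0 mul1e; apply: eq_integral => v _; congr f.
  by apply/rowP => -[].
have mf' : measurable_fun setT (fun v : XN N.+1 => f (dmul l v)) := measurableT_comp mf (measurable_dmul l).
rewrite (int_muS mf f0) (int_muS mf') //.
set l' := \row_j l 0 (lift ord0 j) : 'rV_N.
have l'0 j : l' 0 j != 0 by rewrite mxE.
have mfc : measurable_fun setT (fun z => f (@cconsp R N z)) := measurableT_comp mf (@measurable_cconsp R N).
have md : measurable_fun setT (fun z : (measurableTypeR R * measurableTypeR R) * XN N => (z.1, dmul l' z.2 : XN N)).
  apply: measurable_fun_pair; first exact: measurable_fst.
  exact: (measurableT_comp (measurable_dmul l') measurable_snd).
have mfd := measurableT_comp mfc md.
pose h (p : measurableTypeR R * measurableTypeR R) := (\int[mu R N]_v f (ccons (of_pair p) (dmul l' v)))%E.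
have mh : measurable_fun setT h.
  exact: (@measurable_fun_fubini_tonelli_F _ _ _ _ _ (mu R N) _ mfd (fun z => f0 _)).
have h0 p : (0 <= h p)%E by exact: integral_ge0.
have J0 : 0 <= \prod_j cabs2 (l' 0 j) by apply: prodr_ge0 => j _; exact: cabs2_ge0.
transitivity (\int[lebCm R]_p ((\prod_j cabs2 (l' 0 j))%:E * h p))%E.
  apply: eq_integral => p _.
  by rewrite (IH l' l'0 (fun v => f (ccons (of_pair p) v))) //; exact: (measurableT_comp mfc (pair1_measurable p)).
transitivity ((\prod_j cabs2 (l' 0 j))%:E * \int[lebCm R]_p h p)%E.
  exact: (@ge0_integralZl_EFin _ _ _ (lebCm R) setT measurableT h (fun p _ => h0 p) mh _ J0).
have E := (planar_cmulp (l0 ord0)).2 h mh h0.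
transitivity ((\prod_j cabs2 (l' 0%R j))%:E * ((cabs2 (l 0%R ord0))%:E * \int[lebCm R]_x h (cmulp (l 0%R ord0) x)))%E.
  by congr (_ * _)%E.
rewrite muleA -EFinM; congr (_ * _)%E.
  rewrite big_ord_recl mulrC; congr (_ * _)%:E.
  by apply: eq_bigr => j _; rewrite mxE.
by apply: eq_integral => p _; apply: eq_integral => v _; rewrite dmul_ccons.
Qed.

End dilation.

(** * Measurability of open sets and of functions extended by zero *)

Section open_meas.
Variable R : realType.
Notation XN N := (g_sigma_algebraType (@cyl R N)).
Notation V N := ('rV[R[i]]_N : normedModType R[i]).

Lemma complex_gt0 (e : R[i]) : 0 < e -> exists2 d : R, 0 < d & e = d%:C.
Proof. by case: e => a b; rewrite ltcE /= => /andP[/eqP -> a0]; exists a. Qed.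

Lemma open_box N (D : set (V N)) (p : V N) : open D -> D p ->
  exists2 e : R, 0 < e & forall v : V N, (forall j, nC (p 0 j - v 0 j) < e) -> D v.
Proof.
rewrite openE => oD /oD /nbhs_ballP[e /= /complex_gt0[d d0 ->] H].
exists d => // v hv; apply: H; split; first by rewrite ltcR.
by move=> i j; rewrite ord1 /ball /= normC_normc ltcR.
Qed.

Definition cbox N (q : 'rV[rat * rat]_N) (k : nat) : set (XN N) :=
  [set v | forall j, cabs2 (v 0 j - (ratr (q 0 j).1 +i* ratr (q 0 j).2)) < k.+1%:R^-1 ^+ 2].

Lemma measurable_cbox N q k : measurable (@cbox N q k).
Proof.
rewrite (_ : cbox q k = \bigcap_(j in [set: 'I_N]) [set v : XN N | cabs2 (v 0 j - (ratr (q 0 j).1 +i* ratr (q 0 j).2)) < k.+1%:R^-1 ^+ 2]).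
  apply: fin_bigcap_measurable => [|j _]; first exact: finite_finset.
  have mf : measurable_fun setT (fun v : XN N => cabs2 (v 0 j + - (ratr (q 0 j).1 +i* ratr (q 0 j).2))).
    by apply: cmeas_cabs2; apply: cmeasD; [exact: cmeas_coord|exact: cmeas_cst].
  have := mf measurableT `]-oo, k.+1%:R^-1 ^+ 2[%classic (measurable_itv _).
  by rewrite setTI; congr measurable; apply/seteqP; split => v /=; rewrite in_itv.
by apply/seteqP; split => v /= H j; [move=> _|]; exact: H.
Qed.

Lemma nC_cabs2 (z : R[i]) (e : R) : 0 < e -> (cabs2 z < e ^+ 2) = (nC z < e).
Proof. move=> e0; case: z => a b; rewrite /cabs2 /=.
by rewrite -[X in _ = (_ < X)](ger0_norm (ltW e0)) -sqrtr_sqr ltr_sqrt // exprn_gt0. Qed.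

(** The sigma-algebra is generated by coordinates; an open set belongs to it as the union of the
    countably many polydiscs with rational centre and radius [1 / (k + 1)] that it contains. *)
Lemma open_measurableX N (D : set (V N)) : open D -> measurable (D : set (XN N)).
Proof.
move=> oD.
pose F (x : 'rV[rat * rat]_N * nat) := if `[< cbox x.1 x.2 `<=` D >] then cbox x.1 x.2 else set0.
rewrite (_ : D = \bigcup_x F x).
  apply: countable_bigcupT_measurable => [|x]; first exact: countableP.
  by rewrite /F; case: asboolP => _; [exact: measurable_cbox|exact: measurable0].
apply/seteqP; split; last by move=> v [x _]; rewrite /F; case: asboolP => // h; exact: h.
move=> p Dp; have [e e0 He] := open_box oD Dp.
have e20 : 0 < e / 2 by rewrite divr_gt0.
pose k := Num.truncn (e / 2)^-1.
have kp : 0 < (k.+1%:R : R) by rewrite ltr0n.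
have hk : k.+1%:R^-1 < e / 2.
  by rewrite -[X in _ < X]invrK ltf_pV2 ?posrE ?invr_gt0 // truncnS_gt.
have rat_near (x d : R) : 0 < d -> exists q : rat, `|x - ratr q| < d.
  move=> d0; have [q] := @rat_in_itvoo R (x - d) (x + d) ltac:(lra).
  by rewrite in_itv /= => /andP[? ?]; exists q; rewrite ltr_norml; apply/andP; split; lra.
have hk2 : 0 < (k.+1%:R^-1 : R) / 2 by rewrite divr_gt0 // invr_gt0.
have qP j : exists q : rat * rat, nC (p 0 j - (ratr q.1 +i* ratr q.2)) < k.+1%:R^-1.
  have [q1 h1] := rat_near (complex.Re (p 0 j)) _ hk2.
  have [q2 h2] := rat_near (complex.Im (p 0 j)) _ hk2.
  exists (q1, q2); move: h1 h2; case: (p 0 j) => a b /= h1 h2.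
  by apply: (le_lt_trans (normc_split _ _)); rewrite [X in _ < X]splitr; exact: ltrD.
pose q := \row_j sval (cid (qP j)).
have qE j : nC (p 0 j - (ratr (q 0 j).1 +i* ratr (q 0 j).2)) < k.+1%:R^-1.
  by rewrite mxE; case: (cid (qP j)).
exists (q, k) => //; rewrite /F /=; case: asboolP => [_|].
  by move=> j; rewrite nC_cabs2 ?invr_gt0 //; exact: qE.
case=> v hv; apply: He => j.
have -> : p 0 j - v 0 j = (p 0 j - (ratr (q 0 j).1 +i* ratr (q 0 j).2)) + - (v 0 j - (ratr (q 0 j).1 +i* ratr (q 0 j).2)).
  by rewrite opprB addrA subrK.
apply: (le_lt_trans (le_normcD _ _)); rewrite normcN.
have := hv j; rewrite nC_cabs2 ?invr_gt0 // => h; rewrite [X in _ < X]splitr.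
by apply: ltrD; [exact: lt_trans (qE j) hk|exact: lt_trans h hk].
Qed.

Definition zero_ext N (D : set 'rV[R[i]]_N) (f : 'rV[R[i]]_N -> R[i]) (v : 'rV[R[i]]_N) : R[i] := if `[< D v >] then f v else 0.

Lemma cmeas_zero_ext N (D : set (V N)) (f : V N -> R[i]^o) : open D ->
  (forall p, D p -> {for p, continuous f}) -> cmeas (zero_ext D f : XN N -> R[i]).
Proof.
move=> oD cf.
(* [P] stands for the real and the imaginary part. As [P 0 = 0], the set where [P] exceeds [a]
   contains the complement of [D] exactly when [a < 0], or [D] is everything. *)
have H (P : R[i] -> R) : (forall x y, `|P x - P y| <= nC (x - y)) -> P 0 = 0 ->
    measurable_fun setT (fun v : XN N => P (zero_ext D f v)).
  move=> PL P0.
  apply: (measurability _ (RGenOInfty.measurableE R)) => _ [_ [a ->] <-].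
  rewrite setTI.
  have oA : open ([set v | D v /\ a < P (f v)] : set (V N)).
    rewrite openE => v [Dv av].
    have := cf v Dv; move=> /cvgrPdist_lt /(_ (P (f v) - a)%:C).
    rewrite ltcR subr_gt0 => /(_ av) hb.
    have hD : nbhs v D by move: oD; rewrite openE => /(_ v Dv).
    apply: filterS2 hD hb => y Dy hy; split => //.
    move: hy; rewrite normC_normc ltcR => hy.
    have := PL (f v) (f y); move: hy; rewrite ler_norml; lra.
  have [a0|a0] := ltP a 0.
    rewrite (_ : _ @^-1` _ = [set v | D v /\ a < P (f v)] `|` ~` D).
      apply: measurableU; first exact: open_measurableX.
      exact: (measurableC (open_measurableX oD)).
    apply/seteqP; split => v /=; rewrite in_itv /= andbT /zero_ext; case: asboolP => Dv.
    - by left.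
    - by right.
    - by case=> [[]|].
    - by rewrite P0.
  rewrite (_ : _ @^-1` _ = [set v | D v /\ a < P (f v)]); first exact: open_measurableX.
  apply/seteqP; split => v /=; rewrite in_itv /= andbT /zero_ext; case: asboolP => Dv //.
  - by rewrite P0; move: a0; rewrite leNgt => /negP.
  - by case.
  - by case.
split; apply: H => //.
  by move=> x y; rewrite -[X in `|X|](raddfB (@complex.Re R : Rcomplex R -> R)) normc_Re.
by move=> x y; rewrite -[X in `|X|](raddfB (@complex.Im R : Rcomplex R -> R)) normc_Im.
Qed.

End open_meas.

(** * Splitting off the last coordinate *)

Section csnoc.
Variable R : realType.
Notation XN N := (g_sigma_algebraType (@cyl R N)).
Notation mRR := (measurableTypeR R * measurableTypeR R)%type.
Definition csnoc N (z : XN N * mRR) : XN (N + 1) := row_mx z.1 (\row_(_ < 1) of_pair z.2).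

Lemma cmeas_of_pair d (T : measurableType d) (g : T -> mRR) : measurable_fun setT g -> cmeas (fun t => of_pair (g t)).
Proof.
by move=> mg; split; [exact: (measurableT_comp measurable_fst mg)|exact: (measurableT_comp measurable_snd mg)].
Qed.

Lemma measurable_csnoc N : measurable_fun setT (@csnoc N).
Proof.
apply: measurable_toX => j; rewrite /csnoc -(splitK j); case: (fintype.split j) => k /=.
  rewrite (_ : (fun _ => _) = (fun v : XN N => v 0 k) \o fst).
    by apply: cmeas_comp; [exact: measurable_fst|exact: cmeas_coord].
  by apply/funext => z /=; rewrite row_mxEl.
rewrite (_ : (fun _ => _) = (fun z : XN N * mRR => of_pair z.2)).
  by apply: cmeas_of_pair; exact: measurable_snd.
by apply/funext => z /=; rewrite row_mxEr mxE.
Qed.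

Lemma ccons_csnoc N (p q : mRR) (v : XN N) :
  csnoc (ccons (of_pair p) v : XN N.+1, q) = ccons (of_pair p) (csnoc (v, q)) :> XN (N + 1).+1.
Proof.
apply/rowP => j; rewrite /csnoc /=; case: (unliftP ord0 j) => [k ->|->].
  rewrite cconsS !mxE.
  case: splitP => [a /= ak|a /= ak]; case: splitP => [b /= bk|b /= bk].
  - have -> : a = lift ord0 b by apply/val_inj; rewrite /= -bk -ak.
    by rewrite cconsS.
  - by have := ltn_ord a; rewrite -ak /bump leq0n add1n bk ltnS ltnNge leq_addr.
  - by have := ltn_ord b; rewrite -bk; move: ak; rewrite /bump leq0n add1n addSn => -[->]; rewrite ltnNge leq_addr.
  - by rewrite !mxE.
rewrite ccons0 mxE; case: splitP => [a /= a0|a /= a0]; last by move: a0; rewrite addSn.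
have -> : a = ord0 by apply/val_inj; exact/esym/a0.
by rewrite ccons0.
Qed.

(** [mu] grows by coordinates added on the left, while the variable [w] stands on the right; the
    induction moves it past the other coordinates. *)
Lemma mu_csnoc N : @scaled_push_hyp _ _ (XN N * mRR)%type (XN (N + 1)) R (prodm (mu R N) (lebCm R)) (@csnoc N) (mu R (N + 1)) 1.
Proof.
move=> f mf f0; rewrite mul1e.
have mfs : measurable_fun setT (fun z => f (@csnoc N z)) := measurableT_comp mf (@measurable_csnoc N).
rewrite [RHS](tonelli1 _ _ mfs) //.
elim: N f mf f0 mfs => [|N IH] f mf f0 mfs.
  rewrite [LHS](int_muS mf f0) /=.
  have E (g : XN 0 -> \bar R) : (\int[mu R 0]_v g v = g 0%R)%E.
    have mg : measurable_fun setT g.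
      move=> _ B mB; rewrite setTI; have [g0|g0] := pselect (B (g (0 : 'rV_0))).
        rewrite (_ : g @^-1` B = setT) //; apply/seteqP; split => // v _ /=.
        by rewrite (_ : v = (0 : 'rV_0)) //; apply/rowP => -[].
      rewrite (_ : g @^-1` B = set0) //; apply/seteqP; split => // v /=.
      by rewrite (_ : v = (0 : 'rV_0)) //; apply/rowP => -[].
    by rewrite /= integral_dirac // diracT mul1e.
  rewrite [RHS]E; apply: eq_integral => p _; rewrite [LHS]E; congr f.
  apply/rowP => j; rewrite /csnoc; have -> : j = ord0 by exact: ord1.
  rewrite ccons0 mxE; case: splitP => [[]//|k _]; by rewrite mxE.
have mfc : measurable_fun setT (fun z => f (@cconsp R (N + 1) z)) := measurableT_comp mf (@measurable_cconsp R (N + 1)).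
have mh : measurable_fun setT (fun v : XN N.+1 => \int[lebCm R]_q f (csnoc (v, q)))%E.
  exact: (@measurable_fun_fubini_tonelli_F _ _ _ _ _ (lebCm R) _ mfs (fun z => f0 _)).
rewrite [LHS](int_muS mf f0) [RHS](int_muS mh); last by move=> v; exact: integral_ge0.
apply: eq_integral => p _.
have mfp : measurable_fun setT (fun x : XN (N + 1) => f (ccons (of_pair p) x)) := measurableT_comp mfc (pair1_measurable p).
have mfps := measurableT_comp mfp (@measurable_csnoc N).
rewrite (IH _ mfp (fun x => f0 _) mfps).
by apply: eq_integral => v _; apply: eq_integral => q _ /=; rewrite ccons_csnoc.
Qed.

End csnoc.

(** * Radial integrals and averages over the circle *)

Section radial.
Variable R : realType.
Notation mR := (measurableTypeR R).
Notation mRR := (measurableTypeR R * measurableTypeR R)%type.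
Notation leb := (@lebesgue_measure R).
Definition sqrad (p : mRR) : mR := cabs2 (of_pair p).

Lemma measurable_sqrad : measurable_fun setT sqrad.
Proof. by apply: cmeas_cabs2; apply: cmeas_of_pair; exact: measurable_id. Qed.

Definition radM : {measure set mR -> \bar R} := measure_function_pushforward__canonical__measure_function_Measure (lebCm R) measurable_sqrad.
(** Area of the disc of squared radius [r], that is, the distribution function of [sqrad]. *)
Definition disc (r : R) : \bar R := radM `]-oo, r].

Lemma disc_scale (r : R) : 0 < r -> disc r = (r%:E * disc 1)%E.
Proof.
move=> r0; have sr0 : 0 < Num.sqrt r by rewrite sqrtr_gt0.
have E (x : R) : disc x = (\int[lebCm R]_p (\1_(sqrad @^-1` `]-oo, x]) p)%:E)%E.
  rewrite integral_indic ?setIT //; rewrite -[X in measurable X]setTI; exact: measurable_sqrad.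
have l0 : (Num.sqrt r)%:C != 0 :> R[i] by apply/eqP => -[] h; rewrite h ltxx in sr0.
rewrite !E; have [_ H] := planar_cmulp l0.
rewrite H //; last first.
  apply/measurable_EFinP; apply: measurable_indic; rewrite -[X in measurable X]setTI; exact: measurable_sqrad.
congr (_%:E * _)%E.
  by rewrite /cabs2 /= expr0n addr0 sqr_sqrtr // ltW.
apply: eq_integral => p _; congr (_%:E); rewrite !indicE; congr (_%:R); congr nat_of_bool.
apply/idP/idP; rewrite !inE /= /sqrad of_pair_cmulp cabs2M !in_itv /= /cabs2 /= expr0n addr0 sqr_sqrtr ?(ltW r0) //.
  by rewrite -[X in _ <= X]mulr1 ler_pM2l.
by rewrite -[X in _ -> _ <= X]mulr1 ler_pM2l.
Qed.

Lemma disc_lt0 (r : R) : r < 0 -> disc r = 0%E.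
Proof.
move=> r0; rewrite /disc /radM /= /pushforward (_ : _ @^-1` _ = set0) ?measure0 //.
apply/seteqP; split => // p /=; rewrite in_itv /= => h.
by have := le_lt_trans h r0; rewrite ltNge cabs2_ge0.
Qed.

Lemma disc1_fin : (disc 1 < +oo)%E.
Proof.
apply: (@le_lt_trans _ _ (lebCm R (`[-1, 1]%classic `*` `[-1, 1]%classic))).
  rewrite /disc /radM /= /pushforward; apply: (le_measure (lebCm R)); rewrite ?inE.
  - rewrite -[X in measurable X]setTI; exact: measurable_sqrad.
  - exact: measurableX.
  - move=> -[x y] /=; rewrite in_itv /= /sqrad /cabs2 /= !in_itv /= => h.
    have hx : x ^+ 2 <= 1 by apply: le_trans h; rewrite lerDl sqr_ge0.
    have hy : y ^+ 2 <= 1 by apply: le_trans h; rewrite lerDr sqr_ge0.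
    by rewrite -!ler_norml; split; rewrite -sqrtr_sqr -[X in _ <= X]sqrtr1 ler_wsqrtr.
have -> : lebCm R (`[-1, 1]%classic `*` `[-1, 1]%classic) = (leb `[(-1)%R, 1%R]%classic * leb `[(-1)%R, 1%R]%classic)%E.
  exact: (@product_measure1E _ _ _ _ R leb leb _ _ (measurable_itv _) (measurable_itv _)).
rewrite lebesgue_measure_itv /= lte_fin.
by case: ifP => _; rewrite ?mul0e // -EFinB -EFinM ltry.
Qed.

Definition disc_area : R := fine (disc 1).

Lemma disc_ge0 r : (0 <= disc r)%E. Proof. exact: measure_ge0. Qed.

Lemma disc_area_ge0 : 0 <= disc_area. Proof. exact/fine_ge0/disc_ge0. Qed.

Lemma disc1E : disc 1 = disc_area%:E.
Proof. by rewrite fineK // ge0_fin_numE ?disc1_fin // disc_ge0. Qed.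

Lemma discE r : 0 <= r -> disc r = (r * disc_area)%:E.
Proof.
rewrite le_eqVlt => /predU1P[<-|r0]; last by rewrite disc_scale // disc1E.
rewrite mul0r; apply/eqP; rewrite eq_le disc_ge0 andbT.
apply/lee_addgt0Pr => e e0; rewrite add0e.
have d0 : 0 < disc_area + 1 by rewrite ltr_wpDl // disc_area_ge0.
apply: (@le_trans _ _ (disc (e / (disc_area + 1)))).
  apply: (le_measure radM); rewrite ?inE //=.
  apply: subset_itvl; rewrite bnd_simp; apply: divr_ge0 (ltW e0) (ltW d0).
rewrite disc_scale ?divr_gt0 // disc1E -EFinM lee_fin mulrAC ler_pdivrMr // ler_wpM2l ?(ltW e0) //.
by rewrite lerDl.
Qed.

Definition nngD : {nonneg R} := NngNum disc_area_ge0.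
Definition halfM : {measure set mR -> \bar R} := mscale nngD (mrestr leb (measurable_itv (Interval (BLeft (0 : R)) +oo%O))).

Lemma halfME A : halfM A = (disc_area%:E * leb (A `&` `[0%R, +oo[))%E.
Proof. by []. Qed.

Lemma radM_itv (a b : R) : a < b -> radM `]a, b]%classic = halfM `]a, b]%classic.
Proof.
move=> ab; rewrite halfME.
have dis : disc b = (radM `]a, b]%classic + disc a)%E.
  rewrite addeC /disc -measureU //.
    apply: (congr1 radM); apply/seteqP; split => x /=; rewrite !in_itv /=.
      by case: (leP x a) => h; [left|right].
    by case=> [h|/andP[]//]; exact: le_trans h (ltW ab).
  apply/seteqP; split => // x /= []; rewrite !in_itv /= => h /andP[h' _].
  by have := lt_le_trans h' h; rewrite ltxx.
have [a0|a0] := ltP a 0.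
  move: dis; rewrite (disc_lt0 a0) adde0 => <-.
  have [b0|b0] := ltP b 0.
    rewrite disc_lt0 // (_ : _ `&` _ = set0) ?measure0 ?mule0 //.
    apply/seteqP; split => // x /= []; rewrite !in_itv /= andbT => /andP[_ h] h'.
    by have := le_trans h' h; rewrite leNgt b0.
  rewrite discE // (_ : _ `&` _ = `[0, b]%classic); last first.
    apply/seteqP; split => x /=; rewrite !in_itv /= andbT; first by case=> /andP[_ ->] ->.
    by move=> /andP[x0 ->]; rewrite (lt_le_trans a0 x0).
  rewrite lebesgue_measure_itv /= lte_fin; case: ltP => h; first by rewrite -EFinB -EFinM subr0 mulrC.
  have b00 : b = 0 by apply/eqP; rewrite eq_le h b0.
  by rewrite b00 mul0r mule0.
move: dis; rewrite !discE //; last lra.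
rewrite (_ : _ `&` _ = `]a, b]%classic); last first.
  apply/seteqP; split => x /=; rewrite !in_itv /= andbT; first by case.
  by move=> /andP[xa ->]; rewrite xa; split => //; lra.
rewrite lebesgue_measure_itv /= lte_fin ab -EFinB -EFinM.
case: (radM _) => [r||] //.
by rewrite -EFinD => -[h]; congr EFin; rewrite mulrBr; lra.
Qed.

(** Polar coordinates in the squared radius, which has constant density on the half-line: the two
    measures agree on half-open intervals because [disc] is linear there. *)
Lemma radME A : measurable A -> radM A = halfM A.
Proof.
move=> mA; refine (@measure_unique _ R mR (@ocitv R) (fun k => `](- k%:R)%R, k%:R]%classic) _ _ _ _ radM halfM _ _ A mA).
- by [].
- exact: ocitvI.
- by move=> k; exact: is_ocitv.
- apply/seteqP; split => // x _; exists (Num.truncn `|x|).+1 => //=.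
  have := truncnS_gt `|x|; rewrite ltr_norml => /andP[h1 h2].
  by rewrite in_itv /= h1 ltW.
- move=> _ /ocitvP[->|[[a b] /= ab ->]]; first by rewrite !measure0.
  exact: radM_itv.
- move=> k; apply: (@le_lt_trans _ _ (disc k%:R)); last by rewrite discE // ltry.
  by apply: (le_measure radM); rewrite ?inE //; apply: subset_itvr.
Qed.

Lemma integral_rad0 (f : mR -> \bar R) : measurable_fun setT f -> (forall x, 0 <= f x)%E ->
  (\int[lebCm R]_p f (sqrad p) = disc_area%:E * \int[leb]_(x in `[0%R, +oo[) f x)%E.
Proof.
move=> mf f0; have mf' : @measurable_fun _ _ mR _ `[0%R, +oo[ f by exact: measurable_funTS.
have := @ge0_integral_pushforward _ _ _ mR R sqrad measurable_sqrad (lebCm R) `[0%R, +oo[%classic f (measurable_itv _) mf' (fun y _ => f0 y).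
have -> : sqrad @^-1` `[0%R, +oo[%classic = setT.
  by apply/seteqP; split => // p _ /=; rewrite in_itv /= andbT cabs2_ge0.
move=> <-.
have := @eq_measure_integral _ mR R `[0%R, +oo[%classic (mscale nngD leb) radM f.
move=> ->; first by rewrite ge0_integral_mscale.
move=> A mA AD; rewrite radME // /halfM /mscale /= /mrestr; congr (_ * leb _)%E.
exact/setIidPl.
Qed.

(* The Gaussian, integrated both radially and by Fubini. *)
Lemma disc_area_pi : disc_area = pi.
Proof.
have mg : measurable_fun setT (fun x : mR => (expR (- x))%:E).
  apply/measurable_EFinP; apply: (measurableT_comp (@measurable_expR R)).
  exact: oppr_measurable.
have := integral_rad0 mg (fun x => expR_ge0 _).
have -> : (\int[leb]_(x in `[0%R, +oo[) (expR (- x))%:E = 1)%E.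
  have := @integral_exponential_pdf R 1 ltr01 => <-.
  rewrite integral_mkcond; apply: eq_integral => x _.
  rewrite /exponential_pdf !patchE; case: ifP => // _.
  by rewrite mul1r mulN1r.
rewrite mule1 => E.
have : (\int[lebCm R]_p (expR (- sqrad p))%:E = pi%:E)%E.
  have mg' := measurableT_comp mg measurable_sqrad.
  rewrite [LHS](tonelli1 _ _ mg'); last first.
    by move=> z; rewrite lee_fin expR_ge0.
  have I := @integralT_gauss R.
  transitivity (\int[leb]_x ((gauss_fun x)%:E * (Num.sqrt pi)%:E))%E.
    apply: eq_integral => x _; rewrite -I -ge0_integralZl_EFin //.
    - by apply: eq_integral => y _; rewrite -EFinM /= /sqrad /cabs2 /= /gauss_fun -expRD opprD.
    - by move=> y _; rewrite lee_fin gauss_fun_ge0.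
    - by apply/measurable_EFinP; exact: measurable_gauss_fun.
    - exact: gauss_fun_ge0.
  rewrite ge0_integralZr //.
  - by rewrite I -EFinM -expr2 sqr_sqrtr // pi_ge0.
  - by apply/measurable_EFinP; exact: measurable_gauss_fun.
  - by move=> y _; rewrite lee_fin gauss_fun_ge0.
by rewrite E => -[].
Qed.

Lemma Rintegral_sqrad (f : mR -> R) : measurable_fun setT f ->
  (\int[lebCm R]_p f (sqrad p) = pi * \int[leb]_(x in `[0%R, +oo[) f x)%R.
Proof.
move=> mf; have mf' : measurable_fun setT (fun y => (f y)%:E) by exact/measurable_EFinP.
have h1 := integral_rad0 (measurable_funepos mf') (fun x => funepos_ge0 _ x).
have h2 := integral_rad0 (measurable_funeneg mf') (fun x => funeneg_ge0 _ x).
rewrite /Rintegral [in LHS]integralE [in RHS]integralE -disc_area_pi -fine_scaleB; last by rewrite disc_area_pi pi_gt0.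
by rewrite -h1 -h2; congr (fine (_ - _)); apply: eq_integral => x _; rewrite ?funeposE ?funenegE.
Qed.

End radial.

(** * Averages over the unit circle *)

Section circle.
Variable R : realType.
Notation mR := (measurableTypeR R).
Notation leb := (@lebesgue_measure R).
Definition unif01 : {sigma_finite_measure set mR -> \bar R} := uniform_prob (@ltr01 R).

Lemma integral_unif01 (f : mR -> \bar R) : measurable_fun setT f -> (forall x, 0 <= f x)%E ->
  (\int[unif01]_x f x = \int[leb]_(x in `[0%R, 1%R]) f x)%E.
Proof. by move=> mf f0; rewrite /unif01 /= integral_uniform // subr0 invr1 mul1e. Qed.

Lemma Rintegral_unif01 (f : mR -> R) : measurable_fun setT f -> (\int[unif01]_x f x)%R = iseg f 0 1.
Proof.
move=> mf; rewrite /iseg /Rintegral [in LHS]integralE [in RHS]integralE.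
have mf' : measurable_fun setT (fun y => (f y)%:E) by exact/measurable_EFinP.
rewrite (integral_unif01 (measurable_funepos mf')); last by move=> x; exact: funepos_ge0.
by rewrite (integral_unif01 (measurable_funeneg mf')) // => x; exact: funeneg_ge0.
Qed.

Lemma unif01_integrable (f : mR -> R) : continuous (f : R -> R) -> unif01.-integrable setT (EFin \o f).
Proof.
move=> cf; have mf := continuous_measurable_fun cf.
have mf' : measurable_fun setT (EFin \o f) by exact/measurable_EFinP.
apply/integrableP; split => //.
have cs : cseg f 0 1 by move=> x _; exact: cf.
have /integrableP[_] := cseg_int cs.
by rewrite integral_unif01 //; exact: measurableT_comp.
Qed.

Lemma unif01_setT : unif01 setT = 1%E.
Proof. exact: probability_setT. Qed.

Definition circle_pt (t : R) : R[i] := cexp ((2 * pi)%:C * (0 +i* t)).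

Lemma circle_ptE t : circle_pt t = cos (2 * pi * t) +i* sin (2 * pi * t).
Proof. by rewrite /circle_pt /cexp /= !mulr0 mul0r subr0 expR0 addr0 mul1r. Qed.

Lemma normc_circle_pt t : nC (circle_pt t) = 1.
Proof. by rewrite circle_ptE /= cos2Dsin2 sqrtr1. Qed.

Lemma circle_ptN t : circle_pt (- t) = (circle_pt t)^*.
Proof. by rewrite !circle_ptE mulrN cosN sinN. Qed.

Lemma cmeas_circle_pt : cmeas (circle_pt : mR -> R[i]).
Proof.
have cm : continuous (fun t : R => 2 * pi * t : R) by move=> t; exact: mulrl_continuous.
rewrite (_ : (circle_pt : mR -> _) = (fun t => cos (2 * pi * t) +i* sin (2 * pi * t))); last exact/funext/circle_ptE.
split => /=; apply: continuous_measurable_fun => t.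
  by apply: continuous_comp; [exact: cm|exact: continuous_cos].
by apply: continuous_comp; [exact: cm|exact: continuous_sin].
Qed.

Section cMVP.
Variable q : R[i]^o -> R[i]^o.
Hypothesis dq : forall z : R[i]^o, nC z <= 1 -> differentiable q z.
(** The imaginary part of [q] is the real part of [- i q], so the real mean value property gives the
    complex one. *)
Let diq (z : R[i]^o) : nC z <= 1 -> differentiable (fun z : R[i]^o => - 'i * q z : R[i]^o) z.
Proof. by move=> h; apply: differentiableZ; exact: dq. Qed.

Let ReNi (z : R[i]) : complex.Re (- 'i * z) = complex.Im z.
Proof. by case: z => a b /=; ring. Qed.

Lemma continuous_circle_pt (q' : R[i]^o -> R[i]^o) : (forall z : R[i]^o, nC z <= 1 -> differentiable q' z) ->
  continuous (fun t : R => complex.Re (q' (circle_pt t)) : R).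
Proof.
move=> h t; have := CR_of_differentiable (differentiable_MVP_Q h t (lexx 0)).
by move=> /CR_continuous[].
Qed.

Lemma cMVP : cintegrable unif01 (fun t => q (circle_pt t)) /\ cint unif01 (fun t => q (circle_pt t)) = q 0.
Proof.
have c1' := continuous_circle_pt dq; have c2' := continuous_circle_pt diq.
have c3 : continuous (fun t : R => complex.Im (q (circle_pt t)) : R).
  by rewrite (_ : (fun t => _) = (fun t => complex.Re (- 'i * q (circle_pt t)))) //; apply/funext => x; rewrite ReNi.
split; first by split; exact: unif01_integrable.
rewrite /cint; have -> : q 0 = complex.Re (q 0) +i* complex.Im (q 0) by case: (q 0).
congr (_ +i* _).
  by rewrite Rintegral_unif01; [exact: MVP_pos|exact: continuous_measurable_fun].
rewrite Rintegral_unif01; last exact: continuous_measurable_fun.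
have := MVP_pos diq; rewrite ReNi => <-; congr iseg; apply/funext => t.
by rewrite ReNi.
Qed.

Lemma cMVPN : cintegrable unif01 (fun t => q (circle_pt t)^*) /\ cint unif01 (fun t => q (circle_pt t)^*) = q 0.
Proof.
have co : continuous (fun t : R => - t : R) by move=> t; exact: opp_continuous.
have c1' : continuous (fun t : R => complex.Re (q (circle_pt (- t))) : R).
  by move=> t; apply: (@continuous_comp _ _ _ _ (fun t => complex.Re (q (circle_pt t)))); [exact: co|exact: continuous_circle_pt].
have c2' : continuous (fun t : R => complex.Re (- 'i * q (circle_pt (- t))) : R).
  by move=> t; apply: (@continuous_comp _ _ _ _ (fun t => complex.Re (- 'i * q (circle_pt t)))); [exact: co|exact: (continuous_circle_pt diq)].
have c3 : continuous (fun t : R => complex.Im (q (circle_pt (- t))) : R).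
  by rewrite (_ : (fun t => _) = (fun t => complex.Re (- 'i * q (circle_pt (- t))))) //; apply/funext => x; rewrite ReNi.
rewrite (_ : (fun t => q (circle_pt t)^*) = (fun t => q (circle_pt (- t)))); last first.
  by apply/funext => t; rewrite circle_ptN.
split; first by split; exact: unif01_integrable.
rewrite /cint; have -> : q 0 = complex.Re (q 0) +i* complex.Im (q 0) by case: (q 0).
congr (_ +i* _).
  by rewrite Rintegral_unif01; [exact: MVP_neg|exact: continuous_measurable_fun].
rewrite Rintegral_unif01; last exact: continuous_measurable_fun.
have := MVP_neg diq; rewrite ReNi => <-; congr iseg; apply/funext => t.
by rewrite ReNi.
Qed.

End cMVP.

(** Jensen's inequality for the square: with [c] the mean, [2 Re (conj(c) q) - |c|^2 <= |q|^2] holds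
    pointwise, and its left-hand side integrates to [|c|^2]. *)
Lemma cabs2_cint (q : mR -> R[i]) : cintegrable unif01 q ->
  ((cabs2 (cint unif01 q))%:E <= \int[unif01]_t (cabs2 (q t))%:E)%E.
Proof.
move=> Iq; have mq := cintegrable_meas Iq.
set c := cint unif01 q.
have m1 : measurable_fun setT (fun t => (cabs2 (q t))%:E) by apply/measurable_EFinP; exact: cmeas_cabs2.
have Ic := cintegrableZ (c^* ) Iq.
have E : cint unif01 (fun t => c^* * q t) = (cabs2 c)%:C.
  by rewrite cintZ // -/c; case: (c) => a b; rewrite /cabs2; simpc => /=; apply/eqP; rewrite eq_complex /=; apply/andP; split; apply/eqP; ring.
have [->|fin] := eqVneq (\int[unif01]_t (cabs2 (q t))%:E)%E +oo%E; first exact: leey.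
have I2 : unif01.-integrable setT (fun t => (cabs2 (q t))%:E).
  apply/integrableP; split => //.
  under eq_integral do rewrite gee0_abs ?lee_fin ?cabs2_ge0 //.
  by rewrite ltey.
have : (\int[unif01]_t (2 * complex.Re (c^* * q t) - cabs2 c)%:E <= \int[unif01]_t (cabs2 (q t))%:E)%E.
  apply: le_integral => //.
    have h1 := integrableZl measurableT 2 Ic.1.
    have h2 : unif01.-integrable setT (fun _ : mR => (cabs2 c)%:E).
      exact: (finite_measure_integrable_cst (uniform_prob (@ltr01 R))).
    have := integrableB measurableT h1 h2; apply: eq_integrableT => t.
    by rewrite /= EFinB EFinM.
  move=> t _; rewrite lee_fin; case: (c) (q t) => a b [x y]; rewrite /cabs2; simpc => /=.
  have := sqr_ge0 (x - a); have := sqr_ge0 (y - b); rewrite !sqrrB; lra.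
have h1 := integrableZl measurableT 2 Ic.1.
have h2 : unif01.-integrable setT (fun _ : mR => (cabs2 c)%:E).
  exact: (finite_measure_integrable_cst (uniform_prob (@ltr01 R))).
have -> : (\int[unif01]_t (2 * complex.Re (c^* * q t) - cabs2 c)%:E = (cabs2 c)%:E)%E; last by [].
have E2 : (\int[unif01]_t (complex.Re (c^* * q t))%:E = (cabs2 c)%:E)%E.
  rewrite -[LHS]fineK; last exact: integrable_fin_num Ic.1.
  by congr EFin; exact: (congr1 (@complex.Re R) E).
transitivity (\int[unif01]_t (2%:E * (complex.Re (c^* * q t))%:E - (cabs2 c)%:E))%E.
  by apply: eq_integral => t _; rewrite EFinB EFinM.
rewrite integralB // integralZl ?E2; [|exact: measurableT|exact: Ic.1].
have -> : (\int[unif01]__ (cabs2 c)%:E = (cabs2 c)%:E)%E.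
  by rewrite integral_cst // -[RHS]mule1; congr (_ * _)%E; exact: unif01_setT.
by rewrite -EFinM -EFinB; congr EFin; ring.
Qed.

End circle.

(** * Multiplication by points of the polydisc *)

Section diffrow.
Variable R : realType.
Notation V N := ('rV[R[i]]_N : normedModType R[i]).

Lemma differentiable_row (U : normedModType R[i]) N (c : U -> V N) (x : U) :
  (forall j, differentiable (fun u => c u 0 j : R[i]^o) x) -> differentiable c x.
Proof.
move=> H; have -> : c = \sum_(j < N) (fun u => (c u 0 j : R[i]^o) *: (delta_mx 0 j : V N)).
  apply/funext => u; apply/rowP => k; rewrite fct_sumE summxE (bigD1 k) //= big1 ?addr0.
    by rewrite !mxE !eqxx mulr1.
  by move=> j jk; rewrite !mxE eq_sym (negbTE jk) andbF mulr0.
by apply: differentiable_sum => j; apply: differentiableZl.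
Qed.

Lemma differentiable_coordC N (j : 'I_N) (x : V N) : differentiable (fun v : V N => v 0 j : R[i]^o) x.
Proof. exact: differentiable_coord. Qed.

Lemma differentiable_mulC (U : normedModType R[i]) (f g : U -> R[i]^o) x :
  differentiable f x -> differentiable g x -> differentiable (fun u => f u * g u : R[i]^o) x.
Proof. exact: differentiableM. Qed.

Lemma differentiable_addC (U : normedModType R[i]) (f g : U -> R[i]^o) x :
  differentiable f x -> differentiable g x -> differentiable (fun u => f u + g u : R[i]^o) x.
Proof. exact: differentiableD. Qed.

Lemma differentiable_invC (U : normedModType R[i]) (f : U -> R[i]^o) x :
  differentiable f x -> f x != 0 -> differentiable (fun u => (f u)^-1 : R[i]^o) x.
Proof. by move=> df f0; exact: differentiableV. Qed.

Lemma differentiable_compC (U W : normedModType R[i]) (f : U -> W) (g : W -> R[i]^o) x :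
  differentiable f x -> differentiable g (f x) -> differentiable (fun u => g (f u)) x.
Proof. by move=> df dg; exact: (differentiable_comp df dg). Qed.

Lemma differentiable_cstC (U : normedModType R[i]) (c : R[i]) (x : U) : differentiable (fun _ : U => c : R[i]^o) x.
Proof. exact: differentiable_cst. Qed.

End diffrow.

Definition holo (R : realType) N (D : set ('rV[R[i]]_N : normedModType R[i])) (f : ('rV[R[i]]_N : normedModType R[i]) -> R[i]^o) :=
  forall p, D p -> differentiable f p.

Section star.
Variables (R : realType) (n m : nat).
Notation V N := ('rV[R[i]]_N : normedModType R[i]).
Notation XN N := (g_sigma_algebraType (@cyl R N)).
Notation mR := (measurableTypeR R).
Definition mult (l : 'rV[R[i]]_n) : 'rV[R[i]]_(n + m) := row_mx l (const_mx 1).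
Definition act (l : 'rV[R[i]]_n) (v : 'rV[R[i]]_(n + m)) : 'rV[R[i]]_(n + m) := dmul (mult l) v.

Lemma mult_l l a : mult l 0 (lshift m a) = l 0 a. Proof. exact: row_mxEl. Qed.

Lemma mult_r l a : mult l 0 (rshift n a) = 1. Proof. by rewrite /mult row_mxEr mxE. Qed.

Lemma actE l v j : act l v 0 j = mult l 0 j * v 0 j. Proof. by rewrite /act /dmul mxE. Qed.

Lemma ord_splitP (P : 'I_(n + m) -> Prop) : (forall a, P (lshift m a)) -> (forall b, P (rshift n b)) -> forall j, P j.
Proof. by move=> hl hr j; rewrite -(splitK j); case: (fintype.split j) => a /=. Qed.

Lemma actA (k l : 'rV[R[i]]_n) v : act k (act l v) = act (\row_j (k 0 j * l 0 j)) v.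
Proof.
apply/rowP; apply: ord_splitP => a; rewrite !actE ?mult_l ?mult_r; last by rewrite !mul1r.
by rewrite mxE mulrA.
Qed.

Lemma act1 (l : 'rV[R[i]]_n) v : (forall j, l 0 j = 1) -> act l v = v.
Proof. by move=> l1; apply/rowP; apply: ord_splitP => a; rewrite actE ?mult_l ?mult_r ?l1 mul1r. Qed.

Lemma act_row (l z : 'rV[R[i]]_n) (z' : 'rV[R[i]]_m) : act l (row_mx z z') = row_mx (\row_j (l 0 j * z 0 j)) z'.
Proof.
apply/rowP; apply: ord_splitP => a; rewrite actE ?mult_l ?mult_r ?row_mxEl ?row_mxEr; last by rewrite mul1r.
by rewrite mxE.
Qed.

Lemma differentiable_act (U : normedModType R[i]) (l : U -> 'rV[R[i]]_n) (v : U -> V (n + m)) x :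
  (forall j, differentiable (fun u => l u 0 j : R[i]^o) x) -> differentiable v x ->
  differentiable (fun u => act (l u) (v u) : V (n + m)) x.
Proof.
move=> dl dv; apply: differentiable_row => j.
have dvj : differentiable (fun u => v u 0 j : R[i]^o) x.
  exact: (differentiable_compC dv (differentiable_coordC j _)).
rewrite /act (_ : (fun u => _) = (fun u => mult (l u) 0 j * v u 0 j : R[i]^o)); last first.
  by apply/funext => u; rewrite mxE.
apply: differentiable_mulC => //; move: j {dvj}; apply: ord_splitP => a.
  by under eq_fun do rewrite mult_l.
by under eq_fun do rewrite mult_r; exact: differentiable_cstC.
Qed.

Implicit Types (l k : 'rV[R[i]]_n) (v : 'rV[R[i]]_(n + m)).
Definition polydisc (l : 'rV[R[i]]_n) := forall j, nC (l 0 j) <= 1.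
Definition torus (l : 'rV[R[i]]_n) := forall j, nC (l 0 j) = 1.
Definition conj_row (l : 'rV[R[i]]_n) : 'rV[R[i]]_n := \row_j (l 0 j)^*.

Lemma cabs2_normc (z : R[i]) : cabs2 z = nC z ^+ 2.
Proof. by case: z => a b; rewrite /= sqr_sqrtr // addr_ge0 // sqr_ge0. Qed.

Lemma normc_conj (z : R[i]) : nC z^* = nC z.
Proof. by case: z => a b; rewrite /= sqrrN. Qed.

Lemma mulJ_cabs2 (z : R[i]) : z^* * z = (cabs2 z)%:C.
Proof. by case: z => a b; apply/eqP; rewrite eq_complex /cabs2 /=; apply/andP; split; apply/eqP; ring. Qed.

Lemma torus_polydisc l : torus l -> polydisc l.
Proof. by move=> h j; rewrite h. Qed.

Lemma polydisc_conj l : polydisc l -> polydisc (conj_row l).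
Proof. by move=> h j; rewrite mxE normc_conj. Qed.

Lemma mult_neq0 l : (forall j, l 0 j != 0) -> forall j, mult l 0 j != 0.
Proof.
by move=> l0; apply: ord_splitP => a; rewrite ?mult_l ?mult_r ?oner_neq0.
Qed.

Lemma prod_mult l : \prod_j cabs2 (mult l 0 j) = \prod_j cabs2 (l 0 j).
Proof.
rewrite big_split_ord /=.
rewrite [X in _ * X]big1 ?mulr1; last by move=> j _; rewrite mult_r cabs2_normc Normc.normc1 expr1n.
by apply: eq_bigr => j _; rewrite mult_l.
Qed.

Lemma mu_act l : (forall j, l 0 j != 0) ->
  @scaled_push_hyp _ _ (XN (n + m)) (XN (n + m)) R (mu R (n + m)) (act l) (mu R (n + m)) (\prod_j cabs2 (l 0 j)).
Proof. by move=> l0; rewrite -prod_mult; apply: mu_dmul; exact: mult_neq0. Qed.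

Lemma normc_neq0 (z : R[i]) : nC z = 1 -> z != 0.
Proof. by move=> h; apply/eqP => z0; move: h; rewrite z0 Normc.normc0 => /eqP; rewrite eq_sym oner_eq0. Qed.

Lemma mu_torus l : torus l ->
  @scaled_push_hyp _ _ (XN (n + m)) (XN (n + m)) R (mu R (n + m)) (act l) (mu R (n + m)) 1.
Proof.
move=> ul; rewrite [X in scaled_push_hyp _ _ _ X](_ : 1 = \prod_j cabs2 (l 0 j)).
  by apply: mu_act => j; exact: normc_neq0.
by rewrite big1 // => j _; rewrite cabs2_normc ul expr1n.
Qed.

Lemma measurable_act l : measurable_fun setT (act l : XN (n + m) -> XN (n + m)).
Proof. exact: measurable_dmul. Qed.

(* The disc automorphism taking [0] to [a]; constant when [a] is already on the
   circle.  As [s] runs over the unit disc, [mobius_row l s] runs over an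
   analytic disc in the polydisc, with centre [l] and boundary in the torus. *)
Definition mobius (a s : R[i]) : R[i] := if nC a < 1 then (s + a) / (1 + a^* * s) else a.
Definition mobius_row (l : 'rV[R[i]]_n) (s : R[i]) : 'rV[R[i]]_n := \row_j mobius (l 0 j) s.

Lemma mobius_den (a s : R[i]) : nC a < 1 -> nC s <= 1 -> 1 + a^* * s != 0.
Proof.
move=> ha hs; rewrite addrC addr_eq0; apply/eqP => h.
have : nC (a^* * s) = 1 by rewrite h normcN Normc.normc1.
rewrite Normc.normcM normc_conj => h1.
have : nC a * nC s <= nC a by rewrite ler_piMr // normc_ge0.
by rewrite h1 leNgt ha.
Qed.

Lemma mobius0 a : mobius a 0 = a.
Proof. by rewrite /mobius; case: ifP => // _; rewrite add0r mulr0 addr0 divr1. Qed.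

Lemma mobius_row0 l : mobius_row l 0 = l.
Proof. by apply/rowP => j; rewrite mxE mobius0. Qed.

Lemma mobius_conj a s : mobius a^* s^* = (mobius a s)^*.
Proof.
rewrite /mobius normc_conj; case: ifP => // _.
rewrite [RHS]rmorphM /= conjc_inv rmorphD [in RHS]rmorphD rmorphM rmorph1.
by [].
Qed.

Lemma mobius_row_conj l s : mobius_row (conj_row l) s^* = conj_row (mobius_row l s).
Proof. by apply/rowP => j; rewrite !mxE mobius_conj. Qed.

Lemma differentiable_mobius a (s : R[i]^o) : nC s <= 1 -> differentiable (mobius a : R[i]^o -> R[i]^o) s.
Proof.
move=> hs; rewrite /mobius; have [ha|_] := boolP (nC a < 1); last exact: differentiable_cstC.
have d2 : differentiable (fun s : R[i]^o => (1 + a^* * s) : R[i]^o) s.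
  by apply: differentiable_addC; [exact: differentiable_cstC|apply: differentiable_mulC => //; exact: differentiable_cstC].
apply: differentiable_mulC; first by apply: differentiable_addC => //; exact: differentiable_cstC.
by apply: differentiable_invC => //; exact: mobius_den.
Qed.

(** For [|s| <= 1] the right-hand side is nonnegative, and it vanishes for [|s| = 1]: the map
    preserves the closed disc and its boundary. *)
Lemma mobius_cabs2 (a s : R[i]) : nC a < 1 -> cabs2 (1 + a^* * s) - cabs2 (s + a) = (1 - cabs2 a) * (1 - cabs2 s).
Proof. by move=> _; case: a s => [a b] [x y]; rewrite /cabs2 /=; ring. Qed.

Lemma cabs2_le1 (z : R[i]) : (cabs2 z <= 1) = (nC z <= 1).
Proof. by rewrite cabs2_normc -[X in _ <= X](expr1n _ 2) ler_sqr ?nnegrE ?normc_ge0. Qed.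

Lemma mobius_le1 a s : nC a <= 1 -> nC s <= 1 -> nC (mobius a s) <= 1.
Proof.
rewrite /mobius => ha hs; case: ifP => [ha1|//].
have d0 := mobius_den ha1 hs.
rewrite Normc.normcM Normc.normcV ler_pdivrMr ?mul1r; last first.
  by rewrite lt_neqAle normc_ge0 eq_sym andbT; apply: contra d0 => /eqP/Normc.eq0_normc ->.
rewrite -(@ler_sqr R) ?nnegrE ?normc_ge0 // -!cabs2_normc -subr_ge0 mobius_cabs2 //.
by rewrite mulr_ge0 // subr_ge0 cabs2_le1.
Qed.

Lemma mobius_eq1 a s : nC a <= 1 -> nC s = 1 -> nC (mobius a s) = 1.
Proof.
rewrite /mobius => ha hs; case: ifP => [ha1|/negbT]; last by rewrite -leNgt => h; apply/eqP; rewrite eq_le ha.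
have hs' : nC s <= 1 by rewrite hs.
have d0 := mobius_den ha1 hs'.
have n0 : nC (1 + a^* * s) != 0 by apply: contra d0 => /eqP/Normc.eq0_normc ->.
rewrite Normc.normcM Normc.normcV; apply: (mulIf n0); rewrite divfK // mul1r.
apply/eqP; rewrite -(@eqrXn2 _ 2) ?normc_ge0 // -!cabs2_normc eq_sym -subr_eq0 mobius_cabs2 //.
by rewrite [X in _ * (1 - X)]cabs2_normc hs expr1n subrr mulr0.
Qed.

Lemma mobius_row_polydisc l s : polydisc l -> nC s <= 1 -> polydisc (mobius_row l s).
Proof. by move=> sl hs j; rewrite mxE; exact: mobius_le1. Qed.

Lemma mobius_row_torus l s : polydisc l -> nC s = 1 -> torus (mobius_row l s).
Proof. by move=> sl hs j; rewrite mxE; exact: mobius_eq1. Qed.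

Variable D : set (V (n + m)).
Hypothesis oD : open D.
Hypothesis starD : forall l v, polydisc l -> D v -> D (act l v).

Lemma torus_D l v : torus l -> D (act l v) <-> D v.
Proof.
move=> ul; split; last by apply: starD; exact: torus_polydisc.
move=> h; have := starD (polydisc_conj (torus_polydisc ul)) h.
rewrite actA act1 // => j; rewrite !mxE mulJ_cabs2 cabs2_normc ul expr1n.
by apply/eqP; rewrite eq_complex /= !eqxx.
Qed.

Lemma zero_ext_torus (f : V (n + m) -> R[i]^o) l v : torus l -> zero_ext D f (act l v) = zero_ext D (fun v => f (act l v)) v.
Proof.
move=> ul; rewrite /zero_ext; have := torus_D v ul.
by case: asboolP => h1; case: asboolP => h2 // [h3 h4]; [case: h2; exact: h3|case: h1; exact: h4].
Qed.

Lemma dq_mobius_row f l v : holo D f -> polydisc l -> D v ->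
  forall s : R[i]^o, nC s <= 1 -> differentiable (fun s : R[i]^o => f (act (mobius_row l s) v) : R[i]^o) s.
Proof.
move=> hf sl Dv s hs; apply: (@differentiable_compC _ _ _ (fun s : R[i]^o => act (mobius_row l s) v : V (n + m)) f).
  apply: differentiable_act; last exact: differentiable_cst.
  by move=> j; under eq_fun do rewrite mxE; exact: differentiable_mobius.
by apply: hf; apply: starD => //; exact: mobius_row_polydisc.
Qed.

(** Along the analytic disc [s |-> mobius_row l s], the function [f] becomes holomorphic in the
    single variable [s], with value [f (act l v)] at the centre. *)
Lemma average f l v : holo D f -> polydisc l -> D v ->
  cintegrable (@unif01 R) (fun t => f (act (mobius_row l (circle_pt t)) v)) /\
  cint (@unif01 R) (fun t => f (act (mobius_row l (circle_pt t)) v)) = f (act l v).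
Proof.
move=> hf sl Dv; have := cMVP (dq_mobius_row hf sl Dv); by rewrite mobius_row0.
Qed.

Lemma averageN f l v : holo D f -> polydisc l -> D v ->
  cintegrable (@unif01 R) (fun t => f (act (mobius_row l (circle_pt t)^*) v)) /\
  cint (@unif01 R) (fun t => f (act (mobius_row l (circle_pt t)^*) v)) = f (act l v).
Proof.
move=> hf sl Dv; have := cMVPN (dq_mobius_row hf sl Dv); by rewrite mobius_row0.
Qed.

End star.

(* Inside a product [^*] is parsed as [Num.conj]; this normalizes it to [conjc]. *)
Lemma conjCE (R : realType) (z : R[i]) : Num.conj z = conjc z. Proof. by []. Qed.

Lemma integral_unif01_cst (R : realType) (a : \bar R) : (\int[@unif01 R]__ a = a)%E.
Proof. by rewrite integral_cst //= [X in (_ * X)%E](_ : _ = 1%E) ?mule1 //; exact: unif01_setT. Qed.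

Lemma conjc_mulJ (R : realType) (z w : R[i]) : conjc (z * conjc w) = w * conjc z.
Proof. by case: z w => [a b] [c d]; apply/eqP; rewrite eq_complex /=; apply/andP; split; apply/eqP; ring. Qed.

Section mulJ.
Context d (T : measurableType d) (R : realType) (m : {measure set T -> \bar R}).
Implicit Types F G : T -> R[i].
Definition csq F : \bar R := (\int[m]_v (cabs2 (F v))%:E)%E.

Lemma cintegrable_mulJ F G : cmeas F -> cmeas G -> (csq F < +oo)%E -> (csq G < +oo)%E ->
  cintegrable m (fun v => F v * (G v)^*).
Proof.
move=> mF mG sF sG.
have e0 (z : R[i]) : (0 <= (cabs2 z)%:E)%E by rewrite lee_fin cabs2_ge0.
apply: (@cintegrable_dom _ _ _ m _ (fun v => cabs2 (F v) + cabs2 (G v))).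
- by apply: cmeasM => //; exact: cmeas_conj.
- by apply: measurable_funD; exact: cmeas_cabs2.
- by move=> v; exact: cnorm1_mulJ.
under eq_integral do rewrite EFinD.
rewrite ge0_integralD; [exact: lte_add_pinfty|by []| |by apply/measurable_EFinP; exact: cmeas_cabs2| |by apply/measurable_EFinP; exact: cmeas_cabs2].
- by move=> x _; exact: e0.
- by move=> x _; exact: e0.
Qed.

End mulJ.

(** * Multiplication by the polydisc: contraction and adjoint *)

Section sym.
Variables (R : realType) (n m : nat).
Notation V N := ('rV[R[i]]_N : normedModType R[i]).
Notation XN N := (g_sigma_algebraType (@cyl R N)).
Notation mR := (measurableTypeR R).
Notation MU := (mu R (n + m)).
Implicit Types (l k : 'rV[R[i]]_n) (v : 'rV[R[i]]_(n + m)).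
(** The circle with either orientation; conjugation in the adjoint formula exchanges the two. *)
Definition circle_ptb (b : bool) (t : R) : R[i] := if b then circle_pt t else (circle_pt t)^*.

Lemma normc_circle_ptb b t : nC (circle_ptb b t) = 1.
Proof. by rewrite /circle_ptb; case: b; rewrite ?normc_conj normc_circle_pt. Qed.

Lemma circle_ptb_conj b t : (circle_ptb b t)^* = circle_ptb (~~ b) t.
Proof. by rewrite /circle_ptb; case: b => //; exact: conjcK. Qed.

Lemma measurable_joint l b : polydisc l ->
  measurable_fun setT (fun z : XN (n + m) * mR => act (mobius_row l (circle_ptb b z.2)) z.1 : XN (n + m)).
Proof.
move=> sl; apply: measurable_toX; apply: ord_splitP => a.
  under eq_fun do rewrite actE mult_l mxE.
  apply: cmeasM; last exact: (cmeas_comp measurable_fst (@cmeas_coord _ _ _)).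
  apply: (@cmeas_comp _ _ _ _ mR (fun t => mobius (l 0 a) (circle_ptb b t)) snd measurable_snd).
  apply: (@cintegrable_meas _ _ _ (@unif01 R)).
  by rewrite /circle_ptb; case: b; [apply: (cMVP _).1|apply: (cMVPN _).1] => s hs; exact: differentiable_mobius.
under eq_fun do rewrite actE mult_r mul1r.
exact: (cmeas_comp measurable_fst (@cmeas_coord _ _ _)).
Qed.

Variable D : set (V (n + m)).
Hypothesis oD : open D.
Hypothesis starD : forall l v, polydisc l -> D v -> D (act l v).
Let cm f : holo D f -> cmeas (zero_ext D f : XN (n + m) -> R[i]).
Proof. by move=> hf; apply: cmeas_zero_ext => // p Dp; apply: differentiable_continuous; exact: hf. Qed.

Lemma holo_act f l : holo D f -> polydisc l -> holo D (fun v => f (act l v)).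
Proof.
move=> hf sl p Dp; apply: (@differentiable_compC _ _ _ (fun v : V (n + m) => act l v : V (n + m)) f).
  by apply: differentiable_act => // j; exact: differentiable_cstC.
by apply: hf; exact: starD.
Qed.

Lemma averageb f l v b : holo D f -> polydisc l ->
  cintegrable (@unif01 R) (fun t => zero_ext D f (act (mobius_row l (circle_ptb b t)) v)) /\
  cint (@unif01 R) (fun t => zero_ext D f (act (mobius_row l (circle_ptb b t)) v)) = zero_ext D (fun v => f (act l v)) v.
Proof.
move=> hf sl.
have -> : (fun t => zero_ext D f (act (mobius_row l (circle_ptb b t)) v)) =
    (fun t => if `[< D v >] then f (act (mobius_row l (circle_ptb b t)) v) else 0).
  by apply/funext => t; rewrite (zero_ext_torus starD f v (mobius_row_torus sl (normc_circle_ptb b t))).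
rewrite /zero_ext; case: asboolP => Dv.
  by rewrite /circle_ptb; case: b; [exact: (average starD)|exact: (averageN starD)].
split; first by split => /=; exact: integrable0.
by rewrite /cint /Rintegral /= integral0.
Qed.

Notation sqn := (csq MU).
Let cabs2E_ge0 (z : R[i]) : (0 <= (cabs2 z)%:E)%E.
Proof. by rewrite lee_fin cabs2_ge0. Qed.

Lemma sqn_torus (F : XN (n + m) -> R[i]) l : cmeas F -> torus l ->
  (\int[MU]_v (cabs2 (F (act l v)))%:E)%E = sqn F.
Proof.
move=> mF ul; rewrite /csq [RHS](mu_torus ul) ?mul1e //.
by apply/measurable_EFinP; exact: cmeas_cabs2.
Qed.

(** After Tonelli, the multiplier is in the torus for each fixed [t], so the inner integral is the
    same for all [t]. *)
Lemma tonelli_torus (F : XN (n + m) -> R[i]) l b : cmeas F -> polydisc l ->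
  (\int[MU]_v \int[@unif01 R]_t (cabs2 (F (act (mobius_row l (circle_ptb b t)) v)))%:E)%E = sqn F.
Proof.
move=> mF sl; pose g (z : XN (n + m) * mR) := (cabs2 (F (act (mobius_row l (circle_ptb b z.2)) z.1)))%:E.
have mg : measurable_fun setT g.
  apply/measurable_EFinP; apply: cmeas_cabs2.
  exact: (cmeas_comp (measurable_joint b sl) mF).
rewrite -(@tonelli1 _ _ _ _ _ MU (@unif01 R) g mg (fun z => cabs2E_ge0 _)).
rewrite (@tonelli2 _ _ _ _ _ MU (@unif01 R) g mg (fun z => cabs2E_ge0 _)).
rewrite (_ : (fun y => _) = (fun=> sqn F)); last first.
  apply/funext => t; exact: (sqn_torus mF (mobius_row_torus sl (normc_circle_ptb b t))).
by rewrite integral_unif01_cst.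
Qed.

(** Pointwise, [f (act l v)] is an average over the torus and Jensen bounds its square;
    [tonelli_torus] integrates the bound. *)
Lemma contraction f l : holo D f -> polydisc l -> (sqn (zero_ext D (fun v => f (act l v))) <= sqn (zero_ext D f))%E.
Proof.
move=> hf sl; rewrite -(tonelli_torus true (cm hf) sl); apply: ge0_le_integral => //.
- by apply/measurable_EFinP; apply: cmeas_cabs2; apply: cm; exact: holo_act.
- pose g (z : XN (n + m) * mR) := (cabs2 (zero_ext D f (act (mobius_row l (circle_ptb true z.2)) z.1)))%:E.
  apply: (@measurable_fun_fubini_tonelli_F _ _ _ _ _ (@unif01 R) g); last by move=> z; exact: cabs2E_ge0.
  apply/measurable_EFinP; apply: cmeas_cabs2.
  exact: (cmeas_comp (measurable_joint true sl) (cm hf)).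
- move=> v _; have [Iv <-] := averageb v true hf sl; exact: cabs2_cint.
Qed.

Let joint_int (F G : XN (n + m) -> R[i]) l b : cmeas F -> cmeas G -> (sqn F < +oo)%E -> (sqn G < +oo)%E -> polydisc l ->
  cintegrable (prodm MU (@unif01 R)) (fun z : XN (n + m) * mR => F (act (mobius_row l (circle_ptb b z.2)) z.1) * (G z.1)^*).
Proof.
move=> mF mG sF sG sl.
have mj := cmeas_comp (measurable_joint b sl) mF.
have mG1 : cmeas (fun z : XN (n + m) * mR => G z.1) by exact: (cmeas_comp measurable_fst mG).
apply: cintegrable_mulJ => //.
  by rewrite -(tonelli_torus b mF sl) in sF; rewrite /csq tonelli1 //; apply/measurable_EFinP; exact: cmeas_cabs2.
rewrite /csq (@tonelli1 _ _ _ _ _ MU (@unif01 R) (fun z => (cabs2 (G z.1))%:E)); last by move=> z; exact: cabs2E_ge0.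
  by under eq_integral do rewrite /= integral_unif01_cst.
by apply/measurable_EFinP; exact: cmeas_cabs2.
Qed.

(** Both sides are averages over [t] of pairings with a torus multiplier [k]. For such [k] the
    inverse is the conjugate, so a measure-preserving substitution moves [k] from [f] to [g] as its
    conjugate. By [mobius_row_conj] this conjugate lies on the disc of [conj_row l] at the conjugate
    point of the circle. *)
Lemma act_adjoint f g l : holo D f -> holo D g -> (sqn (zero_ext D f) < +oo)%E -> (sqn (zero_ext D g) < +oo)%E -> polydisc l ->
  cint MU (fun v => zero_ext D (fun v => f (act l v)) v * (zero_ext D g v)^*) =
  cint MU (fun v => zero_ext D f v * (zero_ext D (fun v => g (act (conj_row l) v)) v)^*).
Proof.
move=> hf hg sf sg sl; have slc := polydisc_conj sl.
have I1 := joint_int true (cm hf) (cm hg) sf sg sl.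
have I2 := joint_int false (cm hg) (cm hf) sg sf slc.
rewrite (@eq_cint _ (XN (n + m)) R MU _ (fun v => cint (@unif01 R) (fun t => zero_ext D f (act (mobius_row l (circle_ptb true t)) v) * (zero_ext D g v)^*))); last first.
  move=> v; have [Iv <-] := averageb v true hf sl.
  rewrite mulrC -cintZ //; apply: eq_cint => t; exact: mulrC.
rewrite [RHS](@eq_cint _ (XN (n + m)) R MU _ (fun v => cint (@unif01 R) (fun t => (zero_ext D g (act (mobius_row (conj_row l) (circle_ptb false t)) v) * (zero_ext D f v)^* )^*))); last first.
  move=> v; have [Iv <-] := averageb v false hg slc.
  rewrite conjCE -cint_conj // -cintZ; last exact: cintegrable_conj.
  by apply: eq_cint => t; rewrite !conjCE conjc_mulJ.
rewrite (cfubini1 I1) -(cfubini2 I1).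
have I2' := cintegrable_conj I2.
rewrite (cfubini1 I2') -(cfubini2 I2').
apply: eq_cint => t.
have up := mobius_row_torus sl (normc_circle_ptb true t).
have upc : torus (conj_row (mobius_row l (circle_ptb true t))) by move=> j; rewrite mxE normc_conj.
(* Substitution by the conjugate multiplier, which cancels the one inside [f]. *)
rewrite (cint_spush ltr01 (mu_torus upc)); last first.
  have mfa := @cmeas_comp _ _ _ (XN (n + m)) (XN (n + m)) (zero_ext D f) _ (@measurable_act R n m (mobius_row l (circle_ptb true t))) (cm hf).
  apply: cmeasM; first exact: mfa.
  by apply: cmeas_conj; exact: cm.
rewrite mul1r; apply: eq_cint => v; lazy beta iota delta [ssrfun.comp fst snd].
rewrite !conjCE conjc_mulJ actA act1; last first.
  by move=> j; rewrite mxE [conj_row _ _ _]mxE mulrC mulJ_cabs2 cabs2_normc up expr1n.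
by rewrite -mobius_row_conj circle_ptb_conj.
Qed.

End sym.

(** * Bergman spaces as subspaces of [L^2] *)

Section kernel.
Variable R : realType.
Notation V N := ('rV[R[i]]_N : normedModType R[i]).
Notation XN N := (g_sigma_algebraType (@cyl R N)).

Lemma cmeas_holo N (D : set (V N)) (f : V N -> R[i]^o) : open D -> holo D f -> cmeas (zero_ext D f : XN N -> R[i]).
Proof. by move=> oD hf; apply: cmeas_zero_ext => // p Dp; apply: differentiable_continuous; exact: hf. Qed.

Lemma cabs20 : cabs2 (0 : R[i]) = 0.
Proof. by rewrite /cabs2 /= expr0n addr0. Qed.

Lemma L2norm2_csq N (D : set (V N)) (f : V N -> R[i]^o) : open D -> holo D f ->
  L2norm2 D f = csq (mu R N) (zero_ext D f).
Proof.
move=> oD hf; rewrite /L2norm2 /csq.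
have -> : (fun v => (if `[< D v >] then cabs2 (f v) else 0)%:E) = (fun v => (cabs2 (zero_ext D f v))%:E).
  by apply/funext => v; rewrite /zero_ext; case: asboolP => // _; rewrite cabs20.
rewrite int_nonneg_mu // => [|v]; last by rewrite lee_fin cabs2_ge0.
by apply/measurable_EFinP; apply: cmeas_cabs2; exact: cmeas_holo.
Qed.

Lemma A2P N (D : set (V N)) (f : V N -> R[i]^o) : open D ->
  A2 D f <-> holo D f /\ (csq (mu R N) (zero_ext D f) < +oo)%E.
Proof.
move=> oD; split; first by case=> -[_ hf]; rewrite L2norm2_csq.
by case=> hf h; split; [split|rewrite L2norm2_csq].
Qed.

Lemma A2_open N (D : set (V N)) (f : V N -> R[i]^o) : A2 D f -> open D.
Proof. by case=> -[]. Qed.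

Lemma A2_holo N (D : set (V N)) (f : V N -> R[i]^o) : A2 D f -> holo D f.
Proof. by case=> -[]. Qed.

Lemma A2_csq N (D : set (V N)) (f : V N -> R[i]^o) : A2 D f -> (csq (mu R N) (zero_ext D f) < +oo)%E.
Proof. by move=> Af; have /(A2P _ (A2_open Af))[] := Af. Qed.

Lemma cmeas_A2 N (D : set (V N)) (f : V N -> R[i]^o) : A2 D f -> cmeas (zero_ext D f : XN N -> R[i]).
Proof. by move=> Af; exact: (cmeas_holo (A2_open Af) (A2_holo Af)). Qed.

Lemma A2_cintegrable N (D : set (V N)) (f g : V N -> R[i]^o) : A2 D f -> A2 D g ->
  cintegrable (mu R N) (fun v => zero_ext D f v * (zero_ext D g v)^*).
Proof.
by move=> Af Ag; apply: cintegrable_mulJ; [exact: cmeas_A2|exact: cmeas_A2|exact: A2_csq|exact: A2_csq].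
Qed.

Lemma inner_cint N (D : set (V N)) (f g : V N -> R[i]^o) : A2 D f -> A2 D g ->
  inner D f g = cint (mu R N) (fun v => zero_ext D f v * (zero_ext D g v)^*).
Proof.
move=> Af Ag; rewrite -int_C_mu; last exact: A2_cintegrable.
rewrite /inner; congr int_C; apply/funext => v; rewrite /zero_ext.
by case: asboolP => // _; rewrite mul0r.
Qed.

Lemma inner_conj N (D : set (V N)) (f g : V N -> R[i]^o) : A2 D f -> A2 D g ->
  inner D g f = conjc (inner D f g).
Proof.
move=> Af Ag; rewrite !inner_cint // -cint_conj; last exact: A2_cintegrable.
by apply: eq_cint => v; rewrite !conjCE conjc_mulJ.
Qed.

(** Each of [K (., p)] and [K (., q)] is reproduced by the other. *)
Lemma kernel_hermitian N (D : set (V N)) K p q : bergman_kernel D K -> D p -> D q -> K q p = conjc (K p q).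
Proof.
move=> BK Dp Dq; have [Ap hp] := BK _ Dp; have [Aq hq] := BK _ Dq.
by rewrite (hq _ Ap) (hp _ Aq) -inner_conj.
Qed.

Section star.
Variables (n m : nat) (D : set (V (n + m))).
Hypothesis starD : forall l v, polydisc l -> D v -> D (act l v).

Lemma A2_act f l : A2 D f -> polydisc l -> A2 D (fun v => f (act l v)).
Proof.
move=> Af sl; have oD := A2_open Af; apply/(A2P _ oD); split; first exact: (holo_act starD (A2_holo Af)).
by apply: le_lt_trans (A2_csq Af); exact: (contraction oD starD (A2_holo Af)).
Qed.

Lemma conj_rowK (l : 'rV[R[i]]_n) : conj_row (conj_row l) = l.
Proof. by apply/rowP => j; rewrite !mxE conjcK. Qed.

(** The adjoint moves [l] onto [f] as its conjugate; then [K] reproduces the function so obtained at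
    [w0]. *)
Lemma kernel_act K f l w0 : bergman_kernel D K -> D w0 -> A2 D f -> polydisc l ->
  inner D f (fun v => K (act l v) w0) = f (act (conj_row l) w0).
Proof.
move=> BK Dw Af sl; have [AK rK] := BK _ Dw; have oD := A2_open Af.
have slc := polydisc_conj sl.
have Afl := A2_act Af slc.
rewrite inner_cint //; last exact: (A2_act AK sl).
have e1 := act_adjoint oD starD (A2_holo Af) (A2_holo AK) (A2_csq Af) (A2_csq AK) slc.
rewrite conj_rowK in e1; rewrite -e1.
by rewrite -inner_cint // -rK.
Qed.

End star.

End kernel.

Lemma integral_gauss_lt (R : realType) (k : R) (eta : R[i]) : 0 < k ->
  (\int[lebCm R]_p (expR (- k * cabs2 (of_pair p - eta)))%:E < +oo)%E.
Proof.
move=> k0; pose f (p : measurableTypeR R * measurableTypeR R) := (expR (- k * cabs2 (of_pair p - eta)))%:E.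
have mf : measurable_fun setT f.
  apply/measurable_EFinP; apply: (measurableT_comp (@measurable_expR R)).
  apply: measurable_funM; first exact: measurable_cst.
  by apply: cmeas_cabs2; apply: cmeasD; [exact: cmeas_of_pair|exact: cmeas_cst].
have [_ H] := planar_translation (complex.Re eta : measurableTypeR R, complex.Im eta : measurableTypeR R).
rewrite (H f mf (fun p => expR_ge0 _)) mul1e.
pose g (x : measurableTypeR R) := (expR (- k * x))%:E.
have mg : measurable_fun setT g.
  apply/measurable_EFinP; apply: (measurableT_comp (@measurable_expR R)).
  by apply: measurable_funM; [exact: measurable_cst|exact: measurable_id].
rewrite [X in (X < _)%E](_ : _ = (\int[lebCm R]_p g (sqrad p))%E); last first.
  apply: eq_integral => p _; rewrite /f /g /sqrad; congr (expR (- k * cabs2 _))%:E.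
  by case: eta {f mf H} => a b; apply/eqP; rewrite eq_complex /= !addrK !eqxx.
rewrite (integral_rad0 mg (fun x => expR_ge0 _)).
have -> : (\int[@lebesgue_measure R]_(x in `[0%R, +oo[) g x = k^-1%:E)%E.
  have Ie := @integral_exponential_pdf R k k0.
  have e1 : (\int[@lebesgue_measure R]_x (exponential_pdf k x)%:E = k%:E * \int[@lebesgue_measure R]_(x in `[0%R, +oo[) g x)%E.
    rewrite -ge0_integralZl //.
    - rewrite [RHS]integral_mkcond; apply: eq_integral => x _.
      by rewrite /exponential_pdf !patchE; case: ifP.
    - exact: (measurable_funS measurableT).
    - by move=> x _; rewrite lee_fin expR_ge0.
    - by rewrite lee_fin ltW.
  rewrite e1 in Ie; rewrite -[RHS]mule1 -Ie muleA -EFinM mulVf ?mul1e //.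
  by rewrite gt_eqF.
by rewrite -EFinM ltry.
Qed.

(** * Derivatives of tails of integrals *)

Section tail.
Variable R : realType.
Notation leb := (@lebesgue_measure R).
Notation mR := (measurableTypeR R).

Lemma Rintegral_tail (k : mR -> R) (s : R) : measurable_fun setT k -> 0 <= s ->
  leb.-integrable `[0%R, +oo[ (EFin \o k) ->
  (\int[leb]_(x in `[0%R, +oo[) k x - \int[leb]_(x in `[0%R, +oo[) k (x + s) = iseg k 0 s)%R.
Proof.
move=> mk s0 Ik.
have -> : (\int[leb]_(x in `[0%R, +oo[) k (x + s) = \int[leb]_(x in `[s, +oo[) k x)%R.
  rewrite [LHS]Rintegral_mkcond [RHS]Rintegral_mkcond.
  have mks : measurable_fun setT (k \_ `[s, +oo[ : mR -> R).
    apply: (measurable_restrictT k _).1; first exact: (@measurable_itv R (Interval (BLeft s) +oo%O)).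
  exact: (measurable_funS measurableT (@subsetT _ _) mk).
  rewrite (Rintegral_spush _ (@lebesgue_affine R 1 s (oner_neq0 _)) mks) ?normr1 // mul1r.
  congr Rintegral; apply/funext => x; rewrite !patchE mul1r.
  by rewrite !mem_setE !in_itv /= !andbT -lerBlDr subrr.
have sub : [set` Interval (BLeft s) +oo%O] `<=` `[0%R, +oo[%classic.
  by move=> x /=; rewrite !in_itv /= !andbT; exact: le_trans.
have Is : leb.-integrable `[s, +oo[ (EFin \o k) by apply: integrableS Ik.
rewrite -(Rintegral_itv_obnd_cbnd (r := s) (b := +oo%O)); last first.
  by apply: integrableS Is => // x /=; rewrite !in_itv /= !andbT; exact: ltW.
rewrite -(@Rintegral_itvB R k (BLeft 0) +oo%O s) //.
by rewrite opprB addrCA subrr addr0.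
Qed.

(** The difference of the tails is the integral over [[0, s]], which is close to [k' 0 * s].
    Measurability on the line is asked of [k], continuity of [k'], and the two agree only on the
    half-line. *)
Lemma tail_derivative (k k' : mR -> R) : measurable_fun setT k -> leb.-integrable `[0%R, +oo[ (EFin \o k) ->
  (forall x, 0 <= x -> k x = k' x) -> (forall x, 0 <= x -> {for x, continuous (k' : R -> R)}) ->
  forall e : R, 0 < e -> exists2 d : R, 0 < d & forall s : R, 0 <= s < d ->
   `|(\int[leb]_(x in `[0%R, +oo[) k x - \int[leb]_(x in `[0%R, +oo[) k (x + s))%R - k' 0 * s| <= e * s.
Proof.
move=> mk Ik kk' ck e e0.
have /cvgrPdist_le/(_ e e0)[d /= d0 H] := ck 0 (lexx 0).
exists d => // s /andP[s0 sd]; rewrite Rintegral_tail //.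
have -> : iseg k 0 s = iseg k' 0 (0 + s).
  by rewrite /iseg add0r; apply: eq_Rintegral => x; rewrite inE /= in_itv /= => /andP[x0 _]; exact: kk'.
apply: iseg_near => //.
  by move=> x /andP[x0 _]; exact: ck.
move=> x /andP[x0 xs]; rewrite distrC; apply: H; rewrite /ball /= sub0r normrN ger0_norm //.
by rewrite add0r in xs; exact: le_lt_trans sd.
Qed.

Lemma sqrad_integrable (k : mR -> R) : measurable_fun setT k ->
  (lebCm R).-integrable setT (fun p => (k (sqrad p))%:E) -> leb.-integrable `[0%R, +oo[ (EFin \o k).
Proof.
move=> mk /integrableP[_ fin]; apply/integrableP; split.
  by apply/measurable_EFinP; exact: (measurable_funS measurableT (@subsetT _ _) mk).
have mn : measurable_fun setT (fun x => `|(k x)%:E|%E).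
  by apply: measurableT_comp => //; exact/measurable_EFinP.
rewrite (integral_rad0 mn (fun x => abse_ge0 _)) disc_area_pi in fin.
rewrite ltey; apply/eqP => h; move: fin; rewrite h gt0_muley ?ltxx //.
by rewrite lte_fin pi_gt0.
Qed.

Lemma radial_tail_derivative (k : mR -> R[i]) (Q : R[i]^o -> R[i]^o) : cmeas k ->
  cintegrable (lebCm R) (fun p => k (sqrad p)) ->
  (forall x, 0 <= x -> k x = Q x%:C) -> (forall x : R, 0 <= x -> differentiable Q (x%:C : R[i]^o)) ->
  forall e : R, 0 < e -> exists2 d : R, 0 < d & forall s : R, 0 <= s < d ->
   nC (cint (lebCm R) (fun p => k (sqrad p)) - cint (lebCm R) (fun p => k (sqrad p + s)) - (pi * s)%:C * Q 0) <= e * s.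
Proof.
move=> [m1 m2] [I1 I2] kQ dQ e e0.
have CR x : 0 <= x -> CRpt (fun x y => complex.Re (Q (x +i* y))) (fun x y => complex.Im (Q (x +i* y))) x 0.
  by move=> x0; apply: CR_of_differentiable; exact: dQ.
(* The factor [pi] comes from the polar coordinates, the factor 2 from adding the errors of the real
   and the imaginary part. *)
have e1 : 0 < e / (2 * pi) by rewrite divr_gt0 // mulr_gt0 // pi_gt0.
have ck1 x : 0 <= x -> {for x, continuous (fun x : R => complex.Re (Q x%:C) : R)}.
  by move=> x0; exact: (CR_continuous (CR x x0)).2.
have ck2 x : 0 <= x -> {for x, continuous (fun x : R => complex.Im (Q x%:C) : R)}.
  by move=> x0; exact: (CR_continuous (CR_sym (CR x x0))).2.
have q1 x : 0 <= x -> complex.Re (k x) = complex.Re (Q x%:C) by move=> x0; rewrite kQ.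
have q2 x : 0 <= x -> complex.Im (k x) = complex.Im (Q x%:C) by move=> x0; rewrite kQ.
have [d1 d10 H1] := tail_derivative m1 (sqrad_integrable m1 I1) q1 ck1 e1.
have [d2 d20 H2] := tail_derivative m2 (sqrad_integrable m2 I2) q2 ck2 e1.
exists (Num.min d1 d2); first by rewrite lt_min d10.
move=> s /andP[s0]; rewrite lt_min => /andP[sd1 sd2].
have madd : measurable_fun setT (fun x : mR => x + s : mR) by apply: measurable_funD; [exact: measurable_id|exact: measurable_cst].
have := H1 s; rewrite s0 sd1 => /(_ isT) {}H1.
have := H2 s; rewrite s0 sd2 => /(_ isT) {}H2.
rewrite /cint (Rintegral_sqrad m1) (Rintegral_sqrad m2).
rewrite (Rintegral_sqrad (measurableT_comp m1 madd)) (Rintegral_sqrad (measurableT_comp m2 madd)).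
have pi0 : pi != 0 :> R by rewrite gt_eqF // pi_gt0.
move: H1 H2; rewrite -[Q 0]/(Q (0 : R)%:C); case: (Q _) => qa qb; rewrite [complex.Re _]/= [complex.Im _]/=.
move: (\int[_]_(x in _) _)%R (\int[_]_(x in _) _)%R (\int[_]_(x in _) _)%R (\int[_]_(x in _) _)%R => A B C D H1 H2.
have -> : e * s = pi * (e / (2 * pi) * s) + pi * (e / (2 * pi) * s).
  by move: pi0; move: (pi : R) => p p0; field.
have -> : (pi * D +i* (pi * B)) - (pi * C +i* (pi * A)) - (pi * s)%:C * (qa +i* qb) =
  (pi * (D - C - qa * s)) +i* (pi * (B - A - qb * s)) :> R[i].
  by apply/eqP; rewrite eq_complex /=; apply/andP; split; apply/eqP; ring.
apply: le_trans (normc_split _ _) _; rewrite !normrM ger0_norm ?pi_ge0 //.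
by apply: lerD; rewrite ler_wpM2l ?pi_ge0.
Qed.

End tail.

(** * The functions [G_s] and their scalar products *)

Section tower.
Variables (R : realType) (n m : nat) (Om : set 'rV[R[i]]_(n + m)) (gamma : 'rV[R]_n).
Notation V N := ('rV[R[i]]_N : normedModType R[i]).
Notation XN N := (g_sigma_algebraType (@cyl R N)).
Hypothesis starO : star_hartogs Om.
Hypothesis gamma0 : forall j, 0 < gamma 0 j.
Implicit Types (l : 'rV[R[i]]_n) (q v : 'rV[R[i]]_(n + m)).
(** [act (dil c)] is [delta_c]. Complex exponents put the dilations between slices, the multiplier
    [l] and the shift by [s] into one group with additive law [actD]. *)
Definition dil (c : R[i]) : 'rV[R[i]]_n := \row_j cexp ((gamma 0 j)%:C * c).

Lemma Re_rM (a : R) (z : R[i]) : complex.Re (a%:C * z) = a * complex.Re z.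
Proof. by case: z => x y /=; ring. Qed.

Lemma actD (a b : R[i]) v : act (dil a) (act (dil b) v) = act (dil (a + b)) v.
Proof. by rewrite actA; congr act; apply/rowP => j; rewrite !mxE mulrDr cexpD. Qed.

Lemma act0 v : act (dil 0) v = v.
Proof. by apply: act1 => j; rewrite mxE mulr0 cexp0. Qed.

Lemma dil_polydisc (c : R[i]) : complex.Re c <= 0 -> polydisc (dil c).
Proof.
move=> h j; rewrite mxE normc_cexp Re_rM -expR0 ler_expR.
by rewrite mulr_ge0_le0 // ltW.
Qed.

Lemma conj_row_dil c : conj_row (dil c) = dil c^*.
Proof.
apply/rowP => j; rewrite !mxE /cexp; case: c => a b.
apply/eqP; rewrite eq_complex /=.
rewrite !(mul0r, subr0, addr0, oppr0, mulr0, add0r, sub0r, mulrN, cosN, sinN).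
by rewrite !eqxx.
Qed.

Lemma starO_polydisc l v : polydisc l -> Om v -> Om (act l v).
Proof.
move=> sl; rewrite -(hsubmxK v) act_row => Ov; apply: starO => // j.
by rewrite normC_normc lecR; exact: sl.
Qed.

(** A slice depends on [eta] only through [r = |eta|^2 / 2]; the slices are indexed here by this
    number. *)
Definition inO (q : 'rV[R[i]]_(n + m)) (r : R) := Om (act (dil r%:C) q).

(** [delta_(r' + c - r)] multiplies by numbers of modulus at most 1, so star-shapedness applies.
    Membership in a slice is always reduced to this comparison of real parts. *)
Lemma inO_le q (c : R[i]) (r r' : R) : complex.Re c + r' <= r -> inO q r -> inO (act (dil c) q) r'.
Proof.
move=> h; rewrite /inO actD => h1.
have -> : r'%:C + c = (r'%:C + c - r%:C) + r%:C by rewrite subrK.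
rewrite -actD; apply: starO_polydisc => //; apply: dil_polydisc.
by move: h; case: c => a b /=; lra.
Qed.

Lemma Vg_etaE eta q : Vg_eta gamma Om eta q <-> inO q (cabs2 eta / 2).
Proof.
rewrite /Vg_eta /Vg /inO !row_mxKl row_mxKr mxE -[X in act _ X](hsubmxK q) act_row.
have -> : g_gamma gamma (lsubmx q) eta = \row_j (dil (cabs2 eta / 2)%:C 0 j * lsubmx q 0 j) => //.
apply/rowP => j; rewrite !mxE; congr (_ * _); rewrite /cexp; apply/eqP; rewrite eq_complex /=.
by rewrite !(mul0r, subr0, addr0, oppr0, mulr0, add0r, cos0, sin0, mulr1) mulrA !eqxx.
Qed.

Lemma Vg_eta_star eta l v : polydisc l -> Vg_eta gamma Om eta v -> Vg_eta gamma Om eta (act l v).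
Proof.
move=> sl /Vg_etaE h; apply/Vg_etaE; rewrite /inO actA.
have -> : act (\row_j (dil (cabs2 eta / 2)%:C 0 j * l 0 j)) v = act l (act (dil (cabs2 eta / 2)%:C) v).
  by rewrite actA; congr act; apply/rowP => j; rewrite !mxE mulrC.
exact: starO_polydisc.
Qed.

Lemma Vg_eta_dil (w eta c : R[i]) v : complex.Re c + cabs2 w / 2 <= cabs2 eta / 2 ->
  Vg_eta gamma Om eta v -> Vg_eta gamma Om w (act (dil c) v).
Proof. by move=> h /Vg_etaE h1; apply/Vg_etaE; exact: inO_le h1. Qed.

Lemma row_mx_diff (U : normedModType R[i]) (g : U -> V (n + m)) (w : U -> R[i]^o) x : differentiable g x -> differentiable w x ->
  differentiable (fun u => row_mx (g u) (\row_(_ < 1) w u) : V (n + m + 1)) x.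
Proof.
move=> dg dw; apply: differentiable_row => j; rewrite -(splitK j); case: (fintype.split j) => a /=.
  under eq_fun do rewrite row_mxEl.
  exact: (differentiable_compC dg (differentiable_coordC a _)).
by under eq_fun do rewrite row_mxEr mxE.
Qed.

Lemma differentiable_dil (U : normedModType R[i]) (c : U -> R[i]^o) x j : differentiable c x ->
  differentiable (fun u => dil (c u) 0 j : R[i]^o) x.
Proof.
move=> dc; under eq_fun do rewrite mxE.
apply: (@differentiable_compC _ _ _ (fun u => (gamma 0 j)%:C * c u : R[i]^o)); last exact: differentiable_cexp.
by apply: differentiable_mulC => //; exact: differentiable_cstC.
Qed.

Section slices.
Variables (KV : 'rV[R[i]]_(n + m + 1) -> 'rV[R[i]]_(n + m + 1) -> R[i]).
Variables (KE : R[i] -> 'rV[R[i]]_(n + m) -> 'rV[R[i]]_(n + m) -> R[i]).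
Hypothesis BKV : bergman_kernel (Vg gamma Om) KV.
Hypothesis BKE : forall eta, bergman_kernel (Vg_eta gamma Om eta) (KE eta).
Notation VV := (Vg gamma Om).
Notation DD w := (Vg_eta gamma Om w).
Notation MU := (mu R (n + m)).
Notation PM := (prodm MU (lebCm R)).
Definition at_w (w : R[i]) (v : 'rV[R[i]]_(n + m)) : 'rV[R[i]]_(n + m + 1) := row_mx v (\row_(_ < 1) w).

(** For a nonempty slice the openness is contained in the membership of [KE] in its Bergman
    space. *)
Lemma open_slice w : open (DD w : set (V (n + m))).
Proof.
have [[v Dv]|h] := pselect (exists v, DD w v); first exact: (A2_open (BKE Dv).1).
rewrite (_ : DD w = set0); first exact: open0.
by apply/seteqP; split => // v Dv; case: h; exists v.
Qed.

Lemma holo_slice (f : V (n + m + 1) -> R[i]^o) w : holo VV f -> holo (DD w) (fun v => f (at_w w v)).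
Proof.
move=> hf v Dv; apply: (@differentiable_compC _ _ _ (fun v : V (n + m) => at_w w v : V (n + m + 1)) f); last exact: hf.
by apply: row_mx_diff => //; exact: differentiable_cstC.
Qed.

Definition slice_jac (t : R) : R := \prod_j cabs2 (dil (- t)%:C 0 j).

Lemma cexp_neq0 (z : R[i]) : cexp z != 0.
Proof.
apply/eqP => h; have := cexpD z (- z); rewrite h mul0r subrr cexp0 => /eqP.
by rewrite oner_eq0.
Qed.

Lemma slice_jacE t : slice_jac t = expR (- 2 * (\sum_j gamma 0 j) * t).
Proof.
rewrite /slice_jac -mulrA mulrCA mulr_suml expR_sum; apply: eq_bigr => j _.
rewrite cabs2_normc mxE normc_cexp Re_rM -expRM_natl; congr expR => /=; ring.
Qed.

Lemma mu_dil t : @scaled_push_hyp _ _ (XN (n + m)) (XN (n + m)) R MU (act (dil (- t)%:C)) MU (slice_jac t).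
Proof. by apply: mu_act => j; rewrite mxE cexp_neq0. Qed.

(* [delta_(- slice_shift w eta)] maps [V_eta] onto [V_w]. *)
Definition slice_shift (w eta : R[i]) : R := (cabs2 w - cabs2 eta) / 2.

Lemma slice_iff w eta u : DD w (act (dil (- slice_shift w eta)%:C) u) <-> DD eta u.
Proof.
split=> h; last by apply: Vg_eta_dil h => /=; rewrite /slice_shift; lra.
rewrite -(act0 u) -(subrr (- slice_shift w eta)%:C) addrC -actD.
by apply: Vg_eta_dil h => /=; rewrite /slice_shift; lra.
Qed.

Lemma zero_ext_slice F w eta u : zero_ext (DD w) F (act (dil (- slice_shift w eta)%:C) u) =
  zero_ext (DD eta) (fun u => F (act (dil (- slice_shift w eta)%:C) u)) u.
Proof.
rewrite /zero_ext; have := slice_iff w eta u.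
by case: asboolP => h1; case: asboolP => h2 // [h3 h4]; [case: h2; exact: h3|case: h1; exact: h4].
Qed.

Lemma csq_slice (F : V (n + m) -> R[i]^o) w eta : holo (DD w) F ->
  csq MU (zero_ext (DD w) F) = ((slice_jac (slice_shift w eta))%:E * csq MU (zero_ext (DD eta) (fun u => F (act (dil (- slice_shift w eta)%:C) u))))%E.
Proof.
move=> hF; rewrite /csq (mu_dil (slice_shift w eta)); last 2 first.
- by apply/measurable_EFinP; apply: cmeas_cabs2; apply: cmeas_holo => //; exact: open_slice.
- by move=> v; rewrite lee_fin cabs2_ge0.
by congr (_ * _)%E; apply: eq_integral => u _; rewrite zero_ext_slice.
Qed.

(** * Square integrability of the functions [G_c] *)

Section shifted.
Variables (eta : R[i]) (q0 : 'rV[R[i]]_(n + m)).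
Hypothesis Dq : DD eta q0.
Let Keta : V (n + m) -> R[i]^o := fun v => KE eta v q0.
Let AK : A2 (DD eta) Keta. Proof. exact: (BKE Dq).1. Qed.

Notation kap := (\sum_j gamma 0 j).
Implicit Types (c w : R[i]).

Lemma ReB (x y : R[i]) : complex.Re (x - y) = complex.Re x - complex.Re y.
Proof. by case: x y => [a b] [c d]. Qed.

Definition lexp (w : R[i]) : R[i] := w * conjc eta - (cabs2 eta)%:C.
(* [G_c] of the header; [c] is complex so that it can be differentiated in [c]
   with the complex chain rule. *)
Definition shift_kernel (c : R[i]) (w : R[i]) (v : 'rV[R[i]]_(n + m)) : R[i] :=
  cexp (kap%:C * (lexp w - c)) * Keta (act (dil (lexp w - c)) v).
Definition shift_kernelV (c : R[i]) (p : 'rV[R[i]]_(n + m + 1)) : R[i] := shift_kernel c (rsubmx p 0 0) (lsubmx p).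

Lemma shift_kernelV_at c w v : shift_kernelV c (at_w w v) = shift_kernel c w v.
Proof. by rewrite /shift_kernelV row_mxKl row_mxKr mxE. Qed.

(** The completed square behind all estimates of [G_c]. *)
Lemma Re_lexp w : complex.Re (lexp w) = (cabs2 w - cabs2 eta - cabs2 (w - eta)) / 2.
Proof. by rewrite /lexp /cabs2; case: w eta => [a b] [c d] /=; field. Qed.

Lemma open_VV : open (VV : set (V (n + m + 1))).
Proof. by have [/A2_open] := @BKV (at_w eta q0) Dq. Qed.

Lemma shift_kernelV_holo c : 0 <= complex.Re c -> holo VV (shift_kernelV c : V (n + m + 1) -> R[i]^o).
Proof.
move=> c0 p Vp; rewrite /shift_kernelV /shift_kernel.
have dw : differentiable (fun p : V (n + m + 1) => lexp (rsubmx p 0 0) - c : R[i]^o) p.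
  apply: differentiable_addC; last exact: differentiable_cstC.
  apply: differentiable_addC; last exact: differentiable_cstC.
  apply: differentiable_mulC; last exact: differentiable_cstC.
  by under eq_fun do rewrite mxE; exact: differentiable_coordC.
apply: differentiable_mulC.
  apply: (@differentiable_compC _ _ _ (fun p => kap%:C * (lexp (rsubmx p 0 0) - c) : R[i]^o)); last exact: differentiable_cexp.
  by apply: differentiable_mulC => //; exact: differentiable_cstC.
apply: (@differentiable_compC _ _ _ (fun p : V (n + m + 1) => act (dil (lexp (rsubmx p 0 0) - c)) (lsubmx p) : V (n + m)) Keta).
  apply: differentiable_act; first by move=> j; exact: differentiable_dil.
  apply: differentiable_row => j; under eq_fun do rewrite mxE; exact: differentiable_coordC.
apply: (A2_holo AK).
have Dv : DD (rsubmx p 0 0) (lsubmx p).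
  by rewrite /Vg_eta (_ : row_mx _ _ = p) // -[RHS]hsubmxK; congr row_mx; apply/rowP => j; rewrite mxE !ord1.
apply: Vg_eta_dil Dv; rewrite ReB Re_lexp; have := cabs2_ge0 (rsubmx p 0 0 - eta); lra.
Qed.

(** The exponent that is left when [V_w] is carried back to [V_eta]. Its real part is
    [- |w - eta|^2 / 2 - Re c], so for [Re c >= 0] its [dil] is the multiplier [l] in the
    polydisc. *)
Definition slice_exp (c w : R[i]) : R[i] := lexp w - c - (slice_shift w eta)%:C.

Lemma slice_exp_polydisc c w : 0 <= complex.Re c -> polydisc (dil (slice_exp c w)).
Proof.
move=> c0; apply: dil_polydisc; rewrite /slice_exp ReB ReB Re_lexp /slice_shift /=.
have := cabs2_ge0 (w - eta); lra.
Qed.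

Lemma shift_kernel_slice c w u : shift_kernel c w (act (dil (- slice_shift w eta)%:C) u) = cexp (kap%:C * (lexp w - c)) * Keta (act (dil (slice_exp c w)) u).
Proof. by rewrite /shift_kernel actD rmorphN. Qed.

(** The Jacobian of the dilation times the squared modulus of the prefactor is
    [exp (- kap |w - eta|^2 - 2 kap Re c)]; the remaining factor is a contraction of [Keta]. *)
Lemma csq_shift_kernel c w : 0 <= complex.Re c ->
  (csq MU (zero_ext (DD w) (shift_kernel c w)) <= (expR (- kap * cabs2 (w - eta)))%:E * csq MU (zero_ext (DD eta) Keta))%E.
Proof.
move=> c0; have hG : holo (DD w) (shift_kernel c w).
  rewrite (_ : shift_kernel c w = (fun v => shift_kernelV c (at_w w v))); last by apply/funext => v; rewrite shift_kernelV_at.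
  have h := shift_kernelV_holo c0; apply: (@holo_slice (shift_kernelV c) w h).
rewrite (csq_slice eta hG).
rewrite (_ : (fun u => _) = (fun u => cexp (kap%:C * (lexp w - c)) * Keta (act (dil (slice_exp c w)) u))); last first.
  by apply/funext => u; rewrite shift_kernel_slice.
have e1 : csq MU (zero_ext (DD eta) (fun u => cexp (kap%:C * (lexp w - c)) * Keta (act (dil (slice_exp c w)) u))) =
   ((cabs2 (cexp (kap%:C * (lexp w - c))))%:E * csq MU (zero_ext (DD eta) (fun u => Keta (act (dil (slice_exp c w)) u))))%E.
  rewrite /csq -ge0_integralZl //.
  - apply: eq_integral => u _; rewrite -EFinM -cabs2M; congr (cabs2 _)%:E.
    by rewrite /zero_ext; case: asboolP; rewrite // mulr0.
  - apply/measurable_EFinP; apply: cmeas_cabs2; apply: cmeas_holo; first exact: open_slice.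
    apply: holo_act; [exact: Vg_eta_star|exact: (A2_holo AK)|exact: slice_exp_polydisc].
  - by move=> u _; rewrite lee_fin cabs2_ge0.
  - by rewrite lee_fin cabs2_ge0.
rewrite e1 muleA -EFinM; apply: lee_pmul.
- by rewrite lee_fin mulr_ge0 ?cabs2_ge0 // slice_jacE expR_ge0.
- by apply: integral_ge0 => u _; rewrite lee_fin cabs2_ge0.
- rewrite lee_fin slice_jacE cabs2_normc normc_cexp Re_rM -expRM_natl -expRD ler_expR ReB Re_lexp /slice_shift.
  have kc : 0 <= kap * complex.Re c by rewrite mulr_ge0 // sumr_ge0 // => j _; exact: ltW.
  have := kc; lra.
- apply: contraction; [exact: open_slice|exact: Vg_eta_star|exact: (A2_holo AK)|exact: slice_exp_polydisc].
Qed.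

(** Positivity of [kap] makes the Gaussian bound integrable in [w]; this is where [0 < n] enters. *)
Lemma kap_gt0 : (0 < n)%N -> 0 < kap.
Proof. by move=> n0; rewrite (bigD1 (Ordinal n0)) //= ltr_pwDl // sumr_ge0 // => j _; exact: ltW. Qed.

Lemma csq_csnoc (F : XN (n + m + 1) -> R[i]) : cmeas F ->
  csq (mu R (n + m + 1)) F = (\int[lebCm R]_p csq MU (fun v => F (csnoc (v, p))))%E.
Proof.
move=> mF; rewrite /csq (@mu_csnoc R (n + m)); last 2 first.
- by apply/measurable_EFinP; exact: cmeas_cabs2.
- by move=> v; rewrite lee_fin cabs2_ge0.
rewrite mul1e (@tonelli2 _ _ _ _ _ MU (lebCm R) (fun z => (cabs2 (F (csnoc z)))%:E)) //.
- apply/measurable_EFinP; apply: cmeas_cabs2.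
  exact: (cmeas_comp (@measurable_csnoc R _) mF).
- by move=> z; rewrite lee_fin cabs2_ge0.
Qed.

Lemma zero_ext_csnoc (f : V (n + m + 1) -> R[i]^o) v p : zero_ext VV f (csnoc (v, p)) = zero_ext (DD (of_pair p)) (fun v => f (at_w (of_pair p) v)) v.
Proof. by []. Qed.

Lemma shift_kernelV_A2 c : (0 < n)%N -> 0 <= complex.Re c -> A2 VV (shift_kernelV c : V (n + m + 1) -> R[i]^o).
Proof.
move=> n0 c0; apply/(A2P _ open_VV); split; first exact: shift_kernelV_holo.
rewrite csq_csnoc; last by apply: cmeas_holo; [exact: open_VV|exact: shift_kernelV_holo].
have eK : (csq MU (zero_ext (DD eta) Keta) < +oo)%E := A2_csq AK.
have K0 : (0 <= csq MU (zero_ext (DD eta) Keta))%E by apply: integral_ge0 => u _; rewrite lee_fin cabs2_ge0.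
apply: (@le_lt_trans _ _ (\int[lebCm R]_p ((expR (- kap * cabs2 (of_pair p - eta)))%:E * csq MU (zero_ext (DD eta) Keta)))%E).
  have mS : cmeas (fun z : XN (n + m) * (measurableTypeR R * measurableTypeR R) => zero_ext VV (shift_kernelV c) (csnoc z)).
    apply: (cmeas_comp (@measurable_csnoc R _)); apply: cmeas_holo; [exact: open_VV|exact: shift_kernelV_holo].
  apply: ge0_le_integral => //.
  - by move=> p _; apply: integral_ge0 => u _; rewrite lee_fin cabs2_ge0.
  - apply: (@measurable_fun_fubini_tonelli_G _ _ _ _ _ MU (fun z => (cabs2 (zero_ext VV (shift_kernelV c) (csnoc z)))%:E)).
      by apply/measurable_EFinP; exact: cmeas_cabs2.
    by move=> z; rewrite lee_fin cabs2_ge0.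
  - apply: emeasurable_funM; last exact: measurable_cst.
    apply/measurable_EFinP; apply: (measurableT_comp (@measurable_expR R)).
    apply: measurable_funM; first exact: measurable_cst.
    by apply: cmeas_cabs2; apply: cmeasD; [exact: cmeas_of_pair|exact: cmeas_cst].
  - move=> p _; rewrite (_ : (fun v => _) = zero_ext (DD (of_pair p)) (shift_kernel c (of_pair p))); first exact: csq_shift_kernel.
    by apply/funext => v; rewrite zero_ext_csnoc; congr zero_ext; apply/funext => u; rewrite shift_kernelV_at.
have -> : csq MU (zero_ext (DD eta) Keta) = (fine (csq MU (zero_ext (DD eta) Keta)))%:E by rewrite fineK // ge0_fin_numE.
rewrite ge0_integralZr //.
- apply: lte_mul_pinfty; last by rewrite ltry.
    by apply: integral_ge0 => p _; rewrite lee_fin expR_ge0.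
  rewrite ge0_fin_numE; first by apply: integral_gauss_lt; exact: kap_gt0.
  by apply: integral_ge0 => p _; rewrite lee_fin expR_ge0.
- apply/measurable_EFinP; apply: (measurableT_comp (@measurable_expR R)).
  apply: measurable_funM; first exact: measurable_cst.
  by apply: cmeas_cabs2; apply: cmeasD; [exact: cmeas_of_pair|exact: cmeas_cst].
- by rewrite lee_fin fine_ge0.
Qed.

Lemma cexp_conj (z : R[i]) : cexp (conjc z) = conjc (cexp z).
Proof.
case: z => a b; rewrite /cexp; apply/eqP; rewrite eq_complex /= cosN sinN.
by rewrite !(mul0r, subr0, addr0, oppr0, mulr0, add0r, sub0r, mulrN) !eqxx.
Qed.

Lemma cexp_real (x : R) : cexp x%:C = (expR x)%:C.
Proof. by rewrite /cexp /= cos0 sin0 mulr1. Qed.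

Definition dual_exp (s : R) w : R[i] := conjc w * eta - (cabs2 w)%:C - s%:C.

(** The kernel of [V_eta] evaluates at [conj(l) q0], and the dilation carries this point to [V_w];
    their exponents add up to [b]. *)
Lemma dual_exp_slice_exp s w : dual_exp s w = - (slice_shift w eta)%:C + conjc (slice_exp s%:C w).
Proof.
rewrite /dual_exp /slice_exp /lexp /slice_shift /cabs2; case: w eta => [a b] [c d].
by apply/eqP; rewrite eq_complex /=; apply/andP; split; apply/eqP; field.
Qed.

(** The scalar factor in front of [f]: the Jacobian of the dilation times the conjugate of the
    prefactor of [G_s]. *)
Lemma dual_exp_lexp s w : kap%:C * dual_exp s w = (- 2 * kap * slice_shift w eta)%:C + conjc (kap%:C * (lexp w - s%:C)).
Proof.
rewrite /dual_exp /lexp /slice_shift /cabs2; case: w eta => [a b] [c d].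
by apply/eqP; rewrite eq_complex /=; apply/andP; split; apply/eqP; field.
Qed.

(** * Scalar products on a single slice *)

Section pairing.
Variable f : V (n + m + 1) -> R[i]^o.
Hypothesis Af : A2 VV f.
Definition path_val (s : R) w : R[i] := cexp (kap%:C * dual_exp s w) * f (at_w w (act (dil (dual_exp s w)) q0)).
Let h w (u : V (n + m)) : R[i]^o := f (at_w w (act (dil (- slice_shift w eta)%:C) u)).
Let hS w : holo (DD w) (fun v => f (at_w w v)).
Proof. have hf := A2_holo Af; exact: (@holo_slice f w hf). Qed.

Lemma slice_A2 w : (csq MU (zero_ext (DD w) (fun v => f (at_w w v))) < +oo)%E -> A2 (DD eta) (h w).
Proof.
move=> fin; apply: (A2P (h w) (@open_slice eta)).2; split.
  move=> u Du; apply: (@differentiable_compC _ _ _ (fun u : V (n + m) => act (dil (- slice_shift w eta)%:C) u : V (n + m)) (fun v => f (at_w w v))).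
    by apply: differentiable_act => // j; exact: differentiable_cstC.
  by apply: hS; apply/slice_iff.
have e1 := csq_slice eta (@hS w); move: fin; rewrite e1.
rewrite -/(h w); set I := csq _ _.
have I0 : (0 <= I)%E by apply: integral_ge0 => u _; rewrite lee_fin cabs2_ge0.
have J0 : (0 < (slice_jac (slice_shift w eta))%:E)%E by rewrite lte_fin slice_jacE expR_gt0.
by move: I0; case: I => // [r _ _|_]; [rewrite ltry|rewrite gt0_muley].
Qed.

Lemma slice_inner s w : 0 <= s -> (csq MU (zero_ext (DD w) (fun v => f (at_w w v))) < +oo)%E ->
  cint MU (fun v : XN (n + m) => zero_ext (DD w) (fun v => f (at_w w v)) v * conjc (zero_ext (DD w) (shift_kernel s%:C w) v)) = path_val s w.
Proof.
move=> s0 fin; have Ah := slice_A2 fin.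
have J0 : 0 < slice_jac (slice_shift w eta) by rewrite slice_jacE expR_gt0.
have sl : polydisc (dil (slice_exp s%:C w)) by exact: slice_exp_polydisc.
have hG : holo (DD w) (shift_kernel s%:C w).
  rewrite (_ : shift_kernel s%:C w = (fun v => shift_kernelV s%:C (at_w w v))); last by apply/funext => v; rewrite shift_kernelV_at.
  have hh := @shift_kernelV_holo s%:C s0; exact: (@holo_slice (shift_kernelV s%:C) w hh).
rewrite (cint_spush J0 (mu_dil (slice_shift w eta))); last first.
  apply: cmeasM; last apply: cmeas_conj.
    by apply: cmeas_holo; [exact: open_slice|exact: hS].
  by apply: cmeas_holo; [exact: open_slice|exact: hG].
pose C := cexp (kap%:C * (lexp w - s%:C)).
have AKl : A2 (DD eta) (fun u => Keta (act (dil (slice_exp s%:C w)) u)) by apply: A2_act => //; exact: Vg_eta_star.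
rewrite (@eq_cint _ (XN (n + m)) R MU _ (fun u => conjc C * (zero_ext (DD eta) (h w) u * conjc (zero_ext (DD eta) (fun u => Keta (act (dil (slice_exp s%:C w)) u)) u)))); last first.
  move=> u; rewrite /ssrfun.comp !zero_ext_slice.
  rewrite (_ : (fun u => shift_kernel _ _ _) = (fun u => C * Keta (act (dil (slice_exp s%:C w)) u))); last first.
    by apply/funext => u'; rewrite shift_kernel_slice.
  rewrite [X in _ * conjc X](_ : _ = C * zero_ext (DD eta) (fun u => Keta (act (dil (slice_exp s%:C w)) u)) u); last first.
    by rewrite /zero_ext; case: asboolP => // _; rewrite mulr0.
  by rewrite rmorphM mulrCA.
have IK := A2_cintegrable Ah AKl.
rewrite (cintZ _ IK) -(inner_cint Ah AKl).
rewrite (kernel_act _ (@BKE eta) Dq Ah sl); last exact: Vg_eta_star.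
rewrite /h conj_row_dil actD mulrA /path_val.
congr (_ * f (at_w w (act (dil _) q0))); last by rewrite dual_exp_slice_exp rmorphN.
by rewrite dual_exp_lexp cexpD cexp_real cexp_conj slice_jacE.
Qed.

End pairing.

(** * The scalar product with [G_s] as a radial integral *)

Section formula.
Variable f : V (n + m + 1) -> R[i]^o.
Hypothesis Af : A2 VV f.
Hypothesis n0 : (0 < n)%N.
Notation mRR := (measurableTypeR R * measurableTypeR R)%type.

Lemma cmeas_cexp d (T : measurableType d) (F : T -> R[i]) : cmeas F -> cmeas (fun t => cexp (F t)).
Proof.
move=> [m1 m2]; split; rewrite /cexp /=.
  under eq_fun do rewrite mul0r subr0.
  by apply: measurable_funM; [exact: (measurableT_comp (@measurable_expR R))|exact: (measurableT_comp (continuous_measurable_fun (@continuous_cos R)))].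
under eq_fun do rewrite mul0r addr0.
by apply: measurable_funM; [exact: (measurableT_comp (@measurable_expR R))|exact: (measurableT_comp (continuous_measurable_fun (@continuous_sin R)))].
Qed.

Lemma dual_exp_in s w : 0 <= s -> DD w (act (dil (dual_exp s w)) q0).
Proof.
move=> s0; apply: Vg_eta_dil Dq; rewrite /dual_exp; move: s0; rewrite /cabs2; case: w eta => [a b] [c d] /= s0.
have := sqr_ge0 (a - c); have := sqr_ge0 (b - d); rewrite !expr2; nra.
Qed.

Lemma cmeas_path d (T : measurableType d) (g W : T -> R[i]) : cmeas g -> cmeas W ->
  cmeas (fun t => cexp (kap%:C * g t) * zero_ext VV f (at_w (W t) (act (dil (g t)) q0))).
Proof.
move=> mg mW; apply: cmeasM; first by apply: cmeas_cexp; apply: cmeasM => //; exact: cmeas_cst.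
apply: (@cmeas_comp _ _ _ T (XN (n + m + 1)) (zero_ext VV f) (fun t => at_w (W t) (act (dil (g t)) q0))); last exact: cmeas_A2.
apply: measurable_toX => j; rewrite -(splitK j); case: (fintype.split j) => a /=; last first.
  by rewrite (_ : (fun t => _) = W) //; apply/funext => t; rewrite /at_w row_mxEr mxE.
rewrite (_ : (fun t => _) = (fun t => act (dil (g t)) q0 0 a)); last first.
  by apply/funext => t; rewrite /at_w row_mxEl.
move: a; apply: ord_splitP => a.
  under eq_fun do rewrite actE mult_l mxE.
  by apply: cmeasM; [apply: cmeas_cexp; apply: cmeasM => //|]; exact: cmeas_cst.
by under eq_fun do rewrite actE mult_r; exact: cmeas_cst.
Qed.

(** The points at which [f] is taken lie in [V], so the extension by zero changes no value; it
    supplies measurability in [w]. *)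
Lemma path_val_zero_ext s w : 0 <= s -> path_val f s w = cexp (kap%:C * dual_exp s w) * zero_ext VV f (at_w w (act (dil (dual_exp s w)) q0)).
Proof.
move=> s0; rewrite /path_val /zero_ext; case: asboolP => // h; case: h; exact: dual_exp_in.
Qed.

Lemma cmeas_dual_exp (s : R) d (T : measurableType d) (W : T -> R[i]) : cmeas W -> cmeas (fun t => dual_exp s (W t)).
Proof.
move=> mW; rewrite /dual_exp; apply: cmeasD; last exact: cmeas_cst.
apply: cmeasD; first by apply: cmeasM; [exact: cmeas_conj|exact: cmeas_cst].
split => /=; last by rewrite oppr0; exact: measurable_cst.
by apply: (measurableT_comp (@oppr_measurable _ _)) => //; exact: cmeas_cabs2.
Qed.

Lemma cmeas_path_val s : 0 <= s -> cmeas (fun p : mRR => path_val f s (of_pair p)).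
Proof.
move=> s0; under eq_fun do rewrite path_val_zero_ext //.
have m1 : cmeas (fun p : mRR => of_pair p) by exact: cmeas_of_pair.
by apply: cmeas_path => //; exact: cmeas_dual_exp.
Qed.

(** By Tonelli [f] is square integrable on the slice [V_w] for almost every [w], and for these [w]
    the pairing on the slice is given by [slice_inner]. *)
Lemma inner_shift_kernelV s : 0 <= s -> cintegrable (lebCm R) (fun p : mRR => path_val f s (of_pair p)) /\
  inner VV f (shift_kernelV s%:C) = cint (lebCm R) (fun p : mRR => path_val f s (of_pair p)).
Proof.
move=> s0; have AG := @shift_kernelV_A2 s%:C n0 s0.
pose F (z : XN (n + m) * mRR) := zero_ext VV f (csnoc z) * conjc (zero_ext VV (shift_kernelV s%:C) (csnoc z)).
have I0 := A2_cintegrable Af AG.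
have IF : cintegrable PM F.
  exact: (proj1 (cintegrable_spush (@measurable_csnoc R (n + m)) ltr01 (@mu_csnoc R (n + m)) (cintegrable_meas I0)) I0).
have fin : {ae lebCm R, forall p : mRR, (csq MU (fun v => zero_ext VV f (csnoc (v, p))) < +oo)%E}.
  have mS : cmeas (fun z : XN (n + m) * mRR => zero_ext VV f (csnoc z)).
    exact: (cmeas_comp (@measurable_csnoc R _) (cmeas_A2 Af)).
  have ge0 p : (0 <= csq MU (fun v => zero_ext VV f (csnoc (v, p))))%E.
    by apply: integral_ge0 => u _; rewrite lee_fin cabs2_ge0.
  have Ii : (lebCm R).-integrable setT (fun p : mRR => csq MU (fun v => zero_ext VV f (csnoc (v, p)))).
    apply/integrableP; split.
      apply: (@measurable_fun_fubini_tonelli_G _ _ _ _ _ MU (fun z => (cabs2 (zero_ext VV f (csnoc z)))%:E)).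
        by apply/measurable_EFinP; exact: cmeas_cabs2.
      by move=> z; rewrite lee_fin cabs2_ge0.
    under eq_integral do rewrite gee0_abs //.
    by rewrite -(csq_csnoc (cmeas_A2 Af)); exact: A2_csq.
  by apply: filterS (integrable_ae measurableT Ii) => p /(_ Logic.I); rewrite ge0_fin_numE.
have E : {ae lebCm R, forall p : mRR, cint MU (fun v => F (v, p)) = path_val f s (of_pair p)}.
  apply: filterS fin => p finp; rewrite -(slice_inner Af s0) //.
  apply: eq_cint => v; rewrite /F !zero_ext_csnoc; congr (_ * conjc (zero_ext _ _ v)).
  by apply/funext => u; rewrite shift_kernelV_at.
split; first exact: cintegrable_ae (cintegrable_cint2 IF) (cmeas_path_val s0) E.
rewrite (inner_cint Af AG) (cint_spush ltr01 (@mu_csnoc R (n + m)) (cintegrable_meas I0)) mul1r.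
rewrite -(cint_ae _ (cmeas_path_val s0) E); last exact: (cintegrable_meas (cintegrable_cint2 IF)).
exact/esym/(cfubini2 IF).
Qed.

Definition circle_exp (s : R) (x y : R[i]) : R[i] := - s%:C - (cabs2 x)%:C - conjc eta * (y * x).
(* The [zero_ext] makes this measurable on the whole line: for [r < 0] the point
   may leave [V]. *)
Definition radial_val (r : R) : R[i] := cexp (kap%:C * (- r)%:C) * zero_ext VV f (at_w eta (act (dil (- r)%:C) q0)).

Lemma dual_exp_circle_exp s x y : nC y = 1 -> dual_exp s (eta + y * x) = circle_exp s x y.
Proof.
move=> y1; have -> : circle_exp s x y = - s%:C - (cabs2 (y * x))%:C - conjc eta * (y * x).
  by rewrite /circle_exp cabs2M (cabs2_normc y) y1 expr1n mul1r.
move: (y * x) => z; rewrite /dual_exp /cabs2; case: z eta => [a b] [c d].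
by apply/eqP; rewrite eq_complex /=; apply/andP; split; apply/eqP; ring.
Qed.

(** Inside the disc the cross terms in [conj(eta) y x] cancel, and [|y x|^2 <= |x|^2] leaves a sum
    of real parts at most [|eta|^2 / 2]. *)
Lemma circle_exp_in s x y : 0 <= s -> nC y <= 1 -> DD (eta + y * x) (act (dil (circle_exp s x y)) q0).
Proof.
move=> s0 y1; apply: Vg_eta_dil Dq; rewrite /circle_exp.
have h : cabs2 (y * x) <= cabs2 x by rewrite cabs2M ler_piMl ?cabs2_ge0 // cabs2_le1.
rewrite ReB ReB; move: h; move: (y * x) => z h.
have -> : cabs2 (eta + z) = cabs2 eta + cabs2 z + 2 * complex.Re (conjc eta * z).
  by case: z eta {h} => [a b] [c d]; rewrite /cabs2 /=; ring.
have := cabs2_ge0 x; rewrite /=; lra.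
Qed.

Lemma MVP_path s x : 0 <= s ->
  cint (@unif01 R) (fun t => path_val f s (eta + circle_pt t * x)) = radial_val (cabs2 x + s).
Proof.
move=> s0; pose q (y : R[i]^o) : R[i]^o := cexp (kap%:C * circle_exp s x y) * f (at_w (eta + y * x) (act (dil (circle_exp s x y)) q0)).
have dq : forall y : R[i]^o, nC y <= 1 -> differentiable q y.
  move=> y y1; have dy : differentiable (fun y : R[i]^o => y * x : R[i]^o) y.
    by apply: differentiable_mulC => //; exact: differentiable_cstC.
  have dg : differentiable (fun y : R[i]^o => circle_exp s x y : R[i]^o) y.
    rewrite /circle_exp (_ : (fun y => _) = (fun y : R[i]^o => - s%:C - (cabs2 x)%:C + (- conjc eta) * (y * x) : R[i]^o)); last first.
      by apply/funext => u; rewrite mulNr.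
    apply: differentiable_addC; first exact: differentiable_cstC.
    by apply: differentiable_mulC => //; exact: differentiable_cstC.
  apply: differentiable_mulC.
    apply: (@differentiable_compC _ _ _ (fun y : R[i]^o => kap%:C * circle_exp s x y : R[i]^o)); last exact: differentiable_cexp.
    by apply: differentiable_mulC => //; exact: differentiable_cstC.
  apply: (@differentiable_compC _ _ _ (fun y : R[i]^o => at_w (eta + y * x) (act (dil (circle_exp s x y)) q0) : V (n + m + 1)) f).
    apply: (@row_mx_diff _ (fun y : R[i]^o => act (dil (circle_exp s x y)) q0 : V (n + m)) (fun y : R[i]^o => eta + y * x : R[i]^o)).
      by apply: differentiable_act; [move=> j; exact: differentiable_dil|exact: differentiable_cst].
    by apply: differentiable_addC => //; exact: differentiable_cstC.
  by apply: (A2_holo Af); exact: circle_exp_in.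
have [_ h] := cMVP dq.
rewrite (@eq_cint _ _ _ (@unif01 R) _ (fun t => q (circle_pt t))); last first.
  by move=> t; rewrite /path_val /q dual_exp_circle_exp // normc_circle_pt.
have g0 : circle_exp s x 0 = (- (cabs2 x + s))%:C.
  by rewrite /circle_exp mul0r mulr0 subr0; apply/eqP; rewrite eq_complex /=; apply/andP; split; apply/eqP; ring.
rewrite h /q /radial_val mul0r addr0 g0; congr (_ * _).
rewrite /zero_ext; case: asboolP => // H; case: H; rewrite -g0.
have := @circle_exp_in s x 0 s0; rewrite mul0r addr0; apply; by rewrite Normc.normc0.
Qed.

Lemma cint_unif01_cst (c : R[i]) : cint (@unif01 R) (fun _ => c) = c.
Proof.
have dc : forall y : R[i]^o, nC y <= 1 -> differentiable (fun _ : R[i]^o => c : R[i]^o) y by move=> y _; exact: differentiable_cstC.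
by have [_] := cMVP dc.
Qed.

Lemma inner_radial s : 0 <= s -> cintegrable (lebCm R) (fun p : mRR => radial_val (sqrad p + s)) /\
  inner VV f (shift_kernelV s%:C) = cint (lebCm R) (fun p : mRR => radial_val (sqrad p + s)).
Proof.
move=> s0; have [I0 ->] := inner_shift_kernelV s0.
pose P2 (p : mRR) := path_val f s (eta + of_pair p).
have [mt Ht] := planar_translation (complex.Re eta : measurableTypeR R, complex.Im eta : measurableTypeR R).
have m0 := cmeas_path_val s0.
have eP2 : (fun p : mRR => path_val f s (of_pair p)) \o (fun z : mRR => (z.1 + complex.Re eta, z.2 + complex.Im eta)) = P2.
  apply/funext => -[a b]; rewrite /P2 /ssrfun.comp; congr (path_val f s _).
  by case: eta => c d; apply/eqP; rewrite eq_complex /= ![_ + a]addrC ![_ + b]addrC !eqxx.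
have IP2 : cintegrable (lebCm R) P2.
  by rewrite -eP2; exact: (proj1 (cintegrable_spush mt ltr01 Ht m0) I0).
have -> : cint (lebCm R) (fun p : mRR => path_val f s (of_pair p)) = cint (lebCm R) P2.
  by rewrite (cint_spush ltr01 Ht m0) mul1r -eP2.
have mP2 := cintegrable_meas IP2.
have circ0 t : circle_pt t != 0 :> R[i] by apply: normc_neq0; exact: normc_circle_pt.
have J1 t : cabs2 (circle_pt t : R[i]) = 1 by rewrite cabs2_normc normc_circle_pt expr1n.
pose F (z : mRR * measurableTypeR R) := path_val f s (eta + circle_pt z.2 * of_pair z.1).
have mF : cmeas F.
  rewrite /F; under eq_fun do rewrite path_val_zero_ext //.
  have mW : cmeas (fun z : mRR * measurableTypeR R => eta + circle_pt z.2 * of_pair z.1).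
    apply: cmeasD; first exact: cmeas_cst.
    apply: cmeasM; first exact: (cmeas_comp measurable_snd (@cmeas_circle_pt R)).
    exact: cmeas_of_pair.
  by apply: cmeas_path => //; exact: cmeas_dual_exp.
have FP2 p t : F (p, t) = P2 (cmulp (circle_pt t) p) by rewrite /P2 of_pair_cmulp.
have mc1 : measurable_fun setT (fun z => (cnorm1 (F z))%:E) by apply/measurable_EFinP; exact: cmeas_cnorm1.
have mc2 : measurable_fun setT (fun z => (cnorm1 (P2 z))%:E) by apply/measurable_EFinP; exact: cmeas_cnorm1.
have c10 (z : R[i]) : (0 <= (cnorm1 z)%:E)%E by rewrite lee_fin cnorm1_ge0.
(* Integrating in the plane first, rotation invariance makes the integral of the norm independent of
   [t], hence its average is finite. *)
have IF : cintegrable (prodm (lebCm R) (@unif01 R)) F.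
  apply: (cintegrable_prod mF).
  rewrite -(@tonelli1 _ _ _ _ _ (lebCm R) (@unif01 R) _ mc1 (fun z => c10 _)).
  rewrite (@tonelli2 _ _ _ _ _ (lebCm R) (@unif01 R) _ mc1 (fun z => c10 _)).
  rewrite (_ : (fun y => _) = (fun=> \int[lebCm R]_p (cnorm1 (P2 p))%:E)%E); last first.
    apply/funext => t; have [_ H] := planar_cmulp (circ0 t).
    rewrite [RHS](H _ mc2 (fun z => c10 _)) J1 mul1e.
    by apply: eq_integral => p _; rewrite FP2.
  by rewrite integral_unif01_cst; exact: cintegrable_cnorm1.
have E (p : mRR) : cint (@unif01 R) (fun t => F (p, t)) = radial_val (sqrad p + s) := MVP_path (of_pair p) s0.
split.
  have := cintegrable_cint IF.
  by rewrite (_ : (fun x => _) = (fun p : mRR => radial_val (sqrad p + s))) //; apply/funext => p; exact: E.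
(* The integral is replaced by its own average over [t]; rotating the plane by [circle_pt t] then
   puts [t] inside. *)
rewrite -(cint_unif01_cst (cint (lebCm R) P2)).
rewrite (@eq_cint _ _ _ (@unif01 R) _ (fun t => cint (lebCm R) (fun p => F (p, t)))); last first.
  move=> t; have [_ H] := planar_cmulp (circ0 t).
  have J0 : 0 < cabs2 (circle_pt t : R[i]) by rewrite J1.
  rewrite (cint_spush J0 H mP2) J1 mul1r; apply: eq_cint => p.
  by rewrite FP2.
by rewrite (cfubini2 IF) -(cfubini1 IF); apply: eq_cint => p; exact: E.
Qed.

Lemma inner_derivative (e : R) : 0 < e -> exists2 d : R, 0 < d & forall s : R, 0 <= s < d ->
  nC (inner VV f (shift_kernelV 0) - inner VV f (shift_kernelV s%:C) - (pi * s)%:C * f (at_w eta q0)) <= e * s.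
Proof.
have [I0 E0] := inner_radial (lexx 0).
(* [Q] agrees with [radial_val] on the half-line and is free of its case distinction, hence
   differentiable there. *)
pose Q (x : R[i]^o) : R[i]^o := cexp (kap%:C * (- x)) * f (at_w eta (act (dil (- x)) q0)).
have mk : cmeas (radial_val : measurableTypeR R -> R[i]).
  apply: (@cmeas_path _ (measurableTypeR R) (fun r : R => (- r)%:C) (fun _ => eta)); last exact: cmeas_cst.
  by split => /=; [exact: oppr_measurable|exact: measurable_cst].
have in0 (x : R) : 0 <= x -> DD eta (act (dil (- x%:C)) q0).
  by move=> x0; apply: Vg_eta_dil Dq => /=; lra.
have kQ (x : R) : 0 <= x -> radial_val x = Q x%:C.
  move=> x0; rewrite /radial_val /Q rmorphN /zero_ext; case: asboolP => // h; case: h; exact: in0.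
have dQ (x : R) : 0 <= x -> differentiable Q (x%:C : R[i]^o).
  move=> x0; have dN : differentiable (fun y : R[i]^o => - y : R[i]^o) (x%:C : R[i]^o) by exact: differentiableN.
  apply: differentiable_mulC.
    apply: (@differentiable_compC _ _ _ (fun y : R[i]^o => kap%:C * (- y) : R[i]^o)); last exact: differentiable_cexp.
    by apply: differentiable_mulC => //; exact: differentiable_cstC.
  apply: (@differentiable_compC _ _ _ (fun y : R[i]^o => at_w eta (act (dil (- y)) q0) : V (n + m + 1)) f).
    apply: (@row_mx_diff _ (fun y : R[i]^o => act (dil (- y)) q0 : V (n + m)) (fun y : R[i]^o => eta : R[i]^o)).
      by apply: differentiable_act; [move=> j; exact: differentiable_dil|exact: differentiable_cst].
    exact: differentiable_cstC.
  by apply: (A2_holo Af); exact: in0.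
have Ik : cintegrable (lebCm R) (fun p : mRR => radial_val (sqrad p)).
  by rewrite (_ : (fun p => _) = (fun p : mRR => radial_val (sqrad p + 0))) //; apply/funext => p; rewrite addr0.
move=> e0; have [d d0 H] := radial_tail_derivative mk Ik kQ dQ e0.
exists d => // s sd; have := H s sd; have /andP[s0 _] := sd.
have [_ ->] := inner_radial s0; rewrite E0.
rewrite (_ : (fun p : mRR => radial_val (sqrad p + 0)) = (fun p : mRR => radial_val (sqrad p))); last by apply/funext => p; rewrite addr0.
by rewrite /Q !oppr0 mulr0 cexp0 mul1r act0.
Qed.

End formula.

(** Conjugating the expansion of [<f, G_s>] for [f = KV (., p)] turns [f (q0, eta)] into
    [KV p (at_w eta q0)], by Hermitian symmetry. *)
Lemma kernel_derivative w v0 (e : R) : (0 < n)%N -> DD w v0 -> 0 < e -> exists2 d : R, 0 < d & forall s : R, 0 <= s < d ->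
  nC (shift_kernel 0 w v0 - shift_kernel s%:C w v0 - (pi * s)%:C * KV (at_w w v0) (at_w eta q0)) <= e * s.
Proof.
move=> n0 Dv e0; have [Ap rp] := @BKV (at_w w v0) Dv.
have [d d0 H] := inner_derivative Ap n0 e0; exists d => // s sd; have /andP[s0 _] := sd.
have E (t : R) : 0 <= t -> inner VV (fun z => KV z (at_w w v0)) (shift_kernelV t%:C) = conjc (shift_kernel t%:C w v0).
  move=> t0; have At := @shift_kernelV_A2 t%:C n0 t0.
  by rewrite (inner_conj At Ap) -(rp _ At) shift_kernelV_at.
have := H s sd; rewrite (E 0) // (E s) // (kernel_hermitian BKV Dv Dq).
rewrite -normc_conj; congr (nC _ <= _).
have CL (x y z : R[i]) (r : R) : conjc (conjc x - conjc y - r%:C * conjc z) = x - y - r%:C * z.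
  by case: x y z => [x1 x2] [y1 y2] [z1 z2]; apply/eqP; rewrite eq_complex /=; apply/andP; split; apply/eqP; ring.
exact: CL.
Qed.

(** * The complex derivative of [G_c] in [c] *)

Section derivative.
Variables (w : R[i]) (z : V n) (z' : 'rV[R[i]]_m).
Hypothesis Dz : DD w (row_mx z z').
Definition slice_kernel (u : V n) : R[i]^o := Keta (act (dil (lexp w)) (row_mx u z')).
(** By additivity of the exponents, subtracting [t] moves [z] along the curve with coordinates
    [exp (- gamma_j t) z_j], whose velocity at 0 is [- gamma_j z_j]. *)
Let cc (t : R[i]^o) : V n := \row_j (cexp (- (gamma 0 j)%:C * t + 0) * z 0 j).
Let shift_kernelE t : shift_kernel t w (row_mx z z') = cexp (- kap%:C * t + kap%:C * lexp w) * slice_kernel (cc t).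
Proof.
rewrite /shift_kernel /slice_kernel; congr (cexp _ * _); first by ring.
rewrite -actD; congr (Keta (act _ _)); rewrite act_row; congr row_mx.
by apply/rowP => j; rewrite !mxE; congr (cexp _ * _); ring.
Qed.

Let cc0 : cc 0 = z.
Proof. by apply/rowP => j; rewrite mxE mulr0 addr0 cexp0 mul1r. Qed.

Let dF : differentiable slice_kernel z.
Proof.
apply: (@differentiable_compC _ _ _ (fun u : V n => act (dil (lexp w)) (row_mx u z') : V (n + m)) Keta).
  apply: differentiable_act; first by move=> j; exact: differentiable_cstC.
  apply: differentiable_row; apply: ord_splitP => a.
    by under eq_fun do rewrite row_mxEl; exact: differentiable_coordC.
  by under eq_fun do rewrite row_mxEr; exact: differentiable_cstC.
apply: (A2_holo AK); apply: Vg_eta_dil Dz; rewrite Re_lexp.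
by have := cabs2_ge0 (w - eta); lra.
Qed.

Let dcj j : is_derive (0 : R[i]^o) (1 : R[i]^o) (fun t => cc t 0 j : R[i]^o) (- (gamma 0 j)%:C * z 0 j).
Proof.
have h := is_derive_cexp_affine (- (gamma 0 j)%:C) 0 (0 : R[i]^o).
have h2 := @is_deriveZ _ _ _ _ (z 0 j) _ _ _ h.
rewrite mulr0 addr0 cexp0 mulr1 in h2.
suff [-> ->] : (fun t => cc t 0 j : R[i]^o) = (z 0 j \*: (fun t : R[i]^o => cexp (- (gamma 0 j)%:C * t + 0) : R[i]^o)) /\
   - (gamma 0 j)%:C * z 0 j = z 0 j *: (- (gamma 0 j)%:C : R[i]^o) by exact: h2.
by split; [apply/funext => t; rewrite mxE mulrC|rewrite mulrC].
Qed.

Let dcc : differentiable cc 0.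
Proof. by apply: differentiable_row => j; apply/derivable1_diffP; have [] := dcj j. Qed.

Let dccE : 'd cc (0 : R[i]^o) (1 : R[i]^o) = \sum_j (- (gamma 0 j)%:C * z 0 j) *: (delta_mx 0 j : V n).
Proof.
apply/rowP => k; rewrite summxE (bigD1 k) //= big1 ?addr0; last first.
  by move=> j jk; rewrite !mxE [k == j]eq_sym (negbTE jk) andbF mulr0.
rewrite !mxE !eqxx mulr1; have [_ <-] := dcj k.
have @co : {linear V n -> R[i]^o}.
  by exists (fun v : V n => v 0 k : R[i]^o); do 2![eexists]; do ?[constructor];
     rewrite ?mxE// => ? *; rewrite ?mxE//; move=> ?; rewrite !mxE.
have cco : continuous co by exact: coord_continuous.
rewrite deriveE; last exact: (differentiable_compC dcc (differentiable_coordC _ _)).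
have dco : differentiable co (cc 0) by exact: differentiable_coordC.
have E := diff_comp dcc dco.
rewrite (diff_lin _ cco) in E.
have := congr1 (fun g : R[i]^o -> R[i]^o => g 1) E.
by move=> /= ->.
Qed.

(** The product rule produces the two parts of [D_V]: the prefactor gives [kap], the sum of the
    [gamma_j] in front of the identity, and the chain rule along [cc] gives the terms in [z_j] times
    the derivative in [z_j]. *)
Lemma derive_shift_kernel : derivable (fun t : R[i]^o => shift_kernel t w (row_mx z z') : R[i]^o) 0 1 /\
  'D_1 (fun t : R[i]^o => shift_kernel t w (row_mx z z') : R[i]^o) 0 =
  - (cexp (kap%:C * lexp w) * \sum_j (gamma 0 j)%:C * (slice_kernel z + z 0 j * ('D_(delta_mx 0 j) slice_kernel z : R[i]^o))).
Proof.
have dFc : differentiable (slice_kernel \o cc) 0 by apply: differentiable_comp; rewrite ?cc0.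
have D1 : is_derive (0 : R[i]^o) (1 : R[i]^o) (slice_kernel \o cc : R[i]^o -> R[i]^o) (- \sum_j (gamma 0 j)%:C * z 0 j * ('D_(delta_mx 0 j) slice_kernel z : R[i]^o)).
  apply: DeriveDef; first exact/derivable1_diffP.
  rewrite deriveE // diff_comp ?cc0 //= dccE linear_sum -sumrN; apply: eq_bigr => j _.
  by rewrite linearZ /= deriveE // /GRing.scale /= !mulNr.
have D2 := is_derive_cexp_affine (- kap%:C) (kap%:C * lexp w) (0 : R[i]^o).
have D3 := is_deriveM D2 D1.
rewrite (_ : (fun t => _) = (fun t : R[i]^o => cexp (- kap%:C * t + kap%:C * lexp w) : R[i]^o) * (slice_kernel \o cc)); last first.
  by apply/funext => t; rewrite shift_kernelE.
split; first by case: D3.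
have [_ ->] := D3.
rewrite /= cc0 mulr0 add0r /GRing.scale /=.
have -> : \sum_(j < n) (gamma 0 j)%:C * (slice_kernel z + z 0 j * ('D_(delta_mx 0 j) slice_kernel z : R[i]^o)) =
    kap%:C * slice_kernel z + \sum_(j < n) (gamma 0 j)%:C * z 0 j * ('D_(delta_mx 0 j) slice_kernel z : R[i]^o) :> R[i].
  rewrite rmorph_sum mulr_suml -big_split; apply: eq_bigr => j _ /=.
  by rewrite -mulrA -mulrDr.
have A (a b c d : R[i]) : d * - a + c * (- b * d) = - (d * (b * c + a)) by ring.
exact: A.
Qed.

End derivative.

(** For small real [s > 0] the same difference of [G_0] and [G_s] is [s * L] by the complex
    derivative and [pi * s * Kp] by the scalar products, both up to [e / 2 * s]. Hence [L - pi * Kp]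
    has modulus at most every [e > 0]. *)
Lemma kernel_formula w (z : V n) (z' : 'rV[R[i]]_m) : (0 < n)%N -> DD w (row_mx z z') ->
  KV (at_w w (row_mx z z')) (at_w eta q0) =
  cexp (kap%:C * lexp w) / pi%:C * \sum_j (gamma 0 j)%:C * (slice_kernel w z' z + z 0 j * ('D_(delta_mx 0 j) (slice_kernel w z') z : R[i]^o)).
Proof.
move=> n0 Dz; have [dG DG] := derive_shift_kernel Dz.
move: DG; set L := cexp _ * _ => DG; set Kp := KV _ _.
have pi0 : pi%:C != 0 :> R[i] by rewrite (inj_eq (@complexI R)) gt_eqF // pi_gt0.
suff H : nC (L - pi%:C * Kp) = 0.
  have := Normc.eq0_normc H => /eqP; rewrite subr_eq0 => /eqP E.
  by rewrite mulrAC -/L E mulrC mulKf.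
apply/eqP; rewrite eq_le normc_ge0 andbT; apply/ler_addgt0Pr => e e0; rewrite add0r.
have e20 : 0 < e / 2 by rewrite divr_gt0.
have [d1 d10 H1] := kernel_derivative n0 Dz e20.
have [d2 d20 H2] := derive_eps dG e20.
pose s := Num.min d1 d2 / 2.
have mn : 0 < Num.min d1 d2 by rewrite lt_min d10.
have s0 : 0 < s by rewrite divr_gt0.
have sm : s < Num.min d1 d2 by rewrite ltr_pdivrMr // ltr_pMr // ltr1n.
move: sm; rewrite lt_min => /andP[sd1 sd2].
have nCs : nC (s%:C : R[i]) = s by rewrite /= expr0n addr0 sqrtr_sqr ger0_norm // ltW.
have := H1 s; rewrite (ltW s0) sd1 => /(_ isT) A1.
have := H2 s%:C; rewrite nCs sd2 => /(_ isT); rewrite add0r DG => A2.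
rewrite -(@ler_pM2l _ s) // -[X in X * nC _]nCs -Normc.normcM.
have -> : s%:C * (L - pi%:C * Kp) = (shift_kernel 0 w (row_mx z z') - shift_kernel s%:C w (row_mx z z') - (pi * s)%:C * Kp) +
   (shift_kernel s%:C w (row_mx z z') - shift_kernel 0 w (row_mx z z') - - L * s%:C).
  have E (a b c d p t : R[i]) : t * (c - p * d) = a - b - p * t * d + (b - a - - c * t) by ring.
  have -> : (pi * s)%:C = pi%:C * s%:C :> R[i] by exact: (rmorphM (real_complex R)).
  exact: E.
apply: (le_trans (le_normcD _ _)); apply: (le_trans (lerD A1 A2)).
by rewrite le_eqVlt; apply/orP; left; apply/eqP; field.
Qed.

End shifted.

End slices.
End tower.

Local Close Scope classical_set_scope.

Theorem theorem2 (R : realType) (n m : nat) (Om : set 'rV[R[i]]_(n + m))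
  (gamma : 'rV[R]_n)
  (KV : 'rV[R[i]]_(n + m + 1) -> 'rV[R[i]]_(n + m + 1) -> R[i])
  (KE : R[i] -> 'rV[R[i]]_(n + m) -> 'rV[R[i]]_(n + m) -> R[i]) :
  (0 < n)%N -> domain Om -> star_hartogs Om ->
  (forall j, 0 < gamma 0 j) ->
  bergman_kernel (Vg gamma Om) KV ->
  (forall eta, bergman_kernel (Vg_eta gamma Om eta) (KE eta)) ->
  forall (z zeta : 'rV[R[i]]_n) (z' zeta' : 'rV[R[i]]_m) (w eta : R[i]),
    Vg gamma Om (pt z z' w) -> Vg gamma Om (pt zeta zeta' eta) ->
    KV (pt z z' w) (pt zeta zeta' eta) =
    DV gamma w eta
      (fun u : 'rV[R[i]]_n => KE eta (row_mx (lmap gamma u w eta) z') (row_mx zeta zeta'))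
      z.
Proof.
move=> n0 _ starO gamma0 BKV BKE z zeta z' zeta' w eta Vz Vzeta.
rewrite [LHS](kernel_formula starO gamma0 BKV BKE (Vzeta : Vg_eta gamma Om eta (row_mx zeta zeta')) n0 Vz).
(* What remains is that [lmap] is [delta_(a(w))] acting on the first [n] coordinates. *)
suff -> : (fun u : 'rV[R[i]]_n => KE eta (row_mx (lmap gamma u w eta) z') (row_mx zeta zeta')) =
  slice_kernel gamma KE eta (row_mx zeta zeta') w z' by [].
apply/funext => u; rewrite /slice_kernel act_row; congr (KE eta (row_mx _ z') _).
by apply/rowP => j; rewrite !mxE mulrC.
Qed.
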